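(* The $k$-list coloring reconfiguration problem can be solved in polynomial time for graphs of pathwidth one.
   Context: Let $C=\{c_1,\dots,c_k\}$ be a set of $k$ colors. For a graph $G=(V,E)$ with a list $L(v)\subseteq C$ for each $v\in V$, a $k$-list coloring of $G$ is a map $f:V\to C$ with $f(v)\in L(v)$ for all $v$ and $f(v)\neq f(w)$ for every edge $vw\in E$. The reconfiguration graph $R(G,L)$ has the $k$-list colorings of $G$ as nodes, two colorings being adjacent iff they differ on exactly one vertex. The $k$-list coloring reconfiguration problem: given $G$, $L$ and two $k$-list colorings $f_0,f_r$ of $G$, decide whether $R(G,L)$ contains a path from $f_0$ to $f_r$. A path-decomposition of $G$ is a sequence of vertex subsets $X_1,\dots,X_m$ with $\bigcup_i X_i=V(G)$, every edge contained in some $X_i$, and $X_p\cap X_r\subseteq X_q$ whenever $p\le q\le r$; its width is $\max_i|X_i|-1$, and the pathwidth of $G$ is the minimum width of a path-decomposition. *)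

(* Defs.v *)
From HB Require Import structures.
From mathcomp Require Import all_boot all_order all_algebra.
Set Implicit Arguments.
Unset Strict Implicit.
Unset Printing Implicit Defensive.

Record sgraph (T : finType) := SGraph {
  adj :> rel T;
  adj_sym : symmetric adj;
  adj_irr : irreflexive adj
}.

Section PathDecomposition.
Variables (T : finType) (G : sgraph T).

Definition path_decomposition (s : seq {set T}) : Prop :=
  [/\ \bigcup_(X <- s) X = [set: T],
      forall u v, G u v -> exists2 X, X \in s & (u \in X) && (v \in X)
    & forall p q r, p <= q -> q <= r -> r < size s ->
        nth set0 s p :&: nth set0 s r \subset nth set0 s q].

(* An integer, since the graph without vertices has a decomposition of
   width -1. *)
Definition width (s : seq {set T}) : int :=
  ((\max_(X <- s) #|X|)%:Z - 1)%R.

Definition has_pathwidth (w : int) : Prop :=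
  (exists2 s, path_decomposition s & width s = w) /\
  (forall s, path_decomposition s -> (w <= width s)%R).

End PathDecomposition.

Section ListColoring.
Variables (T : finType) (k : nat) (G : sgraph T) (L : {ffun T -> {set 'I_k}}).

Definition list_coloring (f : {ffun T -> 'I_k}) : bool :=
  [forall v, f v \in L v] && [forall v, forall w, G v w ==> (f v != f w)].

Definition reconf_adj : rel {ffun T -> 'I_k} := fun f g =>
  [&& list_coloring f, list_coloring g & #|[set v | f v != g v]| == 1].

End ListColoring.

(* The number k of colors is part of the instance. *)
Record instance := Instance {
  nv : nat;
  nc : nat;
  graph : sgraph 'I_nv;
  lists : {ffun 'I_nv -> {set 'I_nc}};
  col0 : {ffun 'I_nv -> 'I_nc};
  colr : {ffun 'I_nv -> 'I_nc};
  col0P : list_coloring graph lists col0;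
  colrP : list_coloring graph lists colr
}.

Definition reconfigurable (I : instance) : bool :=
  connect (reconf_adj (graph I) (lists I)) (col0 I) (colr I).

(* 1^n 0 1^k 0, followed by the n x n adjacency matrix and three n x k
   matrices, row by row: the characteristic vectors of the lists, and the two
   colorings with one 1 in each row.  The length is
   n + k + 2 + n^2 + 3nk. *)
Definition encode (I : instance) : seq bool :=
  nseq (nv I) true ++ [:: false] ++ nseq (nc I) true ++ [:: false] ++
  [seq graph I u v | u <- enum 'I_(nv I), v <- enum 'I_(nv I)] ++
  [seq c \in lists I v | v <- enum 'I_(nv I), c <- enum 'I_(nc I)] ++
  [seq col0 I v == c | v <- enum 'I_(nv I), c <- enum 'I_(nc I)] ++
  [seq colr I v == c | v <- enum 'I_(nv I), c <- enum 'I_(nc I)].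

Inductive move := MoveL | MoveN | MoveR.

(* Symbols: None is the blank, Some (inl b) an input bit, Some (inr a) a work
   symbol of the machine. *)
Definition symbol (W : finType) : finType := option (bool + W)%type.

(* [tleft] is read from the head outwards; all cells not listed are blank. *)
Record tape (A : Type) := Tape { tleft : seq A; thead : A; tright : seq A }.

Definition act_tape (A : Type) (blank : A) (am : A * move) (t : tape A) :
    tape A :=
  let: (a, m) := am in
  let: Tape l _ r := t in
  match m with
  | MoveL => Tape (behead l) (head blank l) (a :: r)
  | MoveN => Tape l a r
  | MoveR => Tape (a :: l) (head blank r) (behead r)
  end.

(* Deterministic Turing machines with [work_tapes.+1] two-way infinite tapes. *)
Record machine := Machine {
  work_tapes : nat;
  work_sym : finType;
  state : finType;
  start : state;
  (* Some b in the halting states with answer b, None in the other states *)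
  verdict : state -> option bool;
  trans : state -> {ffun 'I_work_tapes.+1 -> symbol work_sym} ->
          state * ('I_work_tapes.+1 -> symbol work_sym * move)
}.

Section Run.
Variable M : machine.

Record config := Config {
  cstate : state M;
  ctapes : 'I_(work_tapes M).+1 -> tape (symbol (work_sym M))
}.

Definition step (c : config) : config :=
  if verdict (cstate c) is Some _ then c
  else
    let: (q, act) := trans (cstate c) [ffun i => thead (ctapes c i)] in
    Config q (fun i => act_tape None (act i) (ctapes c i)).

(* Tape 0 holds the input, with the head on its first bit. *)
Definition init (w : seq bool) : config :=
  let s := [seq Some (inl b) | b <- w] in
  Config (start M)
    (fun i => if i == ord0 then Tape [::] (head None s) (behead s)
              else Tape [::] None [::]).

Definition halts_within (w : seq bool) (n : nat) (b : bool) : Prop :=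
  exists2 t, t <= n & verdict (cstate (iter t step (init w))) = Some b.

End Run.

(* Nothing is required of the machine on words that do not encode an instance
   satisfying [promise]. *)
Definition polytime_solvable (I : Type) (enc : I -> seq bool)
    (promise : I -> Prop) (answer : I -> bool) : Prop :=
  exists (M : machine) (p : {poly nat}), forall x, promise x ->
    halts_within M (enc x) (p.[size (enc x)])%R (answer x).

(* Main.v *)
Require Import Defs.
From HB Require Import structures.
From mathcomp Require Import all_boot all_order all_algebra.
From mathcomp Require Import zify.
From Stdlib Require Import FunctionalExtensionality.

(** A graph of pathwidth one is a disjoint union of caterpillars.  A leaf with
    list L attached to v only forbids the recolorings of v from a to b for which
    L is contained in {a, b}, so the leaves can be dropped and what remains are
    paths, processed vertex by vertex.  For the processed part, keep the graph of
    the classes of reachable colorings, where two colorings are in the same class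
    if they are connected without recoloring the last vertex u.  For the next
    vertex v, a new class is a color d of v together with a component of this
    graph after removal of the classes in which u has color d.  Such a component
    contains the root of a spanning tree, or a node whose parent has color d;
    so at most one new class per color of v is added to the old number of
    classes, which therefore stays polynomial.

    The computation is a program of loops of length N over first-order definable
    relations on [0, N), where N is the length of the input; any such program
    runs in polynomial time on a Turing machine that stores each relation on a
    tape and each variable as a head position. *)

(** For each of the k colors d of v, and k is part of the input, deleting the classes where u has
    color d may leave many components, so a careless bound on the number of classes multiplies at
    every vertex. The tree turns counting into naming: a component that misses the root is named by
    one of its nodes whose parent has color d. As the parent has only one color, an old name is used
    again for at most one d, and only the component of the root needs a fresh name for each d. The
    fresh name for v and d is the address of their bit in the encoded lists. So all names are below
    N and no count of classes is ever made; a class may have several names, which spares the choice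
    of a representative.

    With classes as numbers, each step is first-order definable except the components and the tree,
    which are increasing iterations and complete after N rounds.

    The processing order rests on two facts: every vertex has at most two neighbors on the spine,
    what is left without the leaves, and every nonempty set of vertices has a member with at most
    one neighbor in it. *)

Set Implicit Arguments.
Unset Strict Implicit.
Unset Printing Implicit Defensive.

(** * Program fragments for Turing machines *)

(* Mark of the origin, mark of the cell number N, stored bit. *)
Definition mark : finType := (bool * bool * bool)%type.
Definition sym : finType := symbol mark.

(* Tapes are named by (kind, index): kind 0 is the input tape, kind 1 holds the
   variables of formulas and kind 2 auxiliary counters, both with the head
   position as value; kind 3 holds the relations. *)
Definition tid := (nat * nat)%type.
Definition tape_code (t : tid) : nat := t.1 + 4 * t.2.
Definition tape_decode (n : nat) : tid := (n %% 4, n %/ 4).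

Lemma tape_codeK (t : tid) : t.1 < 4 -> tape_decode (tape_code t) = t.
Proof.
case: t => a b /= lt4; rewrite /tape_decode /tape_code /=.
by congr (_, _); lia.
Qed.

(* [None] leaves the scanned symbol unchanged. *)
Definition action := tid -> option sym * move.

(** A piece of a machine with one entry and an exit for each element of [E]: the result of a test is
    kept in the finite control, as the exit taken. Tapes are addressed by [tid], so the number of
    tapes is fixed only when a whole program is compiled. *)
Record frag (E : finType) := Frag {
  fstate : finType;
  fstart : fstate;
  fnext : fstate -> (tid -> sym) -> (fstate + E) * action
}.

Definition op (E : finType) (t : tid) (h : sym -> E * action) : frag E :=
  @Frag E unit tt (fun _ r => let: (e, a) := h (r t) in (inr e, a)).

(** Leaving [F] and entering [G e] is one transition, so running times simply add up. *)
Definition bind (E E' : finType) (F : frag E) (G : E -> frag E') : frag E' :=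
  @Frag E' (fstate F + {e : E & fstate (G e)})%type (inl (fstart F))
    (fun q r =>
      match q with
      | inl q => let: (x, a) := fnext q r in
          (match x with
           | inl q' => inl (inl q')
           | inr e => inl (inr (Tagged (fun e => fstate (G e)) (fstart (G e))))
           end, a)
      | inr u => let: (x, a) := fnext (tagged u) r in
          (match x with
           | inl q' => inl (inr (Tagged (fun e => fstate (G e)) q'))
           | inr e => inr e
           end, a)
      end).

Definition loop (E : finType) (F : frag (option E)) : frag E :=
  @Frag E (fstate F) (fstart F)
    (fun q r => let: (x, a) := fnext q r in
       (match x with
        | inl q' => inl q'
        | inr None => inl (fstart F)
        | inr (Some e) => inr e
        end, a)).

Definition upd (A : eqType) (B : Type) (f : A -> B) (a : A) (b : B) : A -> B :=
  fun x => if x == a then b else f x.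

Lemma upd_id (A : eqType) (B : Type) (f : A -> B) (a : A) : upd f a (f a) = f.
Proof.
by apply: functional_extensionality => x; rewrite /upd; case: eqP => [->|].
Qed.

Lemma upd_eq (A : eqType) (B : Type) (f : A -> B) a b :
  f a = b -> upd f a b = f.
Proof. by move=> <-; apply: upd_id. Qed.

Lemma upd_same (A : eqType) (B : Type) (f : A -> B) a b : upd f a b a = b.
Proof. by rewrite /upd eqxx. Qed.

Lemma upd_upd (A : eqType) (B : Type) (f : A -> B) a b b' :
  upd (upd f a b) a b' = upd f a b'.
Proof.
by apply: functional_extensionality => x; rewrite /upd; case: eqP.
Qed.

(** The two-way tapes as programs see them: a head position counted from an origin, which is never
    crossed, and a content for each position. *)
Definition acfg := tid -> nat * (nat -> sym).

Definition hd (a : acfg) (t : tid) : sym := (a t).2 (a t).1.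

Definition move_pos (m : move) (p : nat) : nat :=
  match m with MoveL => p.-1 | MoveN => p | MoveR => p.+1 end.

Definition aact (x : action) (a : acfg) : acfg := fun t =>
  (move_pos (x t).2 (a t).1,
   upd (a t).2 (a t).1 (odflt (hd a t) (x t).1)).

(* Nothing is said about the cells to the left of the origin. *)
Definition tape_rep (t : tape sym) (a : nat * (nat -> sym)) : Prop :=
  [/\ Defs.thead t = a.2 a.1,
      forall j, j < a.1 -> nth None (tleft t) j = a.2 (a.1 - j.+1)
    & forall j, nth None (tright t) j = a.2 (a.1 + j.+1)].

Lemma tape_rep_act (t : tape sym) p g s m :
  (m = MoveL -> 0 < p) -> tape_rep t (p, g) ->
  tape_rep (act_tape None (s, m) t) (move_pos m p, upd g p s).
Proof.
move=> pos; case: t => l h r [/= hE lE rE]; case: m pos => pos.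
- have {}pos := pos erefl.
  split=> /=.
  + have := lE 0 pos; rewrite nth0 => ->.
    by rewrite /upd; case: eqP => //; [lia | move=> _; congr g; lia].
  + move=> j jp; rewrite nth_behead lE; last by lia.
    by rewrite /upd; case: eqP => //; [lia | move=> _; congr g; lia].
  + case=> [|j] /=; rewrite /upd; case: eqP => //; try lia.
    by move=> _; rewrite rE; congr g; lia.
- split=> /=.
  + by rewrite /upd eqxx.
  + by move=> j jp; rewrite lE // /upd; case: eqP => //; lia.
  + by move=> j; rewrite rE // /upd; case: eqP => //; lia.
- split=> /=.
  + rewrite -nth0 rE /upd; case: eqP => //; first by lia.
    by move=> _; congr g; lia.
  + case=> [|j] jp /=; rewrite /upd; case: eqP => //; try lia.
    by move=> _; rewrite lE; [congr g; lia | lia].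
  + move=> j; rewrite nth_behead rE /upd; case: eqP; first by lia.
    by move=> _; congr g; lia.
Qed.

(** * Executions of fragments on tapes, with time bounds *)

Section Fragments.
Variable K : nat.

Definition tapes := 'I_K.+1 -> tape sym.

Definition heads (c : tapes) : {ffun 'I_K.+1 -> sym} :=
  [ffun i => Defs.thead (c i)].

Definition reads (s : {ffun 'I_K.+1 -> sym}) : tid -> sym :=
  fun t => s (inord (tape_code t)).

Definition resolve (a : action) (s : {ffun 'I_K.+1 -> sym}) (i : 'I_K.+1) :
    sym * move :=
  (odflt (s i) (a (tape_decode i)).1, (a (tape_decode i)).2).

Definition act (a : action) (c : tapes) : tapes :=
  fun i => act_tape None (resolve a (heads c) i) (c i).

Inductive run (E : finType) (F : frag E) :
    fstate F -> tapes -> nat -> E -> tapes -> Prop :=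
| run_exit q c e a :
    fnext q (reads (heads c)) = (inr e, a) -> run q c 1 e (act a c)
| run_step q c n q' a e c' :
    fnext q (reads (heads c)) = (inl q', a) -> run q' (act a c) n e c' ->
    run q c n.+1 e c'.

Lemma run_bindr (E E' : finType) (F : frag E) (G : E -> frag E') e q c n e' c' :
  @run _ (G e) q c n e' c' ->
  @run _ (bind F G) (inr (Tagged (fun e => fstate (G e)) q)) c n e' c'.
Proof.
elim=> {q c n e' c'} [q c e' a h|q c n q' a e' c' h _ IH].
  by apply: run_exit; rewrite /= h.
by apply: run_step IH; rewrite /= h.
Qed.

Lemma run_bind (E E' : finType) (F : frag E) (G : E -> frag E')
    q c n e c1 m e' c2 :
  @run _ F q c n e c1 -> @run _ (G e) (fstart (G e)) c1 m e' c2 ->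
  @run _ (bind F G) (inl q) c (n + m) e' c2.
Proof.
elim=> {q c n e c1} [q c e a h|q c n q' a e c1 h _ IH] r.
  by rewrite add1n; apply: (run_step _ (run_bindr F r)); rewrite /= h.
by rewrite addSn; apply: run_step (IH r); rewrite /= h.
Qed.

Lemma run_loop_stop (E : finType) (F : frag (option E)) q c n e x c1 :
  @run _ F q c n x c1 -> x = Some e -> @run _ (loop F) q c n e c1.
Proof.
elim=> {q c n x c1} [q c x a h|q c n q' a x c1 h _ IH] xe.
  by apply: run_exit; rewrite /= h xe.
by apply: run_step (IH xe); rewrite /= h.
Qed.

Lemma run_loop_next (E : finType) (F : frag (option E)) q c n x c1 m e c2 :
  @run _ F q c n x c1 -> x = None ->
  @run _ (loop F) (fstart F) c1 m e c2 -> @run _ (loop F) q c (n + m) e c2.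
Proof.
elim=> {q c n x c1} [q c x a h|q c n q' a x c1 h _ IH] xe r.
  by rewrite add1n; apply: run_step r; rewrite /= h xe.
by rewrite addSn; apply: run_step (IH xe r); rewrite /= h.
Qed.

Definition rep (c : tapes) (a : acfg) : Prop :=
  forall i, tape_rep (c i) (a (tape_decode i)).

(** A total-correctness triple with a time bound; the exit belongs to the postcondition. *)
Variant does (E : finType) (F : frag E) (T : nat) (a : acfg) (e : E)
    (a' : acfg) : Prop :=
  Does of (forall c, rep c a ->
    exists n c', [/\ n <= T, run (fstart F) c n e c' & rep c' a']).

(** Only a tape that is read has to exist: [rep] speaks of the tapes of the machine alone, so
    actions on other tapes have no effect. *)
Definition tape_ok (t : tid) : bool := (t.1 < 4) && (tape_code t <= K).

Lemma reads_rep c a t : tape_ok t -> rep c a -> reads (heads c) t = hd a t.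
Proof.
case/andP=> lt4 leK r; rewrite /reads ffunE.
have [-> _ _] := r (inord (tape_code t)).
by rewrite inordK ?ltnS // tape_codeK.
Qed.

Lemma does_op (E : finType) t (h : sym -> E * action) a e x :
  tape_ok t -> h (hd a t) = (e, x) ->
  (forall i, (x i).2 = MoveL -> 0 < (a i).1) ->
  does (op t h) 1 a e (aact x a).
Proof.
move=> tK hE pos; split=> c r; exists 1, (act x c); split=> //.
  by apply: run_exit; rewrite /= (reads_rep tK r) hE.
move=> i; rewrite /act /resolve ffunE /aact /hd.
have ri := r i; have [hE' _ _] := ri; rewrite hE'.
move: ri (pos (tape_decode i)); case: (a _) => p g /= ri pi.
by apply: tape_rep_act.
Qed.

Lemma does_bind (E E' : finType) (F : frag E) (G : E -> frag E')
    T1 T2 a e a1 e' a2 :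
  does F T1 a e a1 -> does (G e) T2 a1 e' a2 ->
  does (bind F G) (T1 + T2) a e' a2.
Proof.
move=> [d1] [d2]; split=> c r; have [n [c1 [nT r1 rep1]]] := d1 c r.
have [m [c2 [mT r2 rep2]]] := d2 c1 rep1.
exists (n + m), c2; split=> //; first exact: leq_add.
exact: run_bind r1 r2.
Qed.

Lemma does_loop_stop (E : finType) (F : frag (option E)) T a e a1 :
  does F T a (Some e) a1 -> does (loop F) T a e a1.
Proof.
move=> [d]; split=> c r; have [n [c1 [nT r1 rep1]]] := d c r.
by exists n, c1; split=> //; apply: run_loop_stop r1 _.
Qed.

Lemma does_loop_next (E : finType) (F : frag (option E)) T T' a e a1 a2 :
  does F T a None a1 -> does (loop F) T' a1 e a2 ->
  does (loop F) (T + T') a e a2.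
Proof.
move=> [d1] [d2]; split=> c r; have [n [c1 [nT r1 rep1]]] := d1 c r.
have [m [c2 [mT r2 rep2]]] := d2 c1 rep1.
exists (n + m), c2; split=> //; first exact: leq_add.
exact: run_loop_next r1 _ r2.
Qed.

Lemma does_le (E : finType) (F : frag E) T T' a e a' :
  T <= T' -> does F T a e a' -> does F T' a e a'.
Proof.
move=> le [d]; split=> c r; have [n [c1 [nT r1 rep1]]] := d c r.
by exists n, c1; split=> //; apply: leq_trans le.
Qed.

Definition stay : action := fun _ => (None, MoveN).

Lemma aact_stay a : aact stay a = a.
Proof.
apply: functional_extensionality => t; rewrite /aact /= upd_id.
by case: (a t).
Qed.

Definition test (t : tid) (f : sym -> bool) : frag bool :=
  op t (fun s => (f s, stay)).

Lemma does_test t f a : tape_ok t -> does (test t f) 1 a (f (hd a t)) a.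
Proof.
by move=> tK; rewrite -{3}(aact_stay a); apply: does_op.
Qed.

(** Returning costs one transition. Tape (0, 0) exists for every [K], so no side condition
    arises. *)
Definition ret (E : finType) (e : E) : frag E := op (0, 0) (fun _ => (e, stay)).

Lemma does_ret (E : finType) (e : E) a : does (ret e) 1 a e a.
Proof. by rewrite -{2}(aact_stay a); apply: does_op. Qed.

Definition seqf (E E' : finType) (F : frag E) (G : frag E') : frag E' :=
  bind F (fun _ => G).

Lemma does_seqf (E E' : finType) (F : frag E) (G : frag E')
    T1 T2 a e a1 e' a2 :
  does F T1 a e a1 -> does G T2 a1 e' a2 ->
  does (seqf F G) (T1 + T2) a e' a2.
Proof. exact: does_bind. Qed.

Definition until (t : tid) (stop : sym -> bool) (B : frag unit) : frag unit :=
  loop (bind (test t stop) (fun b =>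
    if b then ret (Some tt) else seqf B (ret (@None unit)))).

(** The invariant form serves loops whose intermediate contents are only known to exist. A round
    costs the test, the body and the jump back; the last 2 steps are the final test and the exit. *)
Lemma does_until_inv t stop B n (I : nat -> acfg -> Prop) T :
  tape_ok t ->
  (forall j a, j < n -> I j a -> stop (hd a t) = false) ->
  (forall a, I n a -> stop (hd a t)) ->
  (forall j a, j < n -> I j a -> exists2 a', does B T a tt a' & I j.+1 a') ->
  forall a, I 0 a ->
  exists2 a', does (until t stop B) (n * (T + 2) + 2) a tt a' & I n a'.
Proof.
move=> tK; elim: n I => [|n IH] I go halt body a I0.
  exists a => //; apply: does_loop_stop; rewrite mul0n add0n.
  apply: (@does_bind _ _ _ _ 1 1 _ _ _ _ _ (does_test stop _ tK)).
  by rewrite halt //; apply: does_ret.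
have [a1 d1 I1] := body 0 a isT I0.
have [j a2 jn|a2|j a2 jn|a2 d2 I2] := IH (fun j => I j.+1) _ _ _ a1 I1.
- exact: go.
- exact: halt.
- exact: body.
exists a2 => //.
have -> : n.+1 * (T + 2) + 2 = (1 + (T + 1)) + (n * (T + 2) + 2) by lia.
apply: does_loop_next d2.
apply: (does_bind (does_test stop _ tK)); rewrite (go 0) //.
exact: does_seqf d1 (does_ret _ _).
Qed.

Lemma does_until t stop B n (S : nat -> acfg) T :
  tape_ok t ->
  (forall j, j < n -> stop (hd (S j) t) = false) -> stop (hd (S n) t) ->
  (forall j, j < n -> does B T (S j) tt (S j.+1)) ->
  does (until t stop B) (n * (T + 2) + 2) (S 0) tt (S n).
Proof.
move=> tK go halt body.
have [|||a' d aE] := @does_until_inv t stop B n (fun j a => a = S j) T tK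
  _ _ _ (S 0) erefl.
- by move=> j a jn ->; apply: go.
- by move=> a ->.
- by move=> j a jn ->; exists (S j.+1) => //; apply: body.
by rewrite -aE.
Qed.

End Fragments.

(** * Counters and stored relations *)

(** The unmarked cell with bit 0 is the blank, so a fresh tape needs only its marks to represent a
    counter or the empty relation. *)
Definition mk_sym (o e b : bool) : sym :=
  if [|| o, e | b] then Some (inr (o, e, b)) else None.

Definition is_origin (s : sym) : bool :=
  if s is Some (inr (o, _, _)) then o else false.
Definition is_end (s : sym) : bool :=
  if s is Some (inr (_, e, _)) then e else false.
Definition is_one (s : sym) : bool :=
  match s with
  | Some (inr (_, _, b)) => b
  | Some (inl b) => b
  | None => false
  end.

Lemma is_originE o e b : is_origin (mk_sym o e b) = o.
Proof. by case: o e b => [] [] []. Qed.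
Lemma is_endE o e b : is_end (mk_sym o e b) = e.
Proof. by case: o e b => [] [] []. Qed.
Lemma is_oneE o e b : is_one (mk_sym o e b) = b.
Proof. by case: o e b => [] [] []. Qed.
Definition mk_symE := (is_originE, is_endE, is_oneE).

#[local] Arguments mk_sym : simpl never.
#[local] Arguments is_origin : simpl never.
#[local] Arguments is_end : simpl never.
#[local] Arguments is_one : simpl never.

Section Language.
Variables (K : nat) (w : seq bool).
Local Notation N := (size w).

Definition input_cell (j : nat) : sym :=
  nth None [seq Some (inl b) | b <- w] j.

Definition cells (bits : nat -> nat -> bool) (t : tid) (j : nat) : sym :=
  match t.1 with
  | 0 => if t.2 == 0 then input_cell j else None
  | 1 | 2 => mk_sym (j == 0) (j == N) false
  | 3 => mk_sym (j == 0) false (bits t.2 j)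
  | _ => None
  end.

Definition conf (pos : tid -> nat) (bits : nat -> nat -> bool) : acfg :=
  fun t => (pos t, cells bits t).

Definition moves_of (l : seq (tid * move)) (t : tid) : move :=
  foldr (fun x m => if x.1 == t then x.2 else m) MoveN l.

Definition moves (l : seq (tid * move)) : frag unit :=
  op (0, 0) (fun _ => (tt, fun t => (None, moves_of l t))).

Lemma does_moves l pos bits pos' :
  (forall t, moves_of l t = MoveL -> 0 < pos t) ->
  (forall t, pos' t = move_pos (moves_of l t) (pos t)) ->
  does K (moves l) 1 (conf pos bits) tt (conf pos' bits).
Proof.
move=> gt0 pE.
have <- : aact (fun t => (None, moves_of l t)) (conf pos bits) = conf pos' bits.
  apply: functional_extensionality => t.
  by rewrite /aact /hd /= upd_id /conf pE.
exact: does_op.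
Qed.

Lemma hd_counter pos bits i t : t.1 = i.+1 -> i < 2 ->
  hd (conf pos bits) t = mk_sym (pos t == 0) (pos t == N) false.
Proof. by rewrite /hd /conf /= /cells => ->; case: i => [|[|]]. Qed.

Lemma hd_rel pos bits r :
  hd (conf pos bits) (3, r) =
  mk_sym (pos (3, r) == 0) false (bits r (pos (3, r))).
Proof. by []. Qed.

Definition tuntil (n T : nat) := n * (T + 2) + 2.

Lemma leq_tuntil n n' T T' : n <= n' -> T <= T' -> tuntil n T <= tuntil n' T'.
Proof. by move=> ? ?; rewrite /tuntil leq_add2r leq_mul // leq_add2r. Qed.

Definition home (t : tid) : frag unit := until t is_origin (moves [:: (t, MoveL)]).

Lemma does_home t pos bits n :
  tape_ok K t -> 0 < t.1 -> pos t <= n ->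
  does K (home t) (tuntil n 1) (conf pos bits) tt (conf (upd pos t 0) bits).
Proof.
move=> tK t1 le; apply: (@does_le _ _ _ (tuntil (pos t) 1)).
  exact: leq_tuntil.
have -> : conf pos bits = conf (upd pos t (pos t - 0)) bits.
  by rewrite subn0 upd_id.
have -> : upd pos t 0 = upd pos t (pos t - pos t) by rewrite subnn.
have orgE p : is_origin (hd (conf p bits) t) = (p t == 0).
  have [t4 _] := andP tK; case: t t1 t4 {tK le} => [[|[|[|[|?]]]] j] //= _ _;
    by rewrite /hd /conf /cells /= mk_symE.
apply: (@does_until _ _ _ _ _ (fun j => conf (upd pos t (pos t - j)) bits)).
- by [].
- by move=> j jn; rewrite orgE upd_same; lia.
- by rewrite orgE upd_same; lia.
- move=> j jn; apply: does_moves => i; rewrite /moves_of /=.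
    by case: eqP => // <- _; rewrite upd_same; lia.
  rewrite /upd eq_sym; case: eqP => //= _; lia.
Qed.

(* Advances the tape by N ^ d cells. *)
Fixpoint advance (t : tid) (d : nat) : frag unit :=
  if d is d'.+1 then
    seqf (until (2, d') is_end
           (seqf (moves [:: ((2, d'), MoveR)]) (advance t d')))
         (home (2, d'))
  else moves [:: (t, MoveR)].

Fixpoint tadvance (n d : nat) : nat :=
  if d is d'.+1 then tuntil n (1 + tadvance n d') + tuntil n 1 else 1.

(** [t.1 != 2] keeps the advanced tape apart from the counters of the nested loops, which start and
    end at 0. *)
Lemma does_advance t d pos bits :
  t.1 != 2 -> (forall j, j < d -> tape_ok K (2, j)) ->
  (forall j, j < d -> pos (2, j) = 0) ->
  does K (advance t d) (tadvance N d) (conf pos bits) tt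
    (conf (upd pos t (pos t + N ^ d)) bits).
Proof.
move=> t2; elim: d pos => [|d IH] pos ok z /=.
  apply: does_moves => i; rewrite /moves_of /=; first by case: eqP.
  rewrite /upd eq_sym; case: eqP => [->|] //=; lia.
have dK := ok d (ltnSn d).
have tne : (2, d) != t by case: (t) t2 => a b /=; rewrite xpair_eqE; lia.
pose P j := upd (upd pos (2, d) j) t (pos t + j * N ^ d).
apply: (@does_bind _ _ _ _ _ _ _ _ tt (conf (P N) bits)).
  have -> : conf pos bits = conf (P 0) bits.
    by rewrite /P mul0n addn0 (upd_eq (z d (ltnSn d))) upd_id.
  have PE j : P j (2, d) = j by rewrite /P /upd (negPf tne) eqxx.
  apply: (@does_until _ _ _ _ _ (fun j => conf (P j) bits)) => //.
  - by move=> j jn; rewrite (@hd_counter _ _ 1) // mk_symE PE; lia.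
  - by rewrite (@hd_counter _ _ 1) // mk_symE PE eqxx.
  - move=> j jn.
    apply: (@does_bind _ _ _ _ _ _ _ _ tt
              (conf (upd (P j) (2, d) j.+1) bits)).
      apply: does_moves => i; rewrite /moves_of /=; first by case: eqP.
      by rewrite /upd eq_sym; case: eqP => [<-|] //=; rewrite PE.
    have -> : P j.+1 = upd (upd (P j) (2, d) j.+1) t
        (upd (P j) (2, d) j.+1 t + N ^ d).
      rewrite /P; apply: functional_extensionality => i; rewrite /upd eqxx.
      rewrite [t == _]eq_sym (negPf tne).
      by case: eqP => // _; [lia | case: eqP].
    apply: IH => [j' j'd|j' j'd]; first by apply: ok; lia.
    rewrite /P /upd !xpair_eqE eqxx /= (_ : j' == d = false); last by lia.
    case: eqP => [E|_]; last by apply: z; lia.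
    by move: t2; rewrite -E.
have -> : upd pos t (pos t + N ^ d.+1) = upd (P N) (2, d) 0.
  rewrite /P; apply: functional_extensionality => i; rewrite /upd.
  case: eqP => [->|ne]; first by rewrite eq_sym (negPf tne) expnS.
  by case: eqP => // ->; rewrite z.
apply: does_home => //.
by rewrite /P /upd (negPf tne) eqxx.
Qed.

(* Counter (2, 2) remembers the value of variable x. *)
Definition add_var (t : tid) (x d : nat) : frag unit :=
  seqf (until (1, x) is_origin
         (seqf (moves [:: ((1, x), MoveL); ((2, 2), MoveR)]) (advance t d)))
       (until (2, 2) is_origin (moves [:: ((2, 2), MoveL); ((1, x), MoveR)])).

Definition tadd_var (n d : nat) : nat :=
  tuntil n (1 + tadvance n d) + tuntil n 1.

Definition aux_ok := [&& tape_ok K (2, 0), tape_ok K (2, 1) & tape_ok K (2, 2)].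

Definition aux_zero (pos : tid -> nat) : Prop :=
  [/\ pos (2, 0) = 0, pos (2, 1) = 0 & pos (2, 2) = 0].

(** The first loop moves the value of [x] over to counter (2, 2) while advancing [t], the second
    moves it back. The loops of [advance] use the counters below [d], so [d <= 2] keeps them away
    from (2, 2). *)
Lemma does_add_var t x d pos bits :
  t.1 != 1 -> t.1 != 2 -> aux_ok -> d <= 2 ->
  tape_ok K (1, x) -> aux_zero pos -> pos (1, x) <= N ->
  does K (add_var t x d) (tadd_var N d) (conf pos bits) tt
    (conf (upd pos t (pos t + pos (1, x) * N ^ d)) bits).
Proof.
move=> t1 t2 /and3P[ok0 ok1 ok2] d2 xK [z0 z1 z2] le.
have ne1 : (1, x) == t = false by case: (t) t1 => a b /=; rewrite xpair_eqE; lia.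
have ne2 j : (2, j) == t = false.
  by case: (t) t2 => a b /=; rewrite xpair_eqE; lia.
pose v := pos (1, x).
pose P j := upd (upd (upd pos (1, x) (v - j)) (2, 2) j) t (pos t + j * N ^ d).
have P1 j : P j (1, x) = v - j by rewrite /P /upd ne1 !xpair_eqE /= eqxx.
have P2 j : P j (2, 2) = j by rewrite /P /upd ne2 eqxx.
apply: (@does_bind _ _ _ _ _ _ _ _ tt (conf (P v) bits)).
  apply: (@does_le _ _ _ (tuntil v (1 + tadvance N d))).
    exact: leq_tuntil.
  have -> : conf pos bits = conf (P 0) bits.
    by rewrite /P mul0n addn0 subn0 upd_id (upd_eq z2) upd_id.
  apply: (@does_until _ _ _ _ _ (fun j => conf (P j) bits)) => //.
  - by move=> j jn; rewrite (@hd_counter _ _ 0) // mk_symE P1; lia.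
  - by rewrite (@hd_counter _ _ 0) // mk_symE P1 subnn.
  - move=> j jn; pose Q := upd (upd (P j) (1, x) (v - j.+1)) (2, 2) j.+1.
    apply: (@does_bind _ _ _ _ _ _ _ _ tt (conf Q bits)).
      apply: does_moves => i; rewrite /moves_of /=.
        case: eqP => [<-|_]; last by case: eqP.
        by rewrite P1; lia.
      rewrite /Q /upd ![i == _]eq_sym.
      case: eqP => [<-|_]; first by rewrite P2.
      by case: eqP => [<-|] //=; rewrite P1; lia.
    have -> : P j.+1 = upd Q t (Q t + N ^ d).
      rewrite /Q /P; apply: functional_extensionality => i; rewrite /upd eqxx.
      rewrite ![t == _]eq_sym ne1 ne2.
      by case: eqP => // _; [lia | case: eqP => // _; case: eqP].
    apply: does_advance => // j' j'd.
      by case: j' j'd => [|[|]] //; lia.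
    rewrite /Q /P /upd ne2 !xpair_eqE /=.
    by case: j' j'd => [|[|]] //=; lia.
pose Q j := upd (upd (P v) (1, x) j) (2, 2) (v - j).
have Q1 j : Q j (1, x) = j by rewrite /Q /upd !xpair_eqE /= eqxx.
have Q2 j : Q j (2, 2) = v - j by rewrite /Q /upd eqxx.
have -> : P v = Q 0.
  rewrite /Q; apply: functional_extensionality => i; rewrite /upd.
  case: eqP => [->|_]; first by rewrite P2 subn0.
  by case: eqP => [->|] //; rewrite P1 subnn.
have -> : upd pos t (pos t + pos (1, x) * N ^ d) = Q v.
  rewrite /Q /P -/v; apply: functional_extensionality => i; rewrite /upd.
  case: (i =P t) => [->|_]; first by rewrite ![t == _]eq_sym ne1 ne2.
  case: eqP => [->|_]; first by rewrite subnn.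
  by case: eqP => [->|].
apply: (@does_le _ _ _ (tuntil v 1)); first exact: leq_tuntil.
apply: (@does_until _ _ _ _ _ (fun j => conf (Q j) bits)) => //.
- by move=> j jn; rewrite (@hd_counter _ _ 1) // mk_symE Q2; lia.
- by rewrite (@hd_counter _ _ 1) // mk_symE Q2 subnn.
- move=> j jn; apply: does_moves => i; rewrite /moves_of /=.
    case: eqP => [<-|_]; last by case: eqP.
    by rewrite Q2; lia.
  rewrite [in LHS]/Q /upd ![i == _]eq_sym.
  case: ((2, 2) =P i) => [<-|n2] /=; first by rewrite Q2 /=; lia.
  case: ((1, x) =P i) => [<-|n1] /=; first by rewrite Q1.
  by rewrite /Q /upd ![i == _]eq_sym; do 2![case: eqP => // _].
Qed.

(* The loops of [fill] below visit the triples in the order of addresses. *)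
Definition addr (x y z : nat) : nat := z + y * N + x * N ^ 2.

Lemma addr_lt x y z : x < N -> y < N -> z < N -> addr x y z < N ^ 3.
Proof. by rewrite /addr !expnS expn0 => *; nia. Qed.

Definition goto (r x y z : nat) : frag unit :=
  seqf (add_var (3, r) z 0) (seqf (add_var (3, r) y 1) (add_var (3, r) x 2)).

Definition tgoto (n : nat) := tadd_var n 0 + (tadd_var n 1 + tadd_var n 2).

Lemma does_goto r x y z pos bits :
  aux_ok -> tape_ok K (1, x) -> tape_ok K (1, y) -> tape_ok K (1, z) ->
  aux_zero pos -> pos (3, r) = 0 ->
  pos (1, x) <= N -> pos (1, y) <= N -> pos (1, z) <= N ->
  does K (goto r x y z) (tgoto N) (conf pos bits) tt
    (conf (upd pos (3, r) (addr (pos (1, x)) (pos (1, y)) (pos (1, z)))) bits).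
Proof.
move=> aux xK yK zK az r0 xN yN zN.
have az' v : aux_zero (upd pos (3, r) v).
  by case: az => *; split; rewrite /upd xpair_eqE.
apply: does_bind (does_add_var _ _ _ _ _ _ _ _) _ => //.
apply: does_bind (does_add_var _ _ _ _ _ _ _ _) _ => //.
set P := upd _ _ _.
have -> : upd pos (3, r) (addr (pos (1, x)) (pos (1, y)) (pos (1, z))) =
          upd P (3, r) (P (3, r) + P (1, x) * N ^ 2).
  rewrite /P !upd_upd !upd_same r0 /addr expn0 expn1 muln1 add0n.
  by rewrite /upd !xpair_eqE.
exact: does_add_var.
Qed.

(** * First-order programs *)

(* Variables are de Bruijn levels; quantifiers range over [0, N), and [Inp x]
   is the bit number x of the input. *)
Inductive fm :=
| Atom of nat & nat & nat & nat
| Inp of nat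
| Lt of nat & nat
| Not of fm
| And of fm & fm
| Or of fm & fm
| Ex of fm.

Definition store := nat -> nat -> nat -> nat -> bool.

Fixpoint eval (s : store) (e : seq nat) (f : fm) : bool :=
  match f with
  | Atom r x y z => s r (nth 0 e x) (nth 0 e y) (nth 0 e z)
  | Inp x => nth false w (nth 0 e x)
  | Lt x y => nth 0 e x < nth 0 e y
  | Not f => ~~ eval s e f
  | And f g => eval s e f && eval s e g
  | Or f g => eval s e f || eval s e g
  | Ex f => has (fun v => eval s (rcons e v) f) (iota 0 N)
  end.

Definition var_ok (d x : nat) := (x < d) && tape_ok K (1, x).

(** Comparing a variable with itself is excluded because [test_lt] counts down both variables in the
    same step, on two tapes. *)
Fixpoint fm_ok (d : nat) (f : fm) : bool :=
  match f with
  | Atom r x y z =>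
      [&& var_ok d x, var_ok d y, var_ok d z & tape_ok K (3, r)]
  | Inp x => var_ok d x
  | Lt x y => [&& x != y, var_ok d x & var_ok d y]
  | Not f => fm_ok d f
  | And f g | Or f g => fm_ok d f && fm_ok d g
  | Ex f => tape_ok K (1, d) && fm_ok d.+1 f
  end.

Fixpoint mentions (r : nat) (f : fm) : bool :=
  match f with
  | Atom r' _ _ _ => r == r'
  | Inp _ | Lt _ _ => false
  | Not f | Ex f => mentions r f
  | And f g | Or f g => mentions r f || mentions r g
  end.

Definition test_rel (r x y z : nat) : frag bool :=
  seqf (goto r x y z) (bind (test (3, r) is_one) (fun b =>
    seqf (home (3, r)) (ret b))).

(** The input tape carries no origin mark, so its head cannot be sent home; it goes back as far as
    the variable [x] counts down. *)
Definition test_input (x : nat) : frag bool :=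
  seqf (add_var (0, 0) x 0) (bind (test (0, 0) is_one) (fun b =>
    seqf
      (seqf
        (until (1, x) is_origin
          (moves [:: ((1, x), MoveL); ((2, 2), MoveR); ((0, 0), MoveL)]))
        (until (2, 2) is_origin (moves [:: ((2, 2), MoveL); ((1, x), MoveR)])))
      (ret b))).

(** Both values are counted down together. The head of [y] is inspected first, so equal values give
    false. *)
Definition test_lt (x y : nat) : frag bool :=
  bind
    (loop (bind (test (1, y) is_origin) (fun b =>
       if b then ret (Some false) else
       bind (test (1, x) is_origin) (fun b' =>
       if b' then ret (Some true) else
       seqf (moves [:: ((1, x), MoveL); ((1, y), MoveL); ((2, 2), MoveR)])
            (ret (@None bool))))))
    (fun b => seqf
       (until (2, 2) is_origin
         (moves [:: ((2, 2), MoveL); ((1, x), MoveR); ((1, y), MoveR)]))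
       (ret b)).

Definition exists_var (d : nat) (F : frag bool) : frag bool :=
  bind
    (loop (bind (test (1, d) is_end) (fun b =>
       if b then ret (Some false) else
       bind F (fun b' =>
       if b' then ret (Some true) else
       seqf (moves [:: ((1, d), MoveR)]) (ret (@None bool))))))
    (fun b => seqf (home (1, d)) (ret b)).

Fixpoint compf (d : nat) (f : fm) : frag bool :=
  match f with
  | Atom r x y z => test_rel r x y z
  | Inp x => test_input x
  | Lt x y => test_lt x y
  | Not f => bind (compf d f) (fun b => ret (~~ b))
  | And f g => bind (compf d f) (fun b => if b then compf d g else ret false)
  | Or f g => bind (compf d f) (fun b => if b then ret true else compf d g)
  | Ex f => exists_var d (compf d.+1 f)
  end.

Definition tlt (n : nat) := n * 4 + 3 + (tuntil n 1 + 1).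

Fixpoint tcomp (n : nat) (f : fm) : nat :=
  match f with
  | Atom _ _ _ _ => tgoto n + (1 + (tuntil (n ^ 3) 1 + 1))
  | Inp _ => tadd_var n 0 + (1 + ((tuntil n 1 + tuntil n 1) + 1))
  | Lt _ _ => tlt n
  | Not f => tcomp n f + 1
  | And f g | Or f g => tcomp n f + (tcomp n g + 1)
  | Ex f => (n * (tcomp n f + 3) + (tcomp n f + 2)) + (tuntil n 1 + 1)
  end.

(** The default 0 of [nth] matters: a variable out of scope rests at the origin, so opening a scope
    moves no head and closing it sends one head home. *)
Definition pos_of (e : seq nat) (k : nat -> nat) (t : tid) : nat :=
  match t.1 with
  | 1 => nth 0 e t.2
  | 2 => k t.2
  | _ => 0
  end.

Definition stored (bits : nat -> nat -> bool) (s : store) (r : nat) : Prop :=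
  forall x y z, x < N -> y < N -> z < N -> bits r (addr x y z) = s r x y z.

Lemma pos_of_rcons e k v :
  pos_of (rcons e v) k = upd (pos_of e k) (1, size e) v.
Proof.
apply: functional_extensionality => -[a b].
rewrite /upd /pos_of xpair_eqE /= nth_rcons.
case: a => [|[|]] //=; case: ltngtP => // lt.
by rewrite nth_default // ltnW.
Qed.

Lemma pos_of_le e k x : all (ltn^~ N) e -> pos_of e k (1, x) <= N.
Proof.
move=> eN; rewrite /pos_of /=; case: (ltnP x (size e)) => lt.
  by apply: ltnW; apply: (allP eN); apply: mem_nth.
by rewrite nth_default.
Qed.

Lemma does_test_rel r x y z e k bits s :
  aux_ok -> tape_ok K (1, x) -> tape_ok K (1, y) -> tape_ok K (1, z) ->
  tape_ok K (3, r) -> aux_zero (pos_of e k) ->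
  x < size e -> y < size e -> z < size e -> all (ltn^~ N) e ->
  stored bits s r ->
  does K (test_rel r x y z) (tgoto N + (1 + (tuntil (N ^ 3) 1 + 1)))
    (conf (pos_of e k) bits) (s r (nth 0 e x) (nth 0 e y) (nth 0 e z))
    (conf (pos_of e k) bits).
Proof.
move=> aux xK yK zK rK az xe ye ze eN st.
have lt v : v < size e -> nth 0 e v < N.
  by move=> ve; apply: (allP eN); apply: mem_nth.
have le v := pos_of_le k v eN.
apply: does_bind (does_goto _ _ _ _ _ _ _ _ _ _) _ => //.
set P := upd _ _ _.
apply: does_bind (does_test _ _ _) _ => //.
rewrite hd_rel mk_symE [X in bits r X]upd_same st ?lt //.
apply: does_seqf _ (does_ret _ _ _).
have -> : conf (pos_of e k) bits = conf (upd P (3, r) 0) bits.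
  by rewrite /P upd_upd upd_eq.
apply: does_home => //.
by rewrite /P upd_same ltnW // addr_lt ?lt.
Qed.

Lemma does_test_input x e k bits :
  aux_ok -> tape_ok K (0, 0) -> tape_ok K (1, x) -> aux_zero (pos_of e k) ->
  x < size e -> all (ltn^~ N) e ->
  does K (test_input x) (tadd_var N 0 + (1 + ((tuntil N 1 + tuntil N 1) + 1)))
    (conf (pos_of e k) bits) (nth false w (nth 0 e x)) (conf (pos_of e k) bits).
Proof.
move=> aux iK xK az xe eN; have [_ _ z2] := az.
have [_ _ ok2] := and3P aux.
have lt : nth 0 e x < N by apply: (allP eN); apply: mem_nth.
have le v := pos_of_le k v eN.
set p0 := pos_of e k in z2 *; pose v := nth 0 e x.
have vE : p0 (1, x) = v by [].
apply: does_bind (does_add_var _ _ _ _ _ _ _ _) _ => //.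
rewrite -/p0 vE expn0 muln1 (_ : p0 (0, 0) = 0) // add0n.
set P := upd _ _ _.
apply: does_bind (does_test _ _ _) _ => //.
have -> : is_one (hd (conf P bits) (0, 0)) = nth false w v.
  rewrite /hd /conf /cells /= /input_cell /P upd_same.
  by rewrite (nth_map false).
apply: does_seqf _ (does_ret _ _ _).
pose Q j := upd (upd (upd p0 (0, 0) (v - j)) (1, x) (v - j)) (2, 2) j.
have Q1 j : Q j (1, x) = v - j by rewrite /Q /upd !xpair_eqE /= eqxx.
have Q2 j : Q j (2, 2) = j by rewrite /Q /upd eqxx.
have Q0 j : Q j (0, 0) = v - j by rewrite /Q /upd !xpair_eqE /=.
apply: (@does_bind _ _ _ _ _ _ _ _ tt (conf (Q v) bits)).
  apply: (@does_le _ _ _ (tuntil v 1)); first by apply: leq_tuntil => //; lia.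
  have -> : P = Q 0.
    rewrite /P /Q subn0; apply: functional_extensionality => i; rewrite /upd.
    case: (i =P (2, 2)) => [->|_]; first by rewrite xpair_eqE /= z2.
    by case: (i =P (1, x)) => [->|_] //=; rewrite -vE !xpair_eqE /=.
  apply: (@does_until _ _ _ _ _ (fun j => conf (Q j) bits)) => //.
  - by move=> j jn; rewrite (@hd_counter _ _ 0) // mk_symE Q1; lia.
  - by rewrite (@hd_counter _ _ 0) // mk_symE Q1 subnn.
  - move=> j jn; apply: does_moves => i; rewrite /moves_of /=.
      case: eqP => [<-|_]; first by rewrite Q1; lia.
      case: eqP => // _; case: eqP => // <- _; by rewrite Q0; lia.
    rewrite [in LHS]/Q /upd ![i == _]eq_sym.
    case: ((2, 2) =P i) => [<-|n2] /=.
      by rewrite ?xpair_eqE /= Q2.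
    case: ((1, x) =P i) => [<-|n1] /=; first by rewrite Q1; lia.
    case: ((0, 0) =P i) => [<-|n0] /=; first by rewrite Q0; lia.
    by rewrite /Q /upd ![i == _]eq_sym; do 3![case: eqP => // _].
pose R j := upd (upd p0 (1, x) j) (2, 2) (v - j).
have R1 j : R j (1, x) = j by rewrite /R /upd !xpair_eqE /= eqxx.
have R2 j : R j (2, 2) = v - j by rewrite /R /upd eqxx.
have -> : Q v = R 0.
  rewrite /Q /R subnn subn0; apply: functional_extensionality => i; rewrite /upd.
  by do 2![case: eqP => // _]; case: eqP => [->|].
have -> : p0 = R v.
  rewrite /R subnn; apply: functional_extensionality => i; rewrite /upd.
  case: eqP => [->|_]; first by rewrite z2.
  by case: eqP => [->|].
apply: (@does_le _ _ _ (tuntil v 1)); first by apply: leq_tuntil => //; lia.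
apply: (@does_until _ _ _ _ _ (fun j => conf (R j) bits)) => //.
- by move=> j jn; rewrite (@hd_counter _ _ 1) // mk_symE R2; lia.
- by rewrite (@hd_counter _ _ 1) // mk_symE R2 subnn.
- move=> j jn; apply: does_moves => i; rewrite /moves_of /=.
    case: eqP => [<-|_]; first by rewrite R2; lia.
    by case: eqP.
  rewrite [in LHS]/R /upd ![i == _]eq_sym.
  case: ((2, 2) =P i) => [<-|n2] /=; first by rewrite R2; lia.
  case: ((1, x) =P i) => [<-|n1] /=; first by rewrite R1.
  by rewrite /R /upd ![i == _]eq_sym; do 2![case: eqP => // _].
Qed.

Lemma does_test_lt x y e k bits :
  aux_ok -> tape_ok K (1, x) -> tape_ok K (1, y) -> x != y ->
  aux_zero (pos_of e k) -> all (ltn^~ N) e ->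
  does K (test_lt x y) (tlt N)
    (conf (pos_of e k) bits) (nth 0 e x < nth 0 e y) (conf (pos_of e k) bits).
Proof.
move=> aux xK yK xy az eN; have [_ _ z2] := az.
have [_ _ ok2] := and3P aux.
have le v := pos_of_le k v eN.
set p0 := pos_of e k in z2 *; pose vx := nth 0 e x; pose vy := nth 0 e y.
have le0 : vy <= N by exact: (le y).
have vxE : p0 (1, x) = vx by [].
have vyE : p0 (1, y) = vy by [].
pose Q j := upd (upd (upd p0 (1, x) (vx - j)) (1, y) (vy - j)) (2, 2) j.
have Q1 j : Q j (1, x) = vx - j.
  by rewrite /Q /upd !xpair_eqE /= (negPf xy) eqxx.
have Q1' j : Q j (1, y) = vy - j by rewrite /Q /upd !xpair_eqE /= eqxx.
have Q2 j : Q j (2, 2) = j by rewrite /Q /upd eqxx.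
have Q0 : p0 = Q 0.
  rewrite /Q !subn0; apply: functional_extensionality => i; rewrite /upd.
  case: eqP => [->|_]; first by rewrite z2.
  case: eqP => [->|_] //; by case: eqP => [->|].
pose m := minn vx vy.
apply: (@does_bind _ _ _ _ _ _ _ _ (vx < vy) (conf (Q m) bits)).
  have main n j : n = m - j -> j <= m ->
    does K (loop (bind (test (1, y) is_origin) (fun b =>
       if b then ret (Some false) else
       bind (test (1, x) is_origin) (fun b' =>
       if b' then ret (Some true) else
       seqf (moves [:: ((1, x), MoveL); ((1, y), MoveL); ((2, 2), MoveR)])
            (ret (@None bool)))))) (n * 4 + 3) (conf (Q j) bits)
       (vx < vy) (conf (Q m) bits).
    elim: n j => [|n IH] j nE jm.
      have jE : j = m by lia.
      apply: does_loop_stop; rewrite mul0n add0n jE.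
      apply: (does_bind (T1 := 1) (T2 := 2)); first exact: does_test.
      rewrite (@hd_counter _ _ 0) // mk_symE Q1'.
      case: eqP => [y0|y0].
        have -> : (vx < vy) = false by lia.
        by apply: (does_le (T := 1)) => //; apply: does_ret.
      apply: (does_bind (T1 := 1) (T2 := 1)); first exact: does_test.
      rewrite (@hd_counter _ _ 0) // mk_symE Q1.
      have -> : (vx < vy) = true by lia.
      have -> : vx - m == 0 by lia.
      exact: does_ret.
    have -> : n.+1 * 4 + 3 = (1 + (1 + (1 + 1))) + (n * 4 + 3) by lia.
    apply: (does_loop_next _ (IH j.+1 _ _)); try lia.
    apply: does_bind (does_test _ _ _) _ => //.
    rewrite (@hd_counter _ _ 0) // mk_symE Q1'.
    have -> : vy - j == 0 = false by lia.
    apply: does_bind (does_test _ _ _) _ => //.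
    rewrite (@hd_counter _ _ 0) // mk_symE Q1.
    have -> : vx - j == 0 = false by lia.
    apply: does_seqf _ (does_ret _ _ _).
    apply: does_moves => i; rewrite /moves_of /=.
      case: eqP => [<-|_]; first by rewrite Q1; lia.
      case: eqP => [<-|_]; first by rewrite Q1'; lia.
      by case: eqP.
    rewrite [in LHS]/Q /upd ![i == _]eq_sym.
    case: ((2, 2) =P i) => [<-|n2] /=.
      by rewrite ?xpair_eqE /= Q2.
    case: ((1, y) =P i) => [<-|n1] /=.
      by rewrite xpair_eqE /= (negPf xy) Q1' /=; lia.
    case: ((1, x) =P i) => [<-|n0] /=; first by rewrite Q1; lia.
    by rewrite /Q /upd ![i == _]eq_sym; do 3![case: eqP => // _].
  rewrite Q0; apply: (does_le (T := m * 4 + 3)); first by lia.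
  by apply: main; lia.
apply: does_seqf _ (does_ret _ _ _).
have -> : conf (Q m) bits = conf (Q (m - 0)) bits by rewrite subn0.
have -> : conf p0 bits = conf (Q (m - m)) bits by rewrite subnn -Q0.
apply: (@does_le _ _ _ (tuntil m 1)); first by apply: leq_tuntil => //; lia.
apply: (@does_until _ _ _ _ _ (fun j => conf (Q (m - j)) bits)) => //.
- by move=> j jn; rewrite (@hd_counter _ _ 1) // mk_symE Q2; lia.
- by rewrite (@hd_counter _ _ 1) // mk_symE Q2 subnn.
- move=> j jn; apply: does_moves => i; rewrite /moves_of /=.
    case: eqP => [<-|_]; first by rewrite Q2; lia.
    by do 2!case: eqP => //.
  rewrite [in LHS]/Q /upd ![i == _]eq_sym.
  case: ((2, 2) =P i) => [<-|n2] /=; first by rewrite Q2; lia.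
  case: ((1, y) =P i) => [<-|n1] /=.
    by rewrite xpair_eqE /= (negPf xy) Q1' /=; lia.
  case: ((1, x) =P i) => [<-|n0] /=; first by rewrite Q1; lia.
  by rewrite /Q /upd ![i == _]eq_sym; do 3![case: eqP => // _].
Qed.

Lemma does_exists_var e k bits F T (b : nat -> bool) :
  tape_ok K (1, size e) ->
  (forall v, v < N -> does K F T (conf (pos_of (rcons e v) k) bits) (b v)
                        (conf (pos_of (rcons e v) k) bits)) ->
  does K (exists_var (size e) F)
    ((N * (T + 3) + (T + 2)) + (tuntil N 1 + 1))
    (conf (pos_of e k) bits) (has b (iota 0 N)) (conf (pos_of e k) bits).
Proof.
move=> dK dF; set d := size e.
have Pd v : pos_of (rcons e v) k (1, d) = v.
  by rewrite pos_of_rcons upd_same.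
have P0 : pos_of e k = pos_of (rcons e 0) k.
  by rewrite pos_of_rcons upd_eq // /pos_of /= nth_default.
have fin v c : v <= N -> does K (seqf (home (1, d)) (ret c)) (tuntil N 1 + 1)
    (conf (pos_of (rcons e v) k) bits) c (conf (pos_of e k) bits).
  move=> vN; apply: does_seqf _ (does_ret _ _ _).
  have -> : pos_of e k = upd (pos_of (rcons e v) k) (1, d) 0.
    by rewrite pos_of_rcons upd_upd -pos_of_rcons.
  by apply: does_home; rewrite // Pd.
(* The search stops at the first witness, so the final head position is only known to be at most
   [N]. *)
suff main n v : n = N - v -> v <= N -> exists2 v', v' <= N &
    does K (loop (bind (test (1, d) is_end) (fun b =>
       if b then ret (Some false) else
       bind F (fun b' =>
       if b' then ret (Some true) else
       seqf (moves [:: ((1, d), MoveR)]) (ret (@None bool))))))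
     (n * (T + 3) + (T + 2))
     (conf (pos_of (rcons e v) k) bits) (has b (iota v n))
     (conf (pos_of (rcons e v') k) bits).
  have [//|//|v' v'N dL] := main N 0; first by rewrite subn0.
  by rewrite {1}P0; apply: (does_bind dL); apply: fin.
elim: n v => [|n IH] v nE vN.
  exists v => //; apply: does_loop_stop; rewrite mul0n add0n.
  apply: (does_le (T := 1 + 1)); first by lia.
  apply: does_bind (does_test _ _ _) _ => //.
  rewrite (@hd_counter _ _ 0) // mk_symE Pd.
  have -> : v == N by lia.
  exact: does_ret.
have [bv|bv] := boolP (b v).
  exists v => //; apply: does_loop_stop.
  apply: (does_le (T := 1 + (T + 1))); first by lia.
  apply: does_bind (does_test _ _ _) _ => //.
  rewrite (@hd_counter _ _ 0) // mk_symE Pd.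
  have -> : v == N = false by lia.
  apply: does_bind (dF v _) _; first by lia.
  by rewrite /= bv; apply: does_ret.
have [||v' v'N dL] := IH v.+1; try lia.
exists v' => //=; rewrite (negPf bv) /=.
have -> : n.+1 * (T + 3) + (T + 2) =
          (1 + (T + (1 + 1))) + (n * (T + 3) + (T + 2)) by lia.
apply: does_loop_next dL.
apply: does_bind (does_test _ _ _) _ => //.
rewrite (@hd_counter _ _ 0) // mk_symE Pd.
have -> : v == N = false by lia.
apply: does_bind (dF v _) _; first by lia.
rewrite (negPf bv); apply: does_seqf _ (does_ret _ _ _).
apply: does_moves => i; rewrite /moves_of /=; first by case: eqP.
rewrite !pos_of_rcons /upd eq_sym; by case: eqP.
Qed.

Lemma does_comp f e k bits s :
  aux_ok -> tape_ok K (0, 0) -> fm_ok (size e) f -> aux_zero (pos_of e k) ->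
  all (ltn^~ N) e -> (forall r, mentions r f -> stored bits s r) ->
  does K (compf (size e) f) (tcomp N f) (conf (pos_of e k) bits) (eval s e f)
    (conf (pos_of e k) bits).
Proof.
move=> aux iK; elim: f e => [r x y z|x|x y|f IH|f IHf g IHg|f IHf g IHg|f IH] e /=.
- move=> /and4P[/andP[? ?] /andP[? ?] /andP[? ?] rK] az eN st.
  by apply: does_test_rel => //; apply: st.
- by move=> /andP[? ?] az eN _; apply: does_test_input.
- by move=> /and3P[? /andP[? ?] /andP[? ?]] az eN _; apply: does_test_lt.
- by move=> ok az eN st; apply: (does_bind (IH _ _ _ _ _)) => //; apply: does_ret.
- move=> /andP[okf okg] az eN st.
  apply: does_bind (IHf _ _ _ _ _) _ => // [r rf|].
    by apply: st; rewrite rf.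
  case: (eval s e f) => /=.
    apply: (does_le (T := tcomp N g)); first by lia.
    by apply: IHg => // r rg; apply: st; rewrite rg orbT.
  by apply: (does_le (T := 1)); [lia | apply: does_ret].
- move=> /andP[okf okg] az eN st.
  apply: does_bind (IHf _ _ _ _ _) _ => // [r rf|].
    by apply: st; rewrite rf.
  case: (eval s e f) => /=.
    by apply: (does_le (T := 1)); [lia | apply: does_ret].
  apply: (does_le (T := tcomp N g)); first by lia.
  by apply: IHg => // r rg; apply: st; rewrite rg orbT.
- move=> /andP[dK ok] az eN st; apply: does_exists_var => // v vN.
  rewrite -(size_rcons e v); apply: IH => //.
  + by rewrite size_rcons.
  + by rewrite all_rcons /= vN.
Qed.

(** * Assignment programs with loops and their compilation *)

Inductive prog :=
| Skip
| Set_ of nat & fm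
| Seq of prog & prog
| Rep of prog
| When of fm & prog.

Fixpoint exec (p : prog) (s : store) : store :=
  match p with
  | Skip => s
  | Set_ r f => upd s r (fun x y z => eval s [:: x; y; z] f)
  | Seq p q => exec q (exec p s)
  | Rep p => iter N (exec p) s
  | When f p => if eval s [::] f then exec p s else s
  end.

(* Relation 0 is a buffer: it makes [Set_] a simultaneous assignment. *)
Fixpoint prog_ok (j : nat) (p : prog) : bool :=
  match p with
  | Skip => true
  | Set_ r f => [&& r != 0, tape_ok K (3, r), ~~ mentions 0 f & fm_ok 3 f]
  | Seq p q => prog_ok j p && prog_ok j q
  | Rep p => tape_ok K (2, j + 3) && prog_ok j.+1 p
  | When f p => [&& ~~ mentions 0 f, fm_ok 0 f & prog_ok j p]
  end.

Definition write_bit (r : nat) (b : bool) : frag unit :=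
  op (3, r) (fun s =>
    (tt, fun t => if t == (3, r) then (Some (mk_sym (is_origin s) false b), MoveN)
                  else (None, MoveN))).

Lemma does_write_bit r b pos bits :
  tape_ok K (3, r) ->
  does K (write_bit r b) 1 (conf pos bits) tt
    (conf pos (upd bits r (upd (bits r) (pos (3, r)) b))).
Proof.
move=> rK; set act := fun t : tid => if t == (3, r) then
  (Some (mk_sym (is_origin (hd (conf pos bits) (3, r))) false b), MoveN)
  else (None, MoveN).
have <- : aact act (conf pos bits) =
    conf pos (upd bits r (upd (bits r) (pos (3, r)) b)).
  apply: functional_extensionality => t; rewrite /aact /act.
  case: (t =P (3, r)) => [->|ne] /=; last first.
    rewrite upd_id /conf; congr (_, _); apply: functional_extensionality => j.
    rewrite /cells; case: t ne => [[|[|[|[|a]]]] i] //= ne; rewrite /upd.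
    by case: (i =P r) => // E; case: ne; rewrite E.
  rewrite /conf; congr (_, _); apply: functional_extensionality => j.
  rewrite /hd /= /cells /= mk_symE /upd eqxx.
  by case: (j =P _) => [->|].
by apply: does_op => // i; rewrite /act; case: eqP.
Qed.

Definition for_var (d : nat) (B : frag unit) : frag unit :=
  seqf (until (1, d) is_end (seqf B (moves [:: ((1, d), MoveR)])))
       (home (1, d)).

Definition tfor (n T : nat) := tuntil n (T + 1) + tuntil n 1.

Lemma does_for_var e k B T (bt : nat -> nat -> nat -> bool) :
  tape_ok K (1, size e) ->
  (forall v, v < N -> does K B T (conf (pos_of (rcons e v) k) (bt v)) tt
                        (conf (pos_of (rcons e v) k) (bt v.+1))) ->
  does K (for_var (size e) B) (tfor N T)
    (conf (pos_of e k) (bt 0)) tt (conf (pos_of e k) (bt N)).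
Proof.
move=> dK dB; set d := size e.
have Pd v : pos_of (rcons e v) k (1, d) = v.
  by rewrite pos_of_rcons upd_same.
have P0 : pos_of e k = pos_of (rcons e 0) k.
  by rewrite pos_of_rcons upd_eq // /pos_of /= nth_default.
apply: (@does_seqf _ _ _ _ _ _ _ _ tt (conf (pos_of (rcons e N) k) (bt N))).
  rewrite P0.
  apply: (@does_until _ _ _ _ _ (fun j => conf (pos_of (rcons e j) k) (bt j))).
  - by [].
  - by move=> j jn; rewrite (@hd_counter _ _ 0) // mk_symE Pd; lia.
  - by rewrite (@hd_counter _ _ 0) // mk_symE Pd eqxx.
  - move=> j jn; apply: does_seqf (dB j jn) _.
    apply: does_moves => i; rewrite /moves_of /=; first by case: eqP.
    by rewrite !pos_of_rcons /upd eq_sym; case: eqP.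
have -> : pos_of e k = upd (pos_of (rcons e N) k) (1, d) 0.
  by rewrite pos_of_rcons upd_upd -pos_of_rcons.
by apply: does_home; rewrite // Pd.
Qed.

Definition fill (r : nat) (f : fm) : frag unit :=
  for_var 0 (for_var 1 (for_var 2 (bind (compf 3 f) (fun b =>
    seqf (goto r 0 1 2) (seqf (write_bit r b) (home (3, r))))))).

Definition tfill (n : nat) (f : fm) : nat :=
  tfor n (tfor n (tfor n (tcomp n f + (tgoto n + (1 + tuntil (n ^ 3) 1))))).

Definition vars3_ok := [&& tape_ok K (1, 0), tape_ok K (1, 1) & tape_ok K (1, 2)].

Lemma does_fill r f k bits s :
  aux_ok -> tape_ok K (0, 0) -> vars3_ok -> tape_ok K (3, r) -> fm_ok 3 f ->
  aux_zero (pos_of [::] k) -> ~~ mentions r f ->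
  (forall r', mentions r' f -> stored bits s r') ->
  exists2 bits', does K (fill r f) (tfill N f) (conf (pos_of [::] k) bits) tt
      (conf (pos_of [::] k) bits') &
    (forall r', r' != r -> bits' r' = bits r') /\
    (forall x y z, x < N -> y < N -> z < N ->
       bits' r (addr x y z) = eval s [:: x; y; z] f).
Proof.
move=> aux iK /and3P[v0 v1 v2] rK ok az nm st.
(* [addr] is positional notation in base [N], so division recovers the triple from its address. *)
pose F a := eval s [:: a %/ N ^ 2; (a %/ N) %% N; a %% N] f.
(* The contents once the addresses below [m] are filled. The end of an inner loop and the start of
   the next outer round are the same address, so this one family describes all three loops. *)
pose bt m r' a := if (r' == r) && (a < m) then F a else bits r' a.
have FE x y z : x < N -> y < N -> z < N ->
    F (addr x y z) = eval s [:: x; y; z] f.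
  move=> xN yN zN; have N0 : 0 < N by lia.
  have E : addr x y z = (x * N + y) * N + z by rewrite /addr; lia.
  have lt2 : z + y * N < N ^ 2 by rewrite !expnS expn0; nia.
  rewrite /F {2 3}E divnMDl // (divn_small zN) addn0 modnMDl (modn_small yN).
  rewrite modnMDl (modn_small zN).
  have -> : addr x y z = x * N ^ 2 + (z + y * N) by rewrite /addr; lia.
  by rewrite divnMDl ?(divn_small lt2) ?addn0 // expn_gt0 N0.
exists (bt (addr N 0 0)); last first.
  split=> [r' ne|x y z xN yN zN].
    by apply: functional_extensionality => a; rewrite /bt (negPf ne).
  rewrite /bt eqxx /= -FE //.
  have -> // : addr x y z < addr N 0 0 by rewrite /addr !expnS expn0; nia.
have -> : bits = bt (addr 0 0 0).
  do 2!apply: functional_extensionality => ?.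
  by rewrite /bt /addr ltn0 andbF.
apply: (@does_for_var [::] k _ _ (fun v => bt (addr v 0 0))) => // x xN.
have -> : addr x.+1 0 0 = addr x N 0 by rewrite /addr; lia.
apply: (@does_for_var [:: x] k _ _ (fun v => bt (addr x v 0))) => // y yN.
have -> : addr x y.+1 0 = addr x y N by rewrite /addr; lia.
apply: (@does_for_var [:: x; y] k _ _ (fun v => bt (addr x y v))) => // z zN.
have zE : addr x y z.+1 = (addr x y z).+1 by rewrite /addr; lia.
rewrite zE; set m := addr x y z; set e := rcons _ _.
have eN : all (ltn^~ N) e by rewrite /= xN yN zN.
have stb : forall r', mentions r' f -> stored (bt m) s r'.
  move=> r' mr' x' y' z' *; rewrite /bt.
  case: eqP => [E|_]; first by move: mr'; rewrite E (negPf nm).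
  exact: st.
have {}az : aux_zero (pos_of e k) by [].
apply: (does_bind (does_comp aux iK (e := e) _ _ _ stb)) => //.
apply: (does_seqf (does_goto _ aux v0 v1 v2 az _ _ _ _)) => //; try exact: ltnW.
set P := upd _ _ _.
apply: does_seqf (does_write_bit _ _ _ rK) _.
have -> : pos_of e k = upd P (3, r) 0 by rewrite /P upd_upd upd_eq.
have -> : upd (bt m) r (upd (bt m r) (P (3, r)) (eval s e f)) = bt m.+1.
  rewrite /P upd_same -/m; do 2!apply: functional_extensionality => ?.
  rewrite /upd /bt eqxx /= ltnS leq_eqVlt.
  case: eqP => //= ->; case: eqP => //= ->.
  by rewrite -[e]/[:: x; y; z] -FE.
apply: does_home => //.
by rewrite /P upd_same ltnW // addr_lt.
Qed.

(** [j] is the nesting depth of loops. The counters 0 to 2 belong to the address computations, hence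
    the shift by 3. *)
Fixpoint compp (j : nat) (p : prog) : frag unit :=
  match p with
  | Skip => ret tt
  | Set_ r f => seqf (fill 0 f) (fill r (Atom 0 0 1 2))
  | Seq p q => seqf (compp j p) (compp j q)
  | Rep p =>
      seqf (until (2, j + 3) is_end
             (seqf (compp j.+1 p) (moves [:: ((2, j + 3), MoveR)])))
           (home (2, j + 3))
  | When f p => bind (compf 0 f) (fun b => if b then compp j p else ret tt)
  end.

Fixpoint tprog (n : nat) (p : prog) : nat :=
  match p with
  | Skip => 1
  | Set_ r f => tfill n f + tfill n (Atom 0 0 1 2)
  | Seq p q => tprog n p + tprog n q
  | Rep p => tfor n (tprog n p)
  | When f p => tcomp n f + (tprog n p + 1)
  end.

(** The buffer and the cells that are not the address of a triple stay unspecified, so the final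
    contents are only asserted to exist; loops therefore go through [does_until_inv]. *)
Lemma does_compp p j k bits s :
  aux_ok -> tape_ok K (0, 0) -> vars3_ok -> tape_ok K (3, 0) ->
  prog_ok j p -> (forall i, i < 3 -> k i = 0) ->
  (forall i, j <= i -> k (i + 3) = 0) ->
  (forall r, r != 0 -> stored bits s r) ->
  exists2 bits', does K (compp j p) (tprog N p) (conf (pos_of [::] k) bits) tt
      (conf (pos_of [::] k) bits') &
    forall r, r != 0 -> stored bits' (exec p s) r.
Proof.
move=> aux iK v3 b0; elim: p j k bits s => [|r f|p IHp q IHq|p IH|f p IH] j k bits s /=.
- by move=> _ _ _ st; exists bits => //; apply: does_ret.
- move=> /and4P[r0 rK nm ok] kz _ st.
  have az : aux_zero (pos_of [::] k) by split; apply: kz.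
  have [|b1 d1 [b1E b1F]] := @does_fill 0 f k bits s aux iK v3 b0 ok az nm.
    by move=> r' mr'; apply: st; apply: contraNneq nm => <-.
  pose s1 : store := fun r x y z => b1 r (addr x y z).
  have v3' := and3P v3.
  have [|//|b2 d2 [b2E b2F]] := @does_fill r (Atom 0 0 1 2) k b1 s1
    aux iK v3 rK _ az r0.
    by case: v3' => a b c; rewrite /= /var_ok a b c b0.
  exists b2; first exact: does_seqf d1 d2.
  move=> r' r'0 x y z xN yN zN; rewrite /upd.
  case: eqP => [->|/eqP ne]; first by rewrite b2F //= /s1 b1F.
  by rewrite b2E // b1E // st.
- move=> /andP[okp okq] kz kj st.
  have [b1 d1 st1] := IHp _ _ _ _ okp kz kj st.
  have [b2 d2 st2] := IHq _ _ _ _ okq kz kj st1.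
  by exists b2 => //; apply: does_seqf d1 d2.
- move=> /andP[jK ok] kz kj st.
  pose k' v := upd k (j + 3) v.
  have Pj v : pos_of [::] (k' v) (2, j + 3) = v by rewrite /pos_of /= /k' upd_same.
  have PE v v' : upd (pos_of [::] (k' v)) (2, j + 3) v' = pos_of [::] (k' v').
    apply: functional_extensionality => -[a b].
    rewrite /upd /pos_of /k' /upd xpair_eqE /=.
    by case: a => [|[|[|]]] //=; case: eqP.
  have k0 : k = k' 0 by rewrite /k' upd_eq // kj.
  pose I v a := exists2 b, a = conf (pos_of [::] (k' v)) b &
    forall r, r != 0 -> stored b (iter v (exec p) s) r.
  have [||||a' d' [b' a'E st']] := @does_until_inv K (2, j + 3) is_end
    (seqf (compp j.+1 p) (moves [:: ((2, j + 3), MoveR)])) N I (tprog N p + 1)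
    jK _ _ _ (conf (pos_of [::] k) bits).
  + move=> v a vN [b -> _].
    by rewrite (@hd_counter _ _ 1) // mk_symE Pj; lia.
  + by move=> a [b -> _]; rewrite (@hd_counter _ _ 1) // mk_symE Pj eqxx.
  + move=> v a vN [b -> st'].
    have [i i3|i ij|b1 d1 st1] := IH j.+1 (k' v) b _ ok _ _ st'.
    * by rewrite /k' /upd; case: eqP => [|_]; [lia | apply: kz].
    * by rewrite /k' /upd; case: eqP => [|_]; [lia | apply: kj; lia].
    exists (conf (pos_of [::] (k' v.+1)) b1); last by exists b1.
    apply: does_seqf d1 _.
    apply: does_moves => i; rewrite /moves_of /=; first by case: eqP.
    by rewrite -(PE v) /upd eq_sym; case: eqP => //= <-; rewrite Pj.
  + by exists bits; rewrite -?k0.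
  exists b' => //; apply: does_seqf d' _.
  rewrite a'E [in X in does _ _ _ _ _ X]k0 -(PE N 0); apply: does_home => //.
  by rewrite Pj.
- move=> /and3P[nm okf okp] kz kj st.
  have az : aux_zero (pos_of [::] k) by split; apply: kz.
  have st' : forall r', mentions r' f -> stored bits s r'.
    by move=> r' mr'; apply: st; apply: contraNneq nm => <-.
  have d1 := does_comp (e := [::]) aux iK okf az isT st'.
  case: ifP => fE; last first.
    exists bits => //; apply: (does_bind d1); rewrite fE.
    by apply: (does_le (T := 1)); [lia | apply: does_ret].
  have [b1 d2 st1] := IH _ _ _ _ okp kz kj st.
  exists b1 => //; apply: (does_bind d1); rewrite fE.
  by apply: does_le d2; lia.
Qed.

End Language.

(** * Compilation to a Turing machine *)

Section Initialise.
Variables (K : nat) (w : seq bool).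
Local Notation N := (size w).

(** The input head runs to the first blank, which is cell N, and takes the heads of kinds 1 and 2
    along, so that all of them can write the end mark there. The way back is controlled by counter
    (2, 0), since the input tape has no mark. *)
Definition initialise : frag unit :=
  seqf (op (0, 0) (fun _ => (tt, fun t =>
         (if 0 < t.1 < 4 then Some (mk_sym true false false) else None, MoveN))))
  (seqf (loop (op (0, 0) (fun s =>
          if s is None then (Some tt, stay)
          else (None, fun t => (None, if t.1 < 3 then MoveR else MoveN)))))
  (seqf (op (0, 0) (fun _ => (tt, fun t =>
          (if 0 < t.1 < 3 then Some (mk_sym false true false) else None, MoveN))))
        (until (2, 0) is_origin (op (0, 0) (fun _ =>
          (tt, fun t => (None, if t.1 < 3 then MoveL else MoveN))))))).

Definition tinitialise (n : nat) := 1 + ((n + 1) + (1 + tuntil n 1)).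

Definition blank_conf : acfg :=
  fun t => (0, if t == (0, 0) then input_cell w else fun _ => None).

(** [0 < N] keeps the end mark from overwriting the origin mark. *)
Lemma does_initialise :
  0 < N -> tape_ok K (2, 0) ->
  does K initialise (tinitialise N) blank_conf tt
    (conf w (pos_of [::] (fun _ => 0)) (fun _ _ => false)).
Proof.
move=> N0 ok2.
have ok0 : tape_ok K (0, 0) by [].
pose c1 (t : tid) j := if 0 < t.1 < 4 then mk_sym (j == 0) false false
                       else (blank_conf t).2 j.
pose S j : acfg := fun t => (if t.1 < 3 then j else 0, c1 t).
pose Q j := conf w (fun t => if t.1 < 3 then N - j else 0) (fun _ _ => false).
apply: (@does_seqf _ _ _ _ _ _ _ _ tt (S 0)).
  set act := fun t : tid => (_, MoveN).
  have -> : S 0 = aact act blank_conf.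
    apply: functional_extensionality => t; rewrite /S /aact /act /hd /=.
    congr (_, _); first by case: ifP.
    apply: functional_extensionality => j; rewrite /c1 /upd.
    case: ifP => t1; last by case: eqP => // ->.
    case: eqP => // _; rewrite /mk_sym /=.
    by case: eqP => // E; move: t1; rewrite E.
  exact: does_op.
apply: (@does_seqf _ _ _ _ _ _ _ _ tt (S N)).
  have main n j : n = N - j -> j <= N ->
      does K (loop (op (0, 0) (fun s : sym =>
          if s is None then (Some tt, stay)
          else (None, fun t => (None, if t.1 < 3 then MoveR else MoveN)))))
        (n + 1) (S j) tt (S N).
    elim: n j => [|n IH] j nE jN.
      have -> : j = N by lia.
      apply: does_loop_stop; rewrite -{2}(aact_stay (S N)).
      apply: does_op => //; rewrite /hd /= /c1 /= /input_cell.
      by rewrite nth_default // size_map.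
    have -> : n.+1 + 1 = 1 + (n + 1) by lia.
    apply: (does_loop_next _ (IH j.+1 _ _)); try lia.
    set act := fun t : tid => (_, _).
    have -> : S j.+1 = aact act (S j).
      apply: functional_extensionality => t.
      rewrite /S /aact /act /hd /= upd_id.
      by congr (_, _); case: ifP.
    apply: does_op => //; last first.
      by move=> i; rewrite /act /=; case: ifP.
    rewrite /hd /= /c1 /= /input_cell (nth_map false) //; lia.
  by apply: main; rewrite ?subn0.
apply: (@does_seqf _ _ _ _ _ _ _ _ tt (Q 0)).
  set act := fun t : tid => (_, MoveN).
  have -> : Q 0 = aact act (S N).
    apply: functional_extensionality => -[a b]; rewrite /Q /conf /S /aact /act /hd /=.
    congr (_, _); first by rewrite subn0.
    have N0' : (N == 0) = false by lia.
    case: a => [|[|[|[|a]]]] /=; rewrite ?upd_id;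
      apply: functional_extensionality => j; rewrite /c1 /cells //=.
    - by rewrite xpair_eqE /=; case: eqP.
    - by rewrite /upd; case: (j =P N) => [->|_]; rewrite ?N0'.
    - by rewrite /upd; case: (j =P N) => [->|_]; rewrite ?N0'.
  exact: does_op.
have -> : conf w (pos_of [::] (fun=> 0)) (fun _ _ => false) = Q N.
  rewrite /Q; congr conf; apply: functional_extensionality => -[a b].
  rewrite /pos_of /= subnn nth_nil; case: ifP => //; by case: a => [|[|[|]]].
apply: (@does_until _ _ _ _ _ Q) => //.
- by move=> j jn; rewrite (@hd_counter _ _ _ 1) // mk_symE /=; lia.
- by rewrite (@hd_counter _ _ _ 1) // mk_symE /= subnn.
- move=> j jn; set act := fun t : tid => (_, _).
  have -> : Q j.+1 = aact act (Q j).
    apply: functional_extensionality => t.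
    rewrite /Q /conf /aact /act /hd /= upd_id.
    by congr (_, _); case: ifP => // _ /=; lia.
  apply: does_op => // i; rewrite /act /=; case: ifP => // _ _; lia.
Qed.

End Initialise.

Section MachineOfFragment.
Variables (K : nat) (F : frag bool).

Definition machine_of : machine :=
  @Machine K mark (fstate F + bool)%type (inl (fstart F))
    (fun q => if q is inr b then Some b else None)
    (fun q s =>
       match q with
       | inl q => let: (x, a) := fnext q (@reads K s) in (x, @resolve K a s)
       | inr b => (inr b, fun i => (s i, MoveN))
       end).

Lemma iter_step_machine_of q c n b c' :
  @run K _ F q c n b c' ->
  iter n (@step machine_of) (@Config machine_of (inl q) c) =
  @Config machine_of (inr b) c'.
Proof.
elim=> {q c n b c'} [q c b a h|q c n q' a b c' h _ IH].
  by rewrite /= /step /= -/(heads c) h.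
by rewrite iterSr -IH; congr iter; rewrite /step /= -/(heads c) h.
Qed.

Lemma rep_init w : rep (ctapes (init machine_of w)) (blank_conf w).
Proof.
move=> i; rewrite /= /blank_conf.
case: (i =P ord0) => [->|ne] /=.
  by split=> // j; rewrite /= nth_behead add0n.
have -> : (tape_decode i == (0, 0)) = false.
  rewrite /tape_decode xpair_eqE; apply/negP => /andP[/eqP i1 /eqP i2].
  by apply: ne; apply: val_inj; rewrite /= (divn_eq i 4) i1 i2.
by split=> //= j; rewrite nth_nil.
Qed.

End MachineOfFragment.

(** * Polynomial bounds for the running times *)

Definition poly_bounded (f : nat -> nat) : Prop :=
  exists P : {poly nat}, forall n, f n <= P.[n]%R.

Lemma poly_bounded_const c : poly_bounded (fun=> c).
Proof. by exists (c%:P)%R => n; rewrite hornerC. Qed.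

Lemma poly_bounded_id : poly_bounded id.
Proof. by exists 'X%R => n; rewrite hornerX. Qed.

Lemma poly_bounded_add f g :
  poly_bounded f -> poly_bounded g -> poly_bounded (fun n => f n + g n).
Proof.
by move=> [P fP] [Q gQ]; exists (P + Q)%R => n; rewrite hornerD leq_add.
Qed.

Lemma poly_bounded_mul f g :
  poly_bounded f -> poly_bounded g -> poly_bounded (fun n => f n * g n).
Proof.
by move=> [P fP] [Q gQ]; exists (P * Q)%R => n; rewrite hornerM leq_mul.
Qed.

Lemma poly_bounded_exp f d :
  poly_bounded f -> poly_bounded (fun n => f n ^ d).
Proof.
move=> bf; elim: d => [|d IH]; first exact: poly_bounded_const.
by have [P h] := poly_bounded_mul bf IH; exists P => n; rewrite expnS.
Qed.

Lemma poly_bounded_tuntil f g :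
  poly_bounded f -> poly_bounded g -> poly_bounded (fun n => tuntil (f n) (g n)).
Proof.
move=> bf bg; apply: poly_bounded_add (poly_bounded_const _).
by apply: poly_bounded_mul => //; apply: poly_bounded_add (poly_bounded_const _).
Qed.

#[local] Hint Resolve poly_bounded_const poly_bounded_id poly_bounded_add
  poly_bounded_mul poly_bounded_exp poly_bounded_tuntil : polyb.

Lemma poly_bounded_tadvance d : poly_bounded (fun n => tadvance n d).
Proof. elim: d => [|d IH] /=; auto 10 with polyb. Qed.

Lemma poly_bounded_tadd_var d : poly_bounded (fun n => tadd_var n d).
Proof.
have := poly_bounded_tadvance d; rewrite /tadd_var; auto 10 with polyb.
Qed.

Lemma poly_bounded_tgoto : poly_bounded tgoto.
Proof.
have h := poly_bounded_tadd_var.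
by apply: poly_bounded_add => //; apply: poly_bounded_add.
Qed.

#[local] Hint Resolve poly_bounded_tadd_var poly_bounded_tgoto : polyb.

Lemma poly_bounded_tcomp f : poly_bounded (fun n => tcomp n f).
Proof.
elim: f => [r x y z|x|x y|f IH|f IHf g IHg|f IHf g IHg|f IH] /=; rewrite /tlt;
  auto 20 with polyb.
Qed.

Lemma poly_bounded_tfor f :
  poly_bounded f -> poly_bounded (fun n => tfor n (f n)).
Proof. by rewrite /tfor; auto 10 with polyb. Qed.

#[local] Hint Resolve poly_bounded_tcomp poly_bounded_tfor : polyb.

Lemma poly_bounded_tprog p : poly_bounded (fun n => tprog n p).
Proof.
elim: p => [|r f|p IHp q IHq|p IH|f p IH] /=; rewrite /tfill; auto 20 with polyb.
Qed.

#[local] Hint Resolve poly_bounded_tprog : polyb.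

Definition answer (w : seq bool) (p : prog) (f : fm) : bool :=
  eval w (exec w p (fun _ _ _ _ => false)) [::] f.

(** The number of tapes depends on the program alone; the input length enters through the end marks.
    All relations start empty because their tapes are blank. *)
Lemma program_polytime (K : nat) (p : prog) (f : fm) :
  aux_ok K && vars3_ok K && tape_ok K (3, 0) ->
  prog_ok K 0 p -> ~~ mentions 0 f -> fm_ok K 0 f ->
  exists (M : machine) (P : {poly nat}), forall w, 0 < size w ->
    halts_within M w P.[size w]%R (answer w p f).
Proof.
move=> /andP[/andP[aux v3] b0] okp nm okf.
have [P PE] : poly_bounded
    (fun n => tinitialise n + (tprog n p + tcomp n f)).
  by rewrite /tinitialise; auto 20 with polyb.
pose F := seqf initialise (seqf (compp 0 p) (compf 0 f)).
exists (machine_of K F), P => w w0.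
have ok2 : tape_ok K (2, 0) by have /and3P[] := aux.
have d0 := does_initialise w0 ok2.
have [//|//|//|b1 d1 st1] := @does_compp K w p 0 (fun=> 0) (fun _ _ => false)
  (fun _ _ _ _ => false) aux isT v3 b0 okp.
have az : aux_zero (pos_of [::] (fun=> 0)) by split.
have st2 : forall r, mentions r f -> stored w b1 (exec w p (fun _ _ _ _ => false)) r.
  by move=> r mr; apply: st1; apply: contraNneq nm => <-.
have d3 := @does_comp K w f [::] (fun=> 0) b1 _ aux isT okf az isT st2.
have [d] := does_seqf d0 (does_seqf d1 d3).
have [n [c [nT r _]]] := d _ (@rep_init K F w).
exists n; first exact: leq_trans nT (PE _).
by rewrite /init (iter_step_machine_of r).
Qed.

(** * Elimination of the leaves *)

Lemma connect_inv (T : finType) (e : rel T) (Q : T -> Prop) x :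
  Q x -> (forall y z, Q y -> e y z -> Q z) -> forall y, connect e x y -> Q y.
Proof.
move=> Qx step y /connectP[s]; elim: s x Qx => [|z s IH] x Qx /=.
  by move=> _ ->.
by case/andP=> exz; apply: IH; apply: step exz.
Qed.

Section Spine.
Variables (n k : nat) (G : sgraph 'I_n) (L : {ffun 'I_n -> {set 'I_k}}).
Local Notation coloring := {ffun 'I_n -> 'I_k}.

(* In a component with two vertices the smaller one stays on the spine. *)
Definition leaf (l : 'I_n) : bool :=
  [exists w, [&& G l w, [forall w', G l w' ==> (w' == w)] &
     [exists w'', (w'' != l) && G w w''] || (w < l)]].

Definition spine : {set 'I_n} := [set v | ~~ leaf v].

(** Two adjacent leaves would form a whole component, and there the comparison of the two numbers
    makes only the larger one a leaf. *)
Lemma leafP l :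
  leaf l -> exists w, [/\ G l w, forall w', G l w' -> w' = w & w \in spine].
Proof.
case/existsP=> w /and3P[lw /forallP uniq other].
have {}uniq w' : G l w' -> w' = w.
  by move=> lw'; apply/eqP; have /implyP := uniq w'; apply.
exists w; split=> //; rewrite inE; apply/negP => /existsP[x].
case/and3P=> wx /forallP uw ox.
have wl : G w l by rewrite adj_sym.
have xl : l = x by apply/eqP; have /implyP := uw l; apply.
subst x; case/orP: other => [/existsP[y /andP[yl wy]]|lt].
  by have /implyP := uw y => /(_ wy); rewrite (negPf yl).
case/orP: ox => [/existsP[y /andP[yw ly]]|lt']; last by lia.
by rewrite (uniq y ly) eqxx in yw.
Qed.

(* A spine vertex can be recolored from a to b (or can have color a = b) as
   far as its own list and the leaves attached to it are concerned. *)
Definition switch (v : 'I_n) (a b : 'I_k) : bool :=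
  [&& a \in L v, b \in L v &
      [forall l, G v l && leaf l ==>
         [exists c, [&& c \in L l, c != a & c != b]]]].

Lemma switch_sym v a b : switch v a b = switch v b a.
Proof.
rewrite /switch andbCA; congr [&& _, _ & _]; apply: eq_forallb => l.
by congr (_ ==> _); apply: eq_existsb => c; rewrite [(_ != a) && _]andbC.
Qed.

Section Steps.
Variable P : {set 'I_n}.

(** Colorings of [P] are total maps with arbitrary values outside [P], which avoids partial maps.
    [switch v a a] puts [a] in the list of [v] and leaves every leaf at [v] a color other than
    [a]. *)
Definition valid (f : coloring) : bool :=
  [forall v in P, switch v (f v) (f v)] &&
  [forall v in P, forall w in P, G v w ==> (f v != f w)].

(* Recoloring of at most one vertex of P; the colors outside P are ignored. *)
Definition rstep (f g : coloring) : bool :=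
  [&& valid f, valid g, [forall v in P, switch v (f v) (g v)] &
      [exists v, forall w in P, (w != v) ==> (f w == g w)]].

Lemma validP (f : coloring) :
  reflect ((forall v, v \in P -> switch v (f v) (f v)) /\
           (forall v w, v \in P -> w \in P -> G v w -> f v != f w)) (valid f).
Proof.
apply: (iffP andP) => [] [h1 h2]; split.
- by move=> v vP; have /forallP/(_ v)/implyP := h1; apply.
- move=> v w vP wP vw; have /forallP/(_ v)/implyP/(_ vP) := h2.
  by move=> /forallP/(_ w)/implyP/(_ wP)/implyP; apply.
- by apply/forallP => v; apply/implyP; apply: h1.
- apply/forallP => v; apply/implyP => vP; apply/forallP => w.
  by apply/implyP => wP; apply/implyP; apply: h2.
Qed.

Lemma rstepP (f g : coloring) :
  reflect [/\ valid f, valid g, forall v, v \in P -> switch v (f v) (g v) &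
             exists v, forall w, w \in P -> w != v -> f w = g w] (rstep f g).
Proof.
apply: (iffP and4P) => [] [h1 h2 h3 h4]; split=> //.
- by move=> v vP; have /forallP/(_ v)/implyP := h3; apply.
- have /existsP[v /forallP h] := h4; exists v => w wP wv; apply/eqP.
  by have /implyP/(_ wP)/implyP := h w; apply.
- by apply/forallP => v; apply/implyP; apply: h3.
- have [v h] := h4; apply/existsP; exists v; apply/forallP => w.
  by apply/implyP => wP; apply/implyP => wv; apply/eqP; apply: h.
Qed.

Lemma rstep_sym : symmetric rstep.
Proof.
suff h f g : rstep f g -> rstep g f by move=> f g; apply/idP/idP; apply: h.
case/rstepP=> vf vg sw [v h]; apply/rstepP; split=> //.
  by move=> x xP; rewrite switch_sym sw.
by exists v => x xP xv; rewrite h.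
Qed.

Lemma valid_ext (f g : coloring) : {in P, f =1 g} -> valid f -> valid g.
Proof.
move=> fg /validP[h1 h2]; apply/validP; split=> [v vP|v w vP wP vw].
  by rewrite -fg // h1.
by rewrite -!fg // h2.
Qed.

Lemma rstep_ext (v0 : 'I_n) (f g : coloring) : {in P, f =1 g} -> valid f -> rstep f g.
Proof.
move=> fg vf; apply/rstepP; split=> //; first exact: valid_ext vf.
  by move=> v vP; rewrite -fg //; have /validP[h _] := vf; apply: h.
by exists v0 => w wP _; apply: fg.
Qed.

Lemma connect_valid f g : valid f -> connect rstep f g -> valid g.
Proof.
by move=> vf; apply: (@connect_inv _ _ (fun h => valid h)) => // x y _ /rstepP[].
Qed.

End Steps.

Lemma list_coloringP (f : coloring) :
  reflect ((forall v, f v \in L v) /\ (forall v w, G v w -> f v != f w))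
          (list_coloring G L f).
Proof.
apply: (iffP andP) => [] [h1 h2]; split.
- by move=> v; apply: (forallP h1).
- by move=> v w; have /forallP/(_ v)/forallP/(_ w)/implyP := h2.
- by apply/forallP.
- by apply/forallP => v; apply/forallP => w; apply/implyP; apply: h2.
Qed.

Lemma list_coloring_valid P f : list_coloring G L f -> valid P f.
Proof.
case/list_coloringP=> fL prop; apply/validP; split=> [v _|v w _ _]; last exact: prop.
rewrite /switch fL /=; apply/forallP => l; apply/implyP => /andP[vl _].
apply/existsP; exists (f l); rewrite fL /= andbb eq_sym; exact: prop.
Qed.

(** A leaf that is not recolored has a color different from both the old and the new color of its
    neighbor; and when a leaf is recolored, its neighbor is not. *)
Lemma reconf_adj_rstep f g : reconf_adj G L f g -> rstep spine f g.
Proof.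
case/and3P=> cf cg /cards1P[x dE].
have same v : v != x -> f v = g v.
  move=> vx; apply/eqP; rewrite -[_ == _]negbK.
  by have := in_set1 v x; rewrite -dE inE => ->.
apply/rstepP; split; try exact: list_coloring_valid.
- move=> v _; have /list_coloringP[fL fp] := cf; have /list_coloringP[gL gp] := cg.
  rewrite /switch fL gL /=; apply/forallP => l; apply/implyP => /andP[vl _].
  have [lx|lx] := eqVneq l x; last first.
    apply/existsP; exists (f l); rewrite fL /= [f l == f v]eq_sym fp //=.
    by rewrite (same l lx) eq_sym gp.
  have vx : v != x by apply: contraTneq vl => ->; rewrite lx adj_irr.
  apply/existsP; exists (f l); rewrite fL /= -(same v vx) andbb.
  by rewrite eq_sym fp.
- by exists x => v _; apply: same.
Qed.

(** The only neighbor of a leaf lies on the spine, where the two colorings already agree, so the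
    leaves can go straight to their final colors in any order. *)
Lemma connect_same_spine (f g : coloring) :
  list_coloring G L f -> list_coloring G L g -> {in spine, f =1 g} ->
  connect (reconf_adj G L) f g.
Proof.
move=> cf cg fg; have [m] := ubnP #|[set v | f v != g v]|.
elim: m f cf fg => // m IH f cf fg lt.
case: (pickP [pred v | f v != g v]) => [x /= fx|same]; last first.
  have -> : f = g by apply/ffunP => v; apply/eqP; have /negbFE := same v.
  exact: connect0.
have xl : leaf x.
  by apply: contraNT fx => xs; rewrite fg // inE.
pose h := [ffun v => if v == x then g v else f v].
have /list_coloringP[fL fp] := cf; have /list_coloringP[gL gp] := cg.
have nbr v : G x v -> f v = g v.
  by have [w [xw uw ws]] := leafP xl => /uw ->; apply: fg.
have ch : list_coloring G L h.
  apply/list_coloringP; split=> [v|v w vw]; rewrite !ffunE; first by case: ifP.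
  case: (v =P x) => [vx|_]; case: (w =P x) => [wx|_]; try exact: gp;
    try exact: fp.
    by rewrite (nbr w) ?gp // -vx.
  by rewrite (nbr v) ?gp // adj_sym -wx.
apply: (@connect_trans _ _ h).
  apply: connect1; rewrite /reconf_adj cf ch /=; apply/cards1P; exists x.
  apply/setP => v; rewrite !inE ffunE; case: (v =P x) => [->|]; first by rewrite fx.
  by rewrite eqxx.
apply: IH => //.
  by move=> v vs; rewrite ffunE; case: eqP => // _; apply: fg.
apply: leq_trans (_ : #|[set v | f v != g v]| <= m); last by [].
apply: proper_card; apply/properP; split.
  by apply/subsetP => v; rewrite !inE ffunE; case: (v =P x) => //; rewrite eqxx.
by exists x; rewrite !inE // ffunE !eqxx.
Qed.

(** [switch] offers each leaf at the recolored vertex [x] a color that avoids both the old and the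
    new color of [x]. The leaves move there before [x] is recolored. *)
Lemma rstep_reconf (f g F : coloring) :
  rstep spine f g -> list_coloring G L F -> {in spine, F =1 f} ->
  exists F', [/\ list_coloring G L F', {in spine, F' =1 g} &
                connect (reconf_adj G L) F F'].
Proof.
case/rstepP=> vf vg sw [x same] cF Ff.
have /list_coloringP[FL Fp] := cF; have /validP[_ gp] := vg.
have [xs|xs] := boolP (x \in spine); last first.
  exists F; split=> // v vs; rewrite Ff // same //.
  by apply: contraNneq xs => <-.
have [fgx|fgx] := eqVneq (f x) (g x).
  exists F; split=> // v vs; rewrite Ff //; have [->|vx] := eqVneq v x; first by [].
  by rewrite same.
have /and3P[_ gxL /forallP lv] := sw x xs.
(* The default is never taken at a leaf attached to [x], and [F1] uses [col] nowhere else. *)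
pose col l := odflt (F l) [pick c | [&& c \in L l, c != f x & c != g x]].
have colP l : G x l -> leaf l -> [/\ col l \in L l, col l != f x & col l != g x].
  move=> xl ll; rewrite /col; case: pickP => [c /and3P[]|no] //=.
  have := lv l; rewrite xl ll /= => /existsP[c hc].
  by have := no c; rewrite /= hc.
pose F1 := [ffun v => if G x v && leaf v then col v else F v].
have F1s : {in spine, F1 =1 F}.
  by move=> v; rewrite inE ffunE => /negPf ->; rewrite andbF.
have lone l v : G x l -> leaf l -> G l v -> v = x.
  move=> xl ll lv'; have [w [_ uw _]] := leafP ll.
  by rewrite (uw v) // (uw x) // adj_sym.
have cF1 : list_coloring G L F1.
  apply/list_coloringP; split=> [v|v w vw]; rewrite !ffunE.
    by case: ifP => // /andP[xv lv']; have [] := colP v.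
  have Fx : F x = f x by apply: Ff.
  case: ifP => [/andP[xv lv']|nv]; case: ifP => [/andP[xw lw]|nw].
  - have wx := lone v w xv lv' vw; by move: xw; rewrite wx adj_irr.
  - by rewrite (lone v w xv lv' vw) Fx; have [] := colP v.
  - have wv : G w v by rewrite adj_sym.
    by rewrite (lone w v xw lw wv) Fx eq_sym; have [] := colP w.
  - exact: Fp.
pose F2 := [ffun v => if v == x then g x else F1 v].
have F2s : {in spine, F2 =1 g}.
  move=> v vs; rewrite ffunE; case: eqP => [->//|/eqP vx].
  by rewrite F1s // Ff // same.
have /list_coloringP[F1L F1p] := cF1.
have F2p v w : G v w -> v = x -> F2 v != F2 w.
  move=> vw vx; have wx : w != x by apply: contraTneq vw => ->; rewrite vx adj_irr.
  rewrite !ffunE vx eqxx (negPf wx) -vx vw /=.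
  have xw : G x w by rewrite -vx.
  case: ifP => lw; first by rewrite vx eq_sym; have [] := colP w.
  have ws : w \in spine by rewrite inE lw.
  by rewrite Ff // same // vx gp.
have cF2 : list_coloring G L F2.
  apply/list_coloringP; split=> [v|v w vw].
    by rewrite ffunE; case: eqP => [->|].
  have [vx|vx] := eqVneq v x; first exact: F2p.
  have [wx|wx] := eqVneq w x.
    by rewrite eq_sym; apply: F2p => //; rewrite adj_sym.
  by rewrite ffunE (negPf vx) [X in _ != X]ffunE (negPf wx); apply: F1p.
exists F2; split=> //.
apply: (@connect_trans _ _ F1).
  by apply: connect_same_spine => // v vs; rewrite F1s.
apply: connect1; rewrite /reconf_adj cF1 cF2 /=; apply/cards1P; exists x.
apply/setP => v; rewrite !inE [F2 v]ffunE; case: (v =P x) => [->|].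
  by rewrite F1s // Ff.
by rewrite eqxx.
Qed.

Lemma connect_reconf_spine f g :
  list_coloring G L f -> list_coloring G L g ->
  connect (reconf_adj G L) f g = connect (rstep spine) f g.
Proof.
move=> cf cg; apply/idP/idP.
  apply: connect_sub => x y xy; apply: connect1; exact: reconf_adj_rstep.
suff main (h : coloring) : connect (rstep spine) f h -> exists F,
    [/\ list_coloring G L F, {in spine, F =1 h} & connect (reconf_adj G L) f F].
  case/main=> F [cF Fg fF]; apply: connect_trans fF _.
  exact: connect_same_spine.
apply: (@connect_inv _ _ (fun h : coloring => exists F, [/\ list_coloring G L F,
  {in spine, F =1 h} & connect (reconf_adj G L) f F])) => [|x y [F [cF Fx fF]] xy].
  by exists f; split.
have [F' [cF' F'y FF']] := rstep_reconf xy cF Fx.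
by exists F'; split=> //; apply: connect_trans FF'.
Qed.

(** * Graphs of pathwidth one *)

Section Width1.
Variable s : seq {set 'I_n}.
Hypotheses (dec : path_decomposition G s) (width2 : forall X, X \in s -> #|X| <= 2).

Local Notation bag i := (nth set0 s i).

Lemma bag_two i x y z : x \in bag i -> y \in bag i -> z \in bag i ->
  x != y -> x != z -> y = z.
Proof.
move=> xi yi zi xy xz; apply/eqP; apply: contraTT (isT) => yz.
have [lt|ge] := ltnP i (size s); last by rewrite nth_default // inE in xi.
have := width2 (mem_nth set0 lt); rewrite leqNgt => /negP[].
have sub : [set x; y; z] \subset bag i.
  by apply/subsetP => u; rewrite !inE => /orP[/orP[]|] /eqP->.
apply: leq_trans (subset_leq_card sub).
by rewrite -setUA cardsU1 cards2 !inE negb_or xy xz yz.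
Qed.

Lemma bag_edge u v : G u v -> exists i, (u \in bag i) && (v \in bag i).
Proof.
case: dec => _ h _ /h[X Xs uv]; exists (index X s).
by rewrite nth_index.
Qed.

Lemma bag_size i x : x \in bag i -> i < size s.
Proof. by move=> h; rewrite ltnNge; apply: contraTN h => ge; rewrite nth_default ?inE. Qed.

Lemma bag_vertex v : exists i, v \in bag i.
Proof.
case: dec => cov _ _; have : v \in [set: 'I_n] by [].
rewrite -cov; elim: (s) => [|X s' IH]; first by rewrite big_nil inE.
rewrite big_cons inE => /orP[vX|/IH[i vi]]; first by exists 0.
by exists i.+1.
Qed.

Lemma bag_between p q r x :
  x \in bag p -> x \in bag r -> p <= q -> q <= r -> x \in bag q.
Proof.
move=> xp xr pq qr; case: dec => _ _ h.
by apply: (subsetP (h _ _ _ pq qr (bag_size xr))); rewrite inE xp.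
Qed.

Definition first_bag v := ex_minn (bag_vertex v).

Lemma last_bag_bound v i : v \in bag i -> i <= size s.
Proof. by move/bag_size/ltnW. Qed.

Definition last_bag v := ex_maxn (bag_vertex v) (@last_bag_bound v).

Lemma last_bagP v : v \in bag (last_bag v) /\ forall i, v \in bag i -> i <= last_bag v.
Proof. by rewrite /last_bag; case: ex_maxnP => i vi h; split. Qed.

Lemma first_bagP v :
  v \in bag (first_bag v) /\ forall i, v \in bag i -> first_bag v <= i.
Proof. by rewrite /first_bag; case: ex_minnP => i vi h; split. Qed.

(** Take the vertex of [U] whose last bag is earliest. Its neighbors in [U] last at least as long,
    so they all lie in that bag, which has room for only one of them. *)
Lemma degenerate (U : {set 'I_n}) : U != set0 -> exists2 v, v \in U &
  forall x y, x \in U -> y \in U -> G v x -> G v y -> x = y.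
Proof.
case/set0Pn=> v0 v0U.
case: (arg_minnP last_bag v0U) => v vU vmin; exists v => // x y xU yU vx vy.
have [vl vmax] := last_bagP v.
have in_last z : z \in U -> G v z -> z \in bag (last_bag v).
  move=> zU vz; have [i /andP[vi zi]] := bag_edge vz.
  have [zl _] := last_bagP z.
  exact: bag_between zi zl (vmax _ vi) (vmin _ zU).
have ne z : G v z -> v != z by move=> vz; apply: contraTneq vz => ->; rewrite adj_irr.
by apply: (bag_two vl (in_last x xU vx) (in_last y yU vy)); apply: ne.
Qed.

(** A bag between the first and the last one of [u] contains [u] and at most one other vertex. A
    neighbor of [u] that avoids these two end bags shares every bag of its own with [u], so it has
    no other neighbor and is a leaf, as [u] has a second neighbor. Each spine neighbor thus lies in
    an end bag, and each end bag holds only one. *)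
Lemma spine_degree u x y z : x \in spine -> y \in spine -> z \in spine ->
  G u x -> G u y -> G u z -> [|| x == y, x == z | y == z].
Proof.
move=> xs ys zs ux uy uz; apply: contraTT (isT); rewrite !negb_or.
case/and3P=> xy xz yz.
have ne v : G u v -> u != v by move=> uv; apply: contraTneq uv => ->; rewrite adj_irr.
have [ulast umax] := last_bagP u; have [ufirst umin] := first_bagP u.
have ends v v' : v \in spine -> G u v -> G u v' -> v' != v ->
    (v \in bag (first_bag u)) || (v \in bag (last_bag u)).
  move=> vs uv uv' v'v; apply: contraTT vs; rewrite negb_or => /andP[nf nl].
  rewrite inE negbK; apply/existsP; exists u.
  have [j /andP[uj vj]] := bag_edge uv.
  (* A bag of [v] outside the interval of [u] would put [v] into an end bag, because the bags of [v]
     are consecutive and one of them contains [u]. *)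
  have inside i : v \in bag i -> u \in bag i.
    move=> vi; have [le1|lt1] := leqP (first_bag u) i; last first.
      case/negP: nf; apply: bag_between vi vj _ (umin _ uj); exact: ltnW.
    have [le2|lt2] := leqP i (last_bag u).
      exact: bag_between ufirst ulast le1 le2.
    case/negP: nl; apply: bag_between vj vi (umax _ uj) _; exact: ltnW.
  apply/and3P; split; first by rewrite adj_sym.
    apply/forallP => w; apply/implyP => vw; apply: contraTT (isT) => wu.
    have [i /andP[vi wi]] := bag_edge vw.
    have vne : v != w by apply: contraTneq vw => ->; rewrite adj_irr.
    have := bag_two vi wi (inside i vi) vne; rewrite eq_sym ne // => /(_ isT) E.
    by rewrite E eqxx in wu.
  by apply/orP; left; apply/existsP; exists v'; rewrite v'v uv'.
have one i v v' : u \in bag i -> G u v -> G u v' -> v \in bag i -> v' \in bag i ->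
    v = v'.
  by move=> ui uv uv' vi v'i; apply: (bag_two ui); rewrite ?ne.
have hx := ends x y xs ux uy; rewrite eq_sym xy in hx.
have hy := ends y x ys uy ux xy.
have hz := ends z x zs uz ux xz.
have contra i v v' : u \in bag i -> v \in bag i -> v' \in bag i -> G u v ->
  G u v' -> v != v' -> False.
  by move=> ui vi v'i uv uv' /eqP; apply; apply: one ui uv uv' vi v'i.
(* Three vertices in two end bags: two of them share one. *)
case/orP: (hx isT) => fx; case/orP: hy => fy; case/orP: hz => fz.
all: try by case: (contra _ _ _ ufirst fx fy ux uy xy).
all: try by case: (contra _ _ _ ulast fx fy ux uy xy).
all: try by case: (contra _ _ _ ufirst fx fz ux uz xz).
all: try by case: (contra _ _ _ ulast fx fz ux uz xz).
all: try by case: (contra _ _ _ ufirst fy fz uy uz yz).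
all: by case: (contra _ _ _ ulast fy fz uy uz yz).
Qed.

End Width1.

End Spine.

(** * Classes of colorings and their names *)

Section Classes.
Variables (n k : nat) (G : sgraph 'I_n) (L : {ffun 'I_n -> {set 'I_k}}).
Local Notation coloring := {ffun 'I_n -> 'I_k}.
Local Notation rstep := (rstep G L).
Local Notation valid := (valid G L).
Local Notation switch := (switch G L).
Variables (f0 fr : coloring) (N : nat).

Definition same_at (cur : option 'I_n) (f g : coloring) : bool :=
  if cur is Some u then f u == g u else true.

Definition estep (P : {set 'I_n}) cur (f g : coloring) : bool :=
  rstep P f g && same_at cur f g.

(* The colorings of the processed vertices P that are reachable from f0 fall
   into classes, connected by recolorings that fix the color of the current
   vertex.  The name p stands for the class [cls p], and a class may have
   several names.  [C p c] says that the current vertex has color c in the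
   class p, and [Par p c] that it has color c in the class of the parent of p
   in a spanning tree, rooted at r, of the graph [A] on the names [V]. *)
Record class_graph (P : {set 'I_n}) (cur : option 'I_n)
    (cls : nat -> coloring -> Prop) (V : nat -> Prop) (A C : nat -> nat -> Prop)
    (r : nat) (Tau : nat -> Prop) (Par : nat -> nat -> Prop) : Prop :=
  ClassGraph {
  cg_cur : forall u, cur = Some u -> u \in P;
  cg_bound : forall p, V p -> p < N;
  cg_inh : forall p, V p -> exists f, cls p f;
  cg_reach : forall p f, V p -> cls p f -> connect (rstep P) f0 f;
  cg_col : forall p f u c, V p -> cls p f -> cur = Some u ->
    C p c <-> c = f u;
  cg_closed : forall p f g, V p -> cls p f -> estep P cur f g -> cls p g;
  cg_conn : forall p f g, V p -> cls p f -> cls p g -> connect (estep P cur) f g;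
  cg_cover : forall f, connect (rstep P) f0 f -> exists2 p, V p & cls p f;
  cg_adj : forall p q, V p -> V q ->
    A p q <-> exists f g, [/\ cls p f, cls q g & rstep P f g];
  cg_root : V r /\ cls r f0;
  cg_target : forall p, Tau p <-> V p /\ cls p fr;
  cg_tree : forall (B : pred nat) z, V z -> B z -> ~~ B r -> exists y q,
    [/\ V y, V q, B y, ~~ B q & A q y /\ forall c, C q c -> Par y c];
  cg_par : forall y c c', V y -> Par y c -> Par y c' -> c = c'
}.

(** With nothing processed any two maps agree on [P], so there is one class, named by the root.
    [0 < n] provides the vertex that [rstep] asks for. *)
Lemma class_graph0 r (A C : nat -> nat -> Prop) Tau Par V :
  r < N -> (forall p, V p <-> p = r) -> A r r -> (forall p, Tau p <-> p = r) ->
  (forall y c, ~ Par y c) -> 0 < n ->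
  class_graph set0 None (fun _ _ => True) V A C r Tau Par.
Proof.
move=> rN VE Arr TE Par0 n0.
have all f g : rstep set0 f g.
  apply: (rstep_ext (Ordinal n0)) => [v|]; first by rewrite inE.
  by apply/validP; split=> [v|v w]; rewrite inE.
split.
- by [].
- by move=> p /VE->.
- by move=> p _; exists f0.
- by move=> p f _ _; apply: connect1.
- by [].
- by [].
- by move=> p f g _ _ _; apply: connect1; rewrite /estep all.
- by move=> f _; exists r => //; apply/VE.
- by move=> p q /VE-> /VE->; split=> // _; exists f0, f0.
- by split=> //; apply/VE.
- by move=> p; split=> [/TE/VE|[/VE/TE]].
- by move=> B z /VE-> ->.
- by move=> y c c' _ /Par0.
Qed.

(** * Adding one vertex to the class graph *)

Section Extend.
Variables (P : {set 'I_n}) (cur : option 'I_n) (cls : nat -> coloring -> Prop)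
  (V : nat -> Prop) (A C : nat -> nat -> Prop) (r : nat) (Tau : nat -> Prop)
  (Par : nat -> nat -> Prop).
Hypothesis CG : class_graph P cur cls V A C r Tau Par.

Variable v : 'I_n.
Hypothesis vP : v \notin P.
Hypothesis nbr_v : forall x, x \in P -> G x v -> cur = Some x.
Let P' := v |: P.
Hypothesis valid_f0 : valid P' f0.
Hypothesis valid_fr : valid P' fr.

(* The names of the classes whose component contains the root. *)
Variable nm : nat -> nat.
Hypothesis nm_bound : forall d, d < k -> nm d < N.
Hypothesis nm_inj : forall d d', d < k -> d' < k -> nm d = nm d' -> d = d'.
Hypothesis nm_fresh : forall d, d < k -> ~ V (nm d).

(** The old classes whose colorings allow color [d] at [v]. If the current vertex is not adjacent to
    [v], a new path begins and every class qualifies. *)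
Definition avoids (p d : nat) : Prop :=
  V p /\ forall u, cur = Some u -> G u v -> ~ C p d.

(** Connection through classes that avoid [d], specified by closure and induction only, which is
    what an iteration of the program can deliver. *)
Variable Reach : nat -> nat -> nat -> bool.
Hypothesis Reach_refl : forall d p, d < k -> avoids p d -> Reach d p p.
Hypothesis Reach_step : forall d p q q',
  d < k -> Reach d p q -> avoids q' d -> A q q' -> Reach d p q'.
Hypothesis Reach_ind : forall d p (Q : nat -> Prop), d < k ->
  (avoids p d -> Q p) ->
  (forall q q', Q q -> avoids q d -> avoids q' d -> A q q' -> Q q') ->
  forall q, Reach d p q -> Q q.

(** A new name of color [d] is the fresh one, for the component of the root, or an old name that
    avoids [d] while its parent has color [d]. Several names of the second kind may lie in one
    component; they then denote the same new class. *)
Variables (C' Class A' : nat -> nat -> Prop) (V' Tau' : nat -> Prop)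
  (Par' : nat -> nat -> Prop).
Hypothesis C'E : forall p d, C' p d <-> exists d' : 'I_k,
  [/\ d = d', switch v d' d' & (p = nm d /\ avoids r d) \/
      (Par p d /\ avoids p d)].
Hypothesis ClassE : forall p z, Class p z <-> exists d,
  C' p d /\ (Reach d p z \/ (p = nm d /\ Reach d r z)).
Hypothesis A'E : forall p q, A' p q <-> exists d d' : 'I_k,
  [/\ C' p d, C' q d', switch v d d' & exists z, Class p z /\ Class q z].
Let r' := nm (f0 v).
Hypothesis V'_root : V' r'.
Hypothesis V'_step : forall p q, V' p -> q < N -> A' p q -> V' q.
Hypothesis V'_ind : forall (Q : nat -> Prop),
  Q r' -> (forall p q, V' p -> Q p -> q < N -> A' p q -> Q q) ->
  forall p, V' p -> Q p.
Hypothesis V'_bound : forall p, V' p -> p < N.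
Hypothesis Tau'E : forall p, Tau' p <->
  [/\ V' p, C' p (fr v) & exists z, Tau z /\ Class p z].
Hypothesis tree' : forall (B : pred nat) z, V' z -> B z -> ~~ B r' -> exists y q,
    [/\ V' y, V' q, B y, ~~ B q & A' q y /\ forall c, C' q c -> Par' y c].
Hypothesis par' : forall y c c', V' y -> Par' y c -> Par' y c' -> c = c'.

Definition cls' (p : nat) (f : coloring) : Prop :=
  [/\ valid P' f, C' p (f v) & exists z, Class p z /\ cls z f].

Definition avoids_col (d : nat) (f : coloring) : Prop :=
  forall u, cur = Some u -> G u v -> d <> f u.

Definition recolor (f : coloring) (d : 'I_k) : coloring :=
  [ffun x => if x == v then d else f x].

Lemma avoids_colE z f d : V z -> cls z f -> avoids z d <-> avoids_col d f.
Proof.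
move=> Vz zf; split=> [[_ h] u cu uv|h].
  by move=> E; apply: (h u cu uv); apply/(cg_col CG d Vz zf cu).
split=> // u cu uv /(cg_col CG d Vz zf cu); exact: h.
Qed.

Lemma recolor_at f d : recolor f d v = d.
Proof. by rewrite ffunE eqxx. Qed.

Lemma recolor_in f d : {in P, recolor f d =1 f}.
Proof. by move=> x xP; rewrite ffunE; case: eqP => // E; rewrite E (negPf vP) in xP. Qed.

Lemma recolor_id f : recolor f (f v) = f.
Proof. by apply/ffunP => x; rewrite ffunE; case: eqP => [->|]. Qed.

Lemma valid_sub f : valid P' f -> valid P f.
Proof.
case/validP=> h1 h2; apply/validP; split=> [x xP|x y xP yP].
  by apply: h1; rewrite !inE xP orbT.
by apply: h2; rewrite !inE ?xP ?yP orbT.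
Qed.

(** By [nbr_v] only the current vertex can be a processed neighbor of [v]. *)
Lemma valid_extend f :
  valid P' f <-> [/\ valid P f, switch v (f v) (f v) & avoids_col (f v) f].
Proof.
split=> [vf|[vf sw av]].
  split; first exact: valid_sub.
    by have /validP[h _] := vf; apply: h; rewrite !inE eqxx.
  move=> u cu uv E; have /validP[_ h] := vf.
  have uP := cg_cur CG cu.
  have := h u v; rewrite !inE uP eqxx orbT => /(_ isT isT uv).
  by rewrite (val_inj E) eqxx.
have nb x : x \in P -> G x v -> f x != f v.
  move=> xP xv; apply/eqP => E; apply: (av x (nbr_v xP xv) xv).
  by rewrite E.
have /validP[h1 h2] := vf; apply/validP; split=> [x|x y].
  by rewrite !inE => /orP[/eqP->|/h1].
rewrite !inE => /orP[/eqP->|xP] /orP[/eqP->|yP] xy.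
- by rewrite adj_irr in xy.
- by rewrite eq_sym nb // adj_sym.
- exact: nb.
- exact: h2.
Qed.

Lemma rstep_sub f g : rstep P' f g -> rstep P f g.
Proof.
case/rstepP=> vf vg sw [x h]; apply/rstepP; split; try exact: valid_sub.
  by move=> y yP; apply: sw; rewrite !inE yP orbT.
by exists x => y yP; apply: h; rewrite !inE yP orbT.
Qed.

Lemma valid_recolor f (d : 'I_k) :
  valid P f -> switch v d d -> avoids_col d f -> valid P' (recolor f d).
Proof.
move=> vf sw av; apply/valid_extend; rewrite recolor_at; split=> //.
  by apply: valid_ext vf => x xP; rewrite recolor_in.
by move=> u cu uv; rewrite recolor_in ?(cg_cur CG cu) //; apply: av.
Qed.

Lemma cls_recolor z f d : V z -> cls z f -> cls z (recolor f d).
Proof.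
move=> Vz zf; apply: (cg_closed CG) (Vz) (zf) _.
have vf : valid P f.
  by apply: connect_valid (cg_reach CG Vz zf); apply: valid_sub.
rewrite /estep (rstep_ext v) //=; last by move=> x xP; rewrite recolor_in.
rewrite /same_at; case E: cur => [u|] //.
by rewrite recolor_in // (cg_cur CG E).
Qed.

Lemma cls_valid z f : V z -> cls z f -> valid P f.
Proof.
move=> Vz zf; apply: connect_valid (cg_reach CG Vz zf); exact: valid_sub.
Qed.

Lemma rstep_recolor f g (d : 'I_k) : rstep P f g -> switch v d d ->
  avoids_col d f -> avoids_col d g ->
  estep P' (Some v) (recolor f d) (recolor g d).
Proof.
case/rstepP=> vf vg sw [x h] swd af ag.
rewrite /estep /= !recolor_at eqxx andbT; apply/rstepP.
split; try exact: valid_recolor.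
  move=> y; rewrite !inE => /orP[/eqP->|yP]; first by rewrite !recolor_at.
  by rewrite !recolor_in // sw.
exists x => y; rewrite !inE => /orP[/eqP->|yP] yx; first by rewrite !recolor_at.
by rewrite !recolor_in // h.
Qed.

Lemma estep_connect_sym Q c : connect_sym (estep Q c).
Proof.
apply: sym_connect_sym => f g; rewrite /estep rstep_sym; congr (_ && _).
by case: c => //= u; rewrite eq_sym.
Qed.

(** Inside an old class the current vertex keeps its color, so [v] can hold color [d] all the
    way. *)
Lemma connect_recolor z f g (d : 'I_k) : V z -> cls z f -> cls z g ->
  avoids z d -> switch v d d ->
  connect (estep P' (Some v)) (recolor f d) (recolor g d).
Proof.
move=> Vz zf zg az sw.
suff h h' : connect (estep P cur) f h' -> cls z h' /\
    connect (estep P' (Some v)) (recolor f d) (recolor h' d).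
  by case: (h g (cg_conn CG Vz zf zg)).
apply: (@connect_inv _ _ (fun g => cls z g /\
    connect (estep P' (Some v)) (recolor f d) (recolor g d))) => //.
move=> x y [zx cx] xy; have zy := cg_closed CG Vz zx xy.
split=> //; apply: connect_trans cx (connect1 _).
have /andP[st _] := xy.
by apply: rstep_recolor => //; apply/(avoids_colE d Vz).
Qed.

Lemma Reach_avoids d p q : d < k -> Reach d p q -> avoids p d /\ avoids q d.
Proof.
move=> dk; apply: (@Reach_ind d p (fun q => avoids p d /\ avoids q d)) => //.
by move=> x y [ap _] _ ay _.
Qed.

Lemma Reach_trans d p q s : d < k -> Reach d p q -> Reach d q s -> Reach d p s.
Proof.
move=> dk pq; apply: (@Reach_ind d q (fun s => Reach d p s)) => //.
by move=> x y px ax ay xy; apply: Reach_step xy.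
Qed.

Lemma A_sym p q : V p -> V q -> A p q -> A q p.
Proof.
move=> Vp Vq /(cg_adj CG Vp Vq)[f [g [pf qg fg]]].
by apply/(cg_adj CG Vq Vp); exists g, f; split=> //; rewrite rstep_sym.
Qed.

Lemma Reach_sym d p q : d < k -> Reach d p q -> Reach d q p.
Proof.
move=> dk; apply: (@Reach_ind d p (fun q => Reach d q p)) => //.
  exact: Reach_refl.
move=> x y xp ax ay xy; apply: Reach_trans xp => //.
apply: (Reach_step (q := y)) => //; first exact: Reach_refl.
by apply: A_sym => //; [case: ax | case: ay].
Qed.

(** A step between two classes may recolor the current vertex, but when both avoid [d] it is
    compatible with color [d] at [v] before and after. *)
Lemma connect_Reach p q f g (d : 'I_k) : Reach d p q -> cls p f -> cls q g ->
  switch v d d -> connect (estep P' (Some v)) (recolor f d) (recolor g d).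
Proof.
move=> pq pf qg sw; move: q pq g qg.
apply: (@Reach_ind d p (fun q => forall g, cls q g ->
  connect (estep P' (Some v)) (recolor f d) (recolor g d))) => //.
  by move=> ap g pg; have [Vp _] := ap; apply: connect_recolor pf pg ap sw.
move=> x y IH ax ay xy g yg; have [Vx _] := ax; have [Vy _] := ay.
have /(cg_adj CG Vx Vy)[f1 [g1 [xf1 yg1 st]]] := xy.
apply: connect_trans (IH f1 xf1) _.
apply: (@connect_trans _ _ (recolor g1 d)).
  by apply: connect1; apply: rstep_recolor => //;
     [apply/(avoids_colE d Vx xf1) | apply/(avoids_colE d Vy yg1)].
exact: connect_recolor yg1 yg ay sw.
Qed.

Lemma C'_lt p d : C' p d -> d < k.
Proof. by case/C'E=> d' [-> _ _]. Qed.

(** A fresh name determines its color by [nm_inj], an old one has the color of its parent, and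
    [nm_fresh] excludes names of both kinds. *)
Lemma C'_fun p d e : C' p d -> C' p e -> d = e.
Proof.
move=> pd pe; have dk := C'_lt pd; have ek := C'_lt pe.
have /C'E[d' [_ _ hd]] := pd; have /C'E[e' [_ _ he]] := pe.
case: hd he => [[pE _]|[Pd ad]] [[pE' _]|[Pe ae]].
- by apply: nm_inj => //; rewrite -pE -pE'.
- by case: ae => Vp _; case: (nm_fresh dk); rewrite -pE.
- by case: ad => Vp _; case: (nm_fresh ek); rewrite -pE'.
- by apply: (@cg_par _ _ _ _ _ _ _ _ _ CG p); case: ad.
Qed.

(** A common description of both kinds of names: the component of a class [s], which is the root for
    a fresh name and [p] itself for an old one. *)
Lemma C'_source p (d : 'I_k) : C' p d -> switch v d d /\
  exists s, avoids s d /\ forall z, Class p z <-> Reach d s z.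
Proof.
move=> pd; have /C'E[d' [/val_inj<- sw hd]] := pd; split=> //.
have dk := ltn_ord d.
case: hd => [[pE ar]|[Ppd ap]].
  exists r; split=> // z; split=> [/ClassE[e [pe]]|rz].
    rewrite -(C'_fun pd pe) => -[pz|[]] //.
    have [[Vp _] _] := Reach_avoids dk pz.
    by case: (nm_fresh dk); rewrite -pE.
  by apply/ClassE; exists d; split=> //; right.
exists p; split=> // z; split=> [/ClassE[e [pe]]|pz].
  rewrite -(C'_fun pd pe) => -[//|[pE _]].
  by case: ap => Vp _; case: (nm_fresh dk); rewrite -pE.
by apply/ClassE; exists d; split=> //; left.
Qed.

Lemma Class_V p z : Class p z -> V z.
Proof.
move=> pz; have /ClassE[e [pe h]] := pz.
by case: h => [h|[_ h]]; have [_ []] := Reach_avoids (C'_lt pe) h.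
Qed.

Lemma Class_step p (d : 'I_k) z z' f g : C' p d -> Class p z ->
  cls z f -> rstep P f g -> avoids_col d f -> avoids_col d g -> V z' ->
  cls z' g -> Class p z'.
Proof.
move=> pd pz zf fg af ag Vz' z'g; have Vz := Class_V pz.
have [_ [s [as_ sE]]] := C'_source pd; apply/sE.
apply: (Reach_step (q := z)); rewrite ?ltn_ord //; first exact/sE.
  exact/(avoids_colE d Vz' z'g).
by apply/(cg_adj CG Vz Vz'); exists f, g.
Qed.

Lemma cls'_conn p f g : cls' p f -> cls' p g -> connect (estep P' (Some v)) f g.
Proof.
move=> [vf Cf [z [pz zf]]] [vg Cg [z' [pz' z'g]]].
have E := val_inj (C'_fun Cf Cg).
have [sw [s [[Vs _] sE]]] := C'_source Cf.
have [h sh] := cg_inh CG Vs.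
have hf := connect_Reach (proj1 (sE z) pz) sh zf sw.
have hg := connect_Reach (proj1 (sE z') pz') sh z'g sw.
rewrite recolor_id in hf; rewrite E recolor_id -E in hg.
by apply: connect_trans hg; rewrite estep_connect_sym.
Qed.

Lemma cls'_intro p (d : 'I_k) z f :
  C' p d -> Class p z -> cls z f -> cls' p (recolor f d).
Proof.
move=> pd pz zf; have Vz := Class_V pz.
have [sw [s [_ sE]]] := C'_source pd.
have [_ az] := Reach_avoids (ltn_ord d) (proj1 (sE z) pz).
split; rewrite ?recolor_at //.
  apply: valid_recolor => //; first exact: cls_valid zf.
  exact/(avoids_colE d Vz zf).
by exists z; split=> //; apply: cls_recolor.
Qed.

(** A step cannot recolor both [v] and the current vertex, so the old color of [v] is still allowed
    after it. *)
Lemma avoids_next f g : rstep P' f g -> avoids_col (f v) g.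
Proof.
move=> fg; have /rstepP[vf vg _ [x h]] := fg.
have /valid_extend[_ _ af] := vf; have /valid_extend[_ _ ag] := vg.
have [E|ne] := eqVneq (f v) (g v); first by rewrite E.
have vx : v = x.
  by apply/eqP; apply: contraNT ne => vx; rewrite h // !inE eqxx.
move=> u cu uv; have uP := cg_cur CG cu.
rewrite -h; first exact: af.
  by rewrite !inE uP orbT.
by rewrite -vx; apply: contraTneq uP => ->.
Qed.

(** An old class that extends to both new ones yields a step which recolors only [v]. Conversely,
    for a step from [f] to [g] the old class of [g] is shared, since [g] also avoids the color that
    [f] gives to [v]. *)
Lemma A'P p q : A' p q <-> exists f g, [/\ cls' p f, cls' q g & rstep P' f g].
Proof.
split=> [/A'E[d [d' [pd qd' sw [z [pz qz]]]]]|[f [g [pf qg fg]]]].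
  have Vz := Class_V pz; have [f zf] := cg_inh CG Vz.
  exists (recolor f d), (recolor f d'); split.
  - exact: cls'_intro zf.
  - exact: cls'_intro zf.
  - have [vf _ _] := cls'_intro pd pz zf; have [vg _ _] := cls'_intro qd' qz zf.
    apply/rstepP; split=> //.
      move=> x; rewrite !inE => /orP[/eqP->|xP]; first by rewrite !recolor_at.
      have /validP[h _] := cls_valid Vz zf.
      by rewrite !recolor_in // h.
    exists v => x; rewrite !inE => /orP[/eqP->|xP _]; first by rewrite eqxx.
    by rewrite !recolor_in.
have [vf Cf [z [pz zf]]] := pf; have [vg Cg [z' [qz' z'g]]] := qg.
apply/A'E; exists (f v), (g v); split=> //.
  by have /rstepP[_ _ sw _] := fg; apply: sw; rewrite !inE eqxx.
exists z'; split=> //.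
apply: (Class_step Cf pz zf (rstep_sub fg)) => //; last exact: Class_V qz'.
  by have /valid_extend[] := vf.
exact: avoids_next.
Qed.

(** This is where the names suffice. The component of the old class of [g], for the color [d] of
    [v], contains the root and is named [nm d], or by [cg_tree] a tree edge enters it from some [q]
    outside to some [y] inside. As [q] is adjacent to the component but not in it, it has color [d];
    hence [y] has a parent of color [d] and is a name. *)
Lemma cls'_cover g : valid P' g -> connect (rstep P) f0 g ->
  exists2 p, p < N & cls' p g.
Proof.
move=> vg cg; have [z Vz zg] := cg_cover CG cg.
pose d := g v; have dk := ltn_ord d.
have /valid_extend[_ sw ag] := vg.
have az : avoids z d by apply/(avoids_colE _ Vz zg).
have zz := Reach_refl dk az.
have fin p : p < N -> C' p d -> Class p z -> exists2 p, p < N & cls' p g.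
  by move=> pN pd pz; exists p => //; split=> //; exists z.
have [zr|nr] := boolP (Reach d z r).
  have [_ ar] := Reach_avoids dk zr.
  have pd : C' (nm d) d by apply/C'E; exists d; split=> //; left.
  apply: (fin (nm d)) => //; first exact: nm_bound.
  by apply/ClassE; exists d; split=> //; right; split=> //; apply: Reach_sym.
have [y [q [Vy Vq zy nq [qy Pq]]]] := cg_tree CG Vz zz nr.
have [_ ay] := Reach_avoids dk zy.
have Cq : C q d.
  have [fq qf] := cg_inh CG Vq.
  have naq : ~ avoids q d.
    move=> aq; case/negP: nq; apply: (Reach_step dk zy aq).
    exact: A_sym.
  (* Without an edge from the current vertex to [v] no class is deleted, and [q] would be in the
     component. *)
  case Ec : cur => [u|]; last by case: naq; split=> // u; rewrite Ec.
  case: (boolP (G u v)) => [uv|nuv]; last first.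
    by case: naq; split=> // u'; rewrite Ec => -[<-]; rewrite (negPf nuv).
  apply/(cg_col CG d Vq qf Ec).
  have [//|ne] := eqVneq (d : nat) (fq u).
  case: naq; apply/(avoids_colE d Vq qf) => u'; rewrite Ec => -[<-] _.
  exact/eqP.
have pd : C' y d by apply/C'E; exists d; split=> //; right; split=> //; apply: Pq.
apply: (fin y) => //; first exact: (cg_bound CG).
by apply/ClassE; exists d; split=> //; left; apply: Reach_sym.
Qed.

Lemma cls'_root : cls' r' f0.
Proof.
have [Vr rf0] := cg_root CG.
have /valid_extend[_ sw af] := valid_f0.
have ar : avoids r (f0 v) by apply/(avoids_colE _ Vr rf0).
have pd : C' r' (f0 v) by apply/C'E; exists (f0 v); split=> //; left.
split=> //; exists r; split=> //; apply/ClassE; exists (f0 v); split=> //.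
by right; split=> //; apply: Reach_refl.
Qed.

Lemma connect_estep Q c f g : connect (estep Q c) f g -> connect (rstep Q) f g.
Proof. by apply: connect_sub => x y /andP[xy _]; apply: connect1. Qed.

Lemma class_graph_extend :
  class_graph P' (Some v) cls' V' A' C' r' Tau' Par'.
Proof.
have C'V p : V' p -> exists d, C' p d.
  apply: (@V'_ind (fun p => exists d, C' p d)); last first.
    by move=> x y _ _ _ /A'E[d [d' [_ yd' _ _]]]; exists d'.
  by exists (f0 v); have [] := cls'_root.
split=> //.
- by move=> u [<-]; rewrite !inE eqxx.
- move=> p /C'V[d pd]; have dk := C'_lt pd.
  have [sw [s [[Vs as_] sE]]] := @C'_source p (Ordinal dk) pd.
  have [f sf] := cg_inh CG Vs; exists (recolor f (Ordinal dk)).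
  by apply: (@cls'_intro p (Ordinal dk) s f pd _ sf); apply/sE; apply: Reach_refl.
- suff h p : V' p -> forall f, cls' p f -> connect (rstep P') f0 f.
    by move=> p f /h; apply.
  apply: (@V'_ind (fun p => forall f, cls' p f -> connect (rstep P') f0 f)).
    by move=> f rf; apply: connect_estep (cls'_conn cls'_root rf).
  move=> x y _ IH _ /A'P[f [g [xf yg fg]]] h yh.
  apply: connect_trans (IH f xf) _; apply: connect_trans (connect1 fg) _.
  exact: connect_estep (cls'_conn yg yh).
- move=> p f u c _ [_ pf _] [<-]; split=> [pc|-> //].
  exact: C'_fun pc pf.
- move=> p f g _ [vf pf [z [pz zf]]] /andP[fg /eqP fgv].
  have /rstepP[_ vg _ _] := fg.
  split=> //; first by rewrite -fgv.
  have Vz := Class_V pz.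
  have cg : connect (rstep P) f0 g.
    exact: connect_trans (cg_reach CG Vz zf) (connect1 (rstep_sub fg)).
  have [z' Vz' z'g] := cg_cover CG cg; exists z'; split=> //.
  apply: (Class_step pf pz zf (rstep_sub fg)) => //.
    by have /valid_extend[] := vf.
  exact: avoids_next.
- by move=> p f g _; apply: cls'_conn.
- apply: (@connect_inv _ _ (fun f => exists2 p, V' p & cls' p f)).
    by exists r' => //; apply: cls'_root.
  move=> f g [p Vp pf] fg; have /rstepP[_ vg _ _] := fg.
  have [_ _ [z [pz zf]]] := pf; have Vz := Class_V pz.
  have cg : connect (rstep P) f0 g.
    exact: connect_trans (cg_reach CG Vz zf) (connect1 (rstep_sub fg)).
  have [q qN qg] := cls'_cover vg cg; exists q => //.
  by apply: (V'_step Vp qN); apply/A'P; exists f, g.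
- by move=> p q _ _; apply: A'P.
- by split=> //; apply: cls'_root.
- move=> p; split=> [/Tau'E[Vp pd [z [/(cg_target CG)[Vz zfr] pz]]]|].
    by split=> //; split=> //; exists z.
  case=> Vp [_ pd [z [pz zf]]]; apply/Tau'E; split=> //; exists z; split=> //.
  by apply/(cg_target CG); split=> //; apply: Class_V pz.
Qed.

End Extend.

End Classes.

(** * Semantics of first-order programs *)

Section Semantics.
Variable w : seq bool.
Local Notation N := (size w).

Fixpoint holds (s : store) (e : seq nat) (f : fm) : Prop :=
  match f with
  | Atom r x y z => s r (nth 0 e x) (nth 0 e y) (nth 0 e z)
  | Inp x => nth false w (nth 0 e x)
  | Lt x y => nth 0 e x < nth 0 e y
  | Not f => ~ holds s e f
  | And f g => holds s e f /\ holds s e g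
  | Or f g => holds s e f \/ holds s e g
  | Ex f => exists v, v < N /\ holds s (rcons e v) f
  end.

Lemma holdsP s e f : reflect (holds s e f) (eval w s e f).
Proof.
elim: f e => [r x y z|x|x y|f IH|f IHf g IHg|f IHf g IHg|f IH] e /=.
- exact: idP.
- exact: idP.
- exact: idP.
- by apply: (iffP negP) => h /IH.
- by apply: (iffP andP) => -[/IHf ? /IHg ?].
- by apply: (iffP orP) => -[/IHf|/IHg] ?; by [left | right].
- apply: (iffP hasP) => [[v]|[v [vN /IH h]]].
    by rewrite mem_iota => vN /IH h; exists v.
  by exists v; rewrite ?mem_iota.
Qed.

Lemma eval_ext s s' e f :
  (forall r, mentions r f -> s r = s' r) -> eval w s e f = eval w s' e f.
Proof.
elim: f e => [r x y z|x|x y|f IH|f IHf g IHg|f IHf g IHg|f IH] e //= h.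
- by rewrite h.
- by rewrite IH.
- by rewrite IHf ?IHg // => r rg; apply: h; rewrite rg ?orbT.
- by rewrite IHf ?IHg // => r rg; apply: h; rewrite rg ?orbT.
- by apply: eq_has => v; apply: IH.
Qed.

Fixpoint writes (r : nat) (p : prog) : bool :=
  match p with
  | Skip => false
  | Set_ r' _ => r == r'
  | Seq p q => writes r p || writes r q
  | Rep p | When _ p => writes r p
  end.

Lemma exec_frame r p s : ~~ writes r p -> exec w p s r = s r.
Proof.
elim: p s => [|r' f|p IHp q IHq|p IH|f p IH] s //= h.
- by rewrite /upd (negPf h).
- by move: h; rewrite negb_or => /andP[hp hq]; rewrite IHq // IHp.
- by elim: (N) => //= t <-; apply: IH.
- by case: ifP => // _; apply: IH.
Qed.

Lemma exec_Seq p q s : exec w (Seq p q) s = exec w q (exec w p s).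
Proof. by []. Qed.

Lemma exec_Rep p s : exec w (Rep p) s = iter N (exec w p) s.
Proof. by []. Qed.

Definition sets (l : seq (nat * fm)) : prog :=
  foldr (fun a p => Seq (Set_ a.1 a.2) p) Skip l.

(** No formula mentions a relation that is assigned by its own or a later entry, so at the end all
    definitions hold simultaneously in the final store. *)
Fixpoint single_assignment (l : seq (nat * fm)) : bool :=
  if l is a :: l' then
    [&& ~~ mentions a.1 a.2, all (fun b => (b.1 != a.1) && ~~ mentions b.1 a.2) l'
      & single_assignment l']
  else true.

Fixpoint satisfies (s : store) (l : seq (nat * fm)) : Prop :=
  if l is a :: l' then
    (forall x y z, s a.1 x y z <-> holds s [:: x; y; z] a.2) /\ satisfies s l'
  else True.

Lemma writes_sets r l : writes r (sets l) = has (fun a => r == a.1) l.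
Proof. by elim: l => //= a l ->. Qed.

Lemma exec_sets l s : single_assignment l -> satisfies (exec w (sets l) s) l.
Proof.
elim: l s => [|[r f] l IH] s //= /and3P[nm fresh sa].
split; last exact: IH.
set s' := exec _ _ _.
have nw : ~~ writes r (sets l).
  rewrite writes_sets -all_predC; apply: sub_all fresh => a /andP[ne _] /=.
  by rewrite eq_sym.
move=> x y z; rewrite [s' r]exec_frame //= /upd eqxx.
rewrite (@eval_ext _ s'); first by split=> /holdsP.
move=> r' mr'; rewrite [s' r']exec_frame /upd.
  by case: eqP => // E; rewrite -E mr' in nm.
rewrite writes_sets -all_predC; apply: sub_all fresh => a /andP[_ ne] /=.
by apply: contraNneq ne => <-.
Qed.

Lemma exec_setP r f s x y z :
  exec w (sets [:: (r, f)]) s r x y z <-> holds s [:: x; y; z] f.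
Proof. by rewrite /= /upd eqxx; split=> /holdsP. Qed.

(** The sets [X t] increase within [0, N), and each round before closure adds an element. *)
Lemma closed_iter (X : nat -> nat -> bool) (E : nat -> nat -> Prop) :
  (forall t q, q < N -> X t.+1 q <-> X t q \/ exists r, [/\ r < N, X t r & E r q]) ->
  forall r q, r < N -> q < N -> X N r -> E r q -> X N q.
Proof.
move=> step.
pose closed t := forall r q, r < N -> q < N -> X t r -> E r q -> X t q.
pose c t := count (X t) (iota 0 N).
have mono t q : q < N -> X t q -> X t.+1 q by move=> qN Xq; apply/step; auto.
have le t : c t <= c t.+1.
  rewrite /c -!size_filter; apply: uniq_leq_size.
    by rewrite filter_uniq // iota_uniq.
  by move=> q; rewrite !mem_filter mem_iota => /andP[/mono h /andP[_ qN]]; rewrite h.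
have stable t : c t.+1 <= c t -> forall q, q < N -> X t.+1 q -> X t q.
  move=> ct q qN Xq.
  have sub : {subset filter (X t) (iota 0 N) <= filter (X t.+1) (iota 0 N)}.
    by move=> q'; rewrite !mem_filter mem_iota => /andP[/mono h /andP[_ q'N]]; rewrite h.
  have un : uniq (filter (X t) (iota 0 N)) by rewrite filter_uniq // iota_uniq.
  have [|_ E'] := uniq_min_size un sub; first by rewrite !size_filter.
  by have := E' q; rewrite !mem_filter mem_iota Xq qN /= andbT => ->.
have grow t : closed t \/ t <= c t.
  elim: t => [|t [IH|IH]]; first by right.
    left=> r q rN qN /(step t r rN) Xr rq; apply/(step t q qN); left.
    case: Xr => [Xr|[r' [r'N Xr' r'r]]]; first exact: IH rq.
    by apply: (IH r) => //; apply: (IH r').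
  have [ct|ct] := leqP (c t.+1) (c t); last by right; apply: leq_ltn_trans ct.
  left=> r q rN qN Xr rq; apply: mono => //; apply: (stable t) => //.
  by apply/step => //; right; exists r; split=> //; apply: (stable t).
(* If the set is not known to be closed at round [N], it has at least [N] elements and is all of [0,
   N). *)
case: (grow N) => // Nc r q rN qN _ _.
have : all (X N) (iota 0 N).
  have := count_size (X N) (iota 0 N); rewrite all_count size_iota => h.
  by rewrite eqn_leq h.
by move/allP; apply; rewrite mem_iota.
Qed.

End Semantics.

(* Formulas with binders: a [fo_form] is a formula as a function of the number of
   variables in scope, which is the level of the next bound variable. *)
Definition fo_form := nat -> fm.
Definition Ex_ (b : nat -> fo_form) : fo_form := fun d => Ex (b d d.+1).
Definition Atom3 (r x y z : nat) : fo_form := fun _ => Atom r x y z.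
(** All stored relations are ternary; one of smaller arity is read with its last argument repeated,
    whence [s r x y y] in the specifications. *)
Definition Atom2 (r x y : nat) : fo_form := fun _ => Atom r x y y.
Definition Atom1 (r x : nat) : fo_form := fun _ => Atom r x x x.
Definition Inp_ (x : nat) : fo_form := fun _ => Inp x.
Definition Lt_ (x y : nat) : fo_form := fun _ => Lt x y.
Definition Not_ (a : fo_form) : fo_form := fun d => Not (a d).
Definition And_ (a b : fo_form) : fo_form := fun d => And (a d) (b d).
Definition Or_ (a b : fo_form) : fo_form := fun d => Or (a d) (b d).
Definition def1 (r : nat) (b : nat -> fo_form) : nat * fm := (r, b 0 3).
Definition def2 (r : nat) (b : nat -> nat -> fo_form) : nat * fm := (r, b 0 1 3).
Definition def3 (r : nat) (b : nat -> nat -> nat -> fo_form) : nat * fm :=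
  (r, b 0 1 2 3).

Declare Scope fof_scope.
Delimit Scope fof_scope with fof.
Notation "'EX' x .. y , b" := (Ex_ (fun x => .. (Ex_ (fun y => b%fof)) ..))
  (at level 200, x binder, y binder, right associativity) : fof_scope.
Notation "a && b" := (And_ a b) : fof_scope.
Notation "a || b" := (Or_ a b) : fof_scope.
Notation "~~ a" := (Not_ a) : fof_scope.
Notation "x < y" := (Lt_ x y) : fof_scope.
Notation "r .[ x ]" := (Atom1 r x) : fof_scope.
Notation "r .[ x , y ]" := (Atom2 r x y)
  (at level 1, left associativity, format "r .[ x , y ]") : fof_scope.
Notation "r .[ x , y , z ]" := (Atom3 r x y z)
  (at level 1, left associativity, format "r .[ x , y , z ]") : fof_scope.

(** * Arithmetic on [0, N) *)

Notation rEq := 1 (only parsing).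
Notation rZero := 2 (only parsing).
Notation rSuc := 3 (only parsing).
Notation rAdd := 4 (only parsing).
Notation rMul := 5 (only parsing).

Definition order_defs : seq (nat * fm) :=
  [:: def2 rEq (fun x y => ~~ (x < y) && ~~ (y < x));
      def1 rZero (fun x => ~~ (EX t, t < x));
      def2 rSuc (fun x y => (x < y) && ~~ (EX t, (x < t) && (t < y)));
      def3 rAdd (fun x y z => rZero.[y] && rEq.[x, z])]%fof.

Definition add_step : prog :=
  sets [:: def3 rAdd (fun x y z => rAdd.[x, y, z] ||
    (EX y' z', rSuc.[y', y] && rSuc.[z', z] && rAdd.[x, y', z']))]%fof.

Definition mul_init : prog :=
  sets [:: def3 rMul (fun x y z => rZero.[y] && rZero.[z])]%fof.

Definition mul_step : prog :=
  sets [:: def3 rMul (fun x y z => rMul.[x, y, z] ||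
    (EX y' z', rSuc.[y', y] && rMul.[x, y', z'] && rAdd.[z', x, z]))]%fof.

Definition arithmetic : prog :=
  Seq (sets order_defs) (Seq (Rep add_step) (Seq mul_init (Rep mul_step))).

Section Arithmetic.
Variable w : seq bool.
Local Notation N := (size w).

Definition arith_ok (s : store) : Prop :=
  (forall x y, s rEq x y y <-> x = y) /\
  (forall x, x < N -> s rZero x x x <-> x = 0) /\
  (forall x y, x < N -> y < N -> s rSuc x y y <-> y = x.+1) /\
  (forall x y z, x < N -> y < N -> z < N -> s rAdd x y z <-> x + y = z) /\
  (forall x y z, x < N -> y < N -> z < N -> s rMul x y z <-> x * y = z).

(** After [t] rounds the relation holds exactly the sums, or products, whose second argument is at
    most [t]. *)
Lemma arithmeticP s : arith_ok (exec w arithmetic s).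
Proof.
have -> : exec w arithmetic s = iter N (exec w mul_step) (exec w mul_init
  (iter N (exec w add_step) (exec w (sets order_defs) s))) by [].
set s1 := exec w (sets order_defs) s.
have [] := exec_sets w s (isT : single_assignment order_defs).
rewrite -/s1 /= => eqE [zeroE [sucE [addE _]]].
have {}eqE x y z : s1 rEq x y z <-> x = y.
  by rewrite eqE; split=> [[]|->]; lia.
have {}zeroE x y z : x < N -> s1 rZero x y z <-> x = 0.
  move=> xN; rewrite zeroE; split=> [h|-> [t []] //].
  by case: x xN h => // x xN h; case: h; exists 0; split=> //; apply: leq_ltn_trans xN.
have {}sucE x y z : x < N -> y < N -> s1 rSuc x y z <-> y = x.+1.
  move=> xN yN; rewrite sucE; split=> [[xy h]|->]; last by split=> // -[t]; lia.
  case: (ltngtP y x.+1) => //; first by lia.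
  by move=> lt; case: h; exists x.+1; split; lia.
have {}addE x y z : y < N -> s1 rAdd x y z <-> y = 0 /\ x = z.
  by move=> yN; rewrite addE zeroE // eqE.
set s2 := iter N (exec w add_step) s1.
have add_t t : (forall r, r != rAdd -> iter t (exec w add_step) s1 r = s1 r) /\
  forall x y z, x < N -> y < N -> z < N ->
    iter t (exec w add_step) s1 rAdd x y z <-> x + y = z /\ y <= t.
  elim: t => [|t [fr IH]]; rewrite ?iterS.
    by split=> // x y z xN yN zN; rewrite addE //; lia.
  set s' := iter _ _ _ in fr IH *; split=> [r ne|x y z xN yN zN].
    by rewrite exec_frame ?fr //= orbF.
  apply: iff_trans (exec_setP _ _ _ _ _ _ _) _; split=> /= [|[xyz yt]].
    case=> [/IH|[y' [y'N [z' [z'N [[]]]]]]]; first by lia.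
    rewrite (fr rSuc) // !sucE // => -> -> /(IH _ _ _ xN y'N z'N).
    by lia.
  case: (leqP y t) => [yt'|ty]; first by left; apply/IH.
  have y0 : 0 < y by lia.
  right; exists y.-1; split; first by lia.
  exists z.-1; split; first by lia.
  rewrite (fr rSuc) // !sucE; try lia.
  by split; [lia | apply/IH; lia].
have [fr2 add2] := add_t N; rewrite -/s2 in fr2 add2.
have {}add2 x y z : x < N -> y < N -> z < N -> s2 rAdd x y z <-> x + y = z.
  by move=> xN yN zN; rewrite add2 //; lia.
set s3 := exec w mul_init s2.
have mul_t t : (forall r, r != rMul -> iter t (exec w mul_step) s3 r = s2 r) /\
  forall x y z, x < N -> y < N -> z < N ->
    iter t (exec w mul_step) s3 rMul x y z <-> x * y = z /\ y <= t.
  elim: t => [|t [fr IH]]; rewrite ?iterS.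
    split=> [r ne|x y z xN yN zN].
      by rewrite -[LHS]/(exec w mul_init s2 r) exec_frame //= orbF.
    apply: iff_trans (exec_setP _ _ _ _ _ _ _) _; rewrite /= (fr2 rZero) //.
    by rewrite !zeroE //; lia.
  set s' := iter _ _ _ in fr IH *; split=> [r ne|x y z xN yN zN].
    by rewrite exec_frame ?fr //= orbF.
  apply: iff_trans (exec_setP _ _ _ _ _ _ _) _; split=> /= [|[xyz yt]].
    case=> [/IH|[y' [y'N [z' [z'N [[]]]]]]]; first by lia.
    rewrite (fr rSuc) // (fr rAdd) // (fr2 rSuc) // sucE // add2 //.
    by move=> -> /(IH _ _ _ xN y'N z'N)[E le] F; nia.
  case: (leqP y t) => [yt'|ty]; first by left; apply/IH.
  have y0 : 0 < y by lia.
  right; exists y.-1; split; first by lia.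
  (* The intermediate product is bounded by the final one, so the quantifier reaches it. *)
  exists (x * y.-1); split; first by nia.
  have lt : x * y.-1 < N by nia.
  rewrite (fr rSuc) // (fr rAdd) // (fr2 rSuc) // sucE ?add2 //; try lia.
  by split; [split; [lia | apply/IH; lia] | nia].
have [fr3 mul3] := mul_t N.
split; first by move=> x y; rewrite fr3 // fr2.
split; first by move=> x xN; rewrite fr3 // fr2 // zeroE.
split; first by move=> x y xN yN; rewrite fr3 // fr2 // sucE.
split; first by move=> x y z xN yN zN; rewrite fr3 // add2.
by move=> x y z xN yN zN; rewrite mul3 //; nia.
Qed.

End Arithmetic.

(** * Decoding the instance *)

(* rN, rM and rK hold n, n + k + 1 (the second 0 of the input) and k; rB1 to
   rB4 hold the addresses of the four matrices, and the name of (v, c) is the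
   address of the bit for c in the list of v. *)
Notation rN := 6 (only parsing).
Notation rM := 7 (only parsing).
Notation rK := 8 (only parsing).
Notation rB1 := 9 (only parsing).
Notation rB2 := 10 (only parsing).
Notation rB3 := 11 (only parsing).
Notation rB4 := 12 (only parsing).
Notation rG := 13 (only parsing).
Notation rName := 14 (only parsing).
Notation rL := 15 (only parsing).
Notation rF0 := 16 (only parsing).
Notation rFr := 17 (only parsing).
Notation rSp := 18 (only parsing).
Notation rSw := 19 (only parsing).

Definition entry (b p v c : nat) : fo_form :=
  (EX a e x q t, rN.[a] && (v < a) && rK.[e] && (c < e) && b.[x] &&
     rMul.[v, e, q] && rAdd.[q, c, t] && rAdd.[x, t, p])%fof.

(** The products [n * n] and [n * k] are sizes of matrices inside the input, so arithmetic below N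
    is enough for all addresses. [rSp] and [rSw] transcribe [spine] and [switch]. *)
Definition decode_defs : seq (nat * fm) :=
  [:: def1 rN (fun x => ~~ Inp_ x && ~~ (EX t, (t < x) && ~~ Inp_ t));
      def1 rM (fun x => ~~ Inp_ x &&
        (EX a, rN.[a] && (a < x) && ~~ (EX t, (a < t) && (t < x) && ~~ Inp_ t)));
      def1 rK (fun x => EX a b m,
        rN.[a] && rM.[m] && rSuc.[a, b] && rAdd.[b, x, m]);
      def1 rB1 (fun x => EX m, rM.[m] && rSuc.[m, x]);
      def1 rB2 (fun x => EX a q b,
        rN.[a] && rMul.[a, a, q] && rB1.[b] && rAdd.[b, q, x]);
      def1 rB3 (fun x => EX a c q b,
        rN.[a] && rK.[c] && rMul.[a, c, q] && rB2.[b] && rAdd.[b, q, x]);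
      def1 rB4 (fun x => EX a c q b,
        rN.[a] && rK.[c] && rMul.[a, c, q] && rB3.[b] && rAdd.[b, q, x]);
      def2 rG (fun u v => EX p, Inp_ p && (EX a x q t,
        rN.[a] && (u < a) && (v < a) && rB1.[x] &&
        rMul.[u, a, q] && rAdd.[q, v, t] && rAdd.[x, t, p]));
      def3 rName (fun p v c => entry rB2 p v c);
      def2 rL (fun v c => EX p, Inp_ p && rName.[p, v, c]);
      def2 rF0 (fun v c => EX p, Inp_ p && entry rB3 p v c);
      def2 rFr (fun v c => EX p, Inp_ p && entry rB4 p v c);
      def1 rSp (fun x => EX a, rN.[a] && (x < a) && ~~ (EX y, rG.[x, y] &&
        ~~ (EX y', rG.[x, y'] && ~~ rEq.[y', y]) &&
        ((EX z, ~~ rEq.[z, x] && rG.[y, z]) || (y < x))));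
      def3 rSw (fun v a b => rL.[v, a] && rL.[v, b] &&
        ~~ (EX l, rG.[v, l] && ~~ rSp.[l] &&
             ~~ (EX c, rL.[l, c] && ~~ rEq.[c, a] && ~~ rEq.[c, b])))]%fof.

Lemma nth_allpairs_mul (S T R : Type) (f : S -> T -> R) x0 y0 z0 s t i j :
  i < size s -> j < size t ->
  nth z0 [seq f x y | x <- s, y <- t] (i * size t + j) = f (nth x0 s i) (nth y0 t j).
Proof.
elim: s i => // x s IH [|i] lti ltj; rewrite /= nth_cat size_map.
  by rewrite mul0n add0n ltj (nth_map y0).
rewrite mulSn -addnA ltnNge leq_addr /= -IH //; congr nth; lia.
Qed.

Section Decode.
Variable I : instance.
Local Notation n := (nv I).
Local Notation k := (nc I).
Local Notation w := (encode I).
Local Notation N := (size (encode I)).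
Hypotheses (n0 : 0 < n) (k0 : 0 < k).

Let m := n + k.+1.
Let b1 := m.+1.
Let b2 := b1 + n * n.
Let b3 := b2 + n * k.
Let b4 := b3 + n * k.

Lemma size_encode : N = b4 + n * k.
Proof.
rewrite /encode !size_cat !size_nseq /= !size_allpairs !size_enum_ord.
rewrite /b4 /b3 /b2 /b1 /m; lia.
Qed.

Lemma nk_gt0 : 0 < n * k.
Proof. by rewrite muln_gt0 n0. Qed.

Lemma encode_head :
  (forall i, i < n -> nth false w i) * (nth false w n = false) *
  (forall i, n < i -> i < m -> nth false w i) * (nth false w m = false).
Proof.
rewrite /encode; split; [split; [split|]|].
- by move=> i lt; rewrite nth_cat size_nseq lt nth_nseq lt.
- by rewrite nth_cat size_nseq ltnn subnn.
- move=> i lt1 lt2; rewrite nth_cat size_nseq ltnNge ltnW //=.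
  have -> : i - n = (i - n.+1).+1 by lia.
  have lt : i - n.+1 < k by rewrite /m in lt2; lia.
  by rewrite /= nth_cat size_nseq lt nth_nseq lt.
- rewrite nth_cat size_nseq /m ltnNge leq_addr /= addKn /=.
  by rewrite nth_cat size_nseq ltnn subnn.
Qed.

Lemma encode_tail i : nth false w (b1 + i) = nth false (
  [seq graph I u v | u <- enum 'I_n, v <- enum 'I_n] ++
  [seq c \in lists I v | v <- enum 'I_n, c <- enum 'I_k] ++
  [seq Defs.col0 I v == c | v <- enum 'I_n, c <- enum 'I_k] ++
  [seq colr I v == c | v <- enum 'I_n, c <- enum 'I_k]) i.
Proof.
rewrite /encode /b1 /m nth_cat size_nseq ltnNge.
have -> : n <= (n + k.+1).+1 + i by lia.
have -> : (n + k.+1).+1 + i - n = (k.+1 + i).+1 by lia.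
rewrite /= nth_cat size_nseq ltnNge.
have -> : k <= k.+1 + i by lia.
by have -> : k.+1 + i - k = i.+1 by lia.
Qed.

Lemma nth_enumE a (i : 'I_a) (x0 : 'I_a) : nth x0 (enum 'I_a) i = i.
Proof. by rewrite nth_ord_enum. Qed.

Lemma encode_graph (u v : 'I_n) : nth false w (b1 + (u * n + v)) = graph I u v.
Proof.
rewrite encode_tail nth_cat size_allpairs !size_enum_ord.
have -> : u * n + v < n * n by have := ltn_ord u; have := ltn_ord v; nia.
have := @nth_allpairs_mul _ _ _ (fun u v => graph I u v) u v false
  (enum 'I_n) (enum 'I_n) u v.
by rewrite !size_enum_ord !nth_enumE; apply.
Qed.

Lemma matrix_lt (v : 'I_n) (c : 'I_k) : v * k + c < n * k.
Proof. by have := ltn_ord v; have := ltn_ord c; nia. Qed.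

Lemma nth_matrix (F : 'I_n -> 'I_k -> bool) (v : 'I_n) (c : 'I_k) s i :
  i = v * k + c ->
  nth false ([seq F v c | v <- enum 'I_n, c <- enum 'I_k] ++ s) i = F v c.
Proof.
move=> ->; rewrite nth_cat size_allpairs !size_enum_ord matrix_lt.
have := @nth_allpairs_mul _ _ _ F v c false (enum 'I_n) (enum 'I_k) v c.
by rewrite !size_enum_ord !nth_enumE; apply.
Qed.

Lemma nth_matrix_skip (F : 'I_n -> 'I_k -> bool) s i :
  nth false ([seq F v c | v <- enum 'I_n, c <- enum 'I_k] ++ s) (n * k + i) =
  nth false s i.
Proof.
rewrite nth_cat size_allpairs !size_enum_ord ltnNge leq_addr /=.
by congr nth; rewrite addKn.
Qed.

Lemma encode_lists (v : 'I_n) (c : 'I_k) :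
  nth false w (b2 + (v * k + c)) = (c \in lists I v).
Proof.
rewrite /b2 -addnA encode_tail nth_cat size_allpairs !size_enum_ord ltnNge.
by rewrite leq_addr /= addKn (@nth_matrix (fun v c => c \in lists I v) v c).
Qed.

Lemma encode_col0 (v : 'I_n) (c : 'I_k) :
  nth false w (b3 + (v * k + c)) = (Defs.col0 I v == c).
Proof.
rewrite /b3 /b2 -!addnA encode_tail nth_cat size_allpairs !size_enum_ord ltnNge.
rewrite leq_addr /= addKn (@nth_matrix_skip (fun v c => c \in lists I v)).
by rewrite (@nth_matrix (fun v c => Defs.col0 I v == c) v c).
Qed.

Lemma encode_colr (v : 'I_n) (c : 'I_k) :
  nth false w (b4 + (v * k + c)) = (colr I v == c).
Proof.
rewrite /b4 /b3 /b2 -!addnA encode_tail nth_cat size_allpairs !size_enum_ord.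
rewrite ltnNge leq_addr /= addKn (@nth_matrix_skip (fun v c => c \in lists I v)).
rewrite (@nth_matrix_skip (fun v c => Defs.col0 I v == c)).
by rewrite -[X in nth false X _]cats0 (@nth_matrix (fun v c => colr I v == c) v c).
Qed.

Definition name (v c : nat) : nat := b2 + (v * k + c).

Definition spine_of : {set 'I_n} := spine (graph I).

Definition decoded (s : store) : Prop :=
  (forall x y, s rEq x y y <-> x = y) /\
  (forall x, x < N -> s rZero x x x <-> x = 0) /\
  (forall x y, x < N -> y < N -> s rG x y y <->
     exists u v : 'I_n, [/\ x = u, y = v & graph I u v]) /\
  (forall p x y, p < N -> x < N -> y < N -> s rName p x y <->
     exists (v : 'I_n) (c : 'I_k), [/\ x = v, y = c & p = name v c]) /\
  (forall x y, x < N -> y < N -> s rF0 x y y <->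
     exists v : 'I_n, x = v /\ y = Defs.col0 I v) /\
  (forall x y, x < N -> y < N -> s rFr x y y <->
     exists v : 'I_n, x = v /\ y = colr I v) /\
  (forall x, x < N -> s rSp x x x <-> exists v : 'I_n, x = v /\ v \in spine_of) /\
  (forall x y z, x < N -> y < N -> z < N -> s rSw x y z <->
     exists (v : 'I_n) (a b : 'I_k),
       [/\ x = v, y = a, z = b & switch (graph I) (lists I) v a b]).

Lemma ord_lt_N (v : 'I_n) : v < N.
Proof. rewrite size_encode /b4 /b3 /b2 /b1 /m; have := ltn_ord v; lia. Qed.

Lemma color_lt_N (c : 'I_k) : c < N.
Proof. rewrite size_encode /b4 /b3 /b2 /b1 /m; have := ltn_ord c; lia. Qed.

Lemma name_lt_N (v : 'I_n) (c : 'I_k) : name v c < N.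
Proof. rewrite size_encode /name /b4 /b3; have := matrix_lt v c; lia. Qed.

(** This keeps 0 free as the name of the initial class. *)
Lemma name_gt0 v c : 0 < name v c.
Proof. by rewrite /name /b2 /b1. Qed.

Lemma name_inj (v v' : 'I_n) (c c' : 'I_k) :
  name v c = name v' c' -> v = v' /\ c = c'.
Proof.
move=> /addnI E; have lt := ltn_ord c; have lt' := ltn_ord c'.
have cc : c = c' :> nat.
  by have := congr1 (modn^~ k) E; rewrite !modnMDl !modn_small.
have vv : v = v' :> nat by nia.
by split; apply: val_inj.
Qed.

(** The left side is what [holds] makes of [entry]; the matrix is a parameter because lists and both
    colorings have the same layout. *)
Lemma entryP s b base p x y : arith_ok w s ->
  (forall x, x < N -> s rN x x x <-> x = n) ->
  (forall x, x < N -> s rK x x x <-> x = k) ->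
  (forall x, x < N -> s b x x x <-> x = base) ->
  base + n * k <= N -> p < N -> x < N -> y < N ->
  (exists a, a < N /\ exists e, e < N /\ exists z, z < N /\ exists q, q < N /\
   exists t, t < N /\ (((((((s rN a a a /\ x < a) /\ s rK e e e) /\ y < e) /\
     s b z z z) /\ s rMul x e q) /\ s rAdd q y t) /\ s rAdd z t p)) <->
  (exists (v : 'I_n) (c : 'I_k), [/\ x = v, y = c & p = base + (v * k + c)]).
Proof.
move=> [_ [_ [_ [addE mulE]]]] nE kE bE le pN xN yN; split.
  case=> a [aN [e [eN [z [zN [q [qN [t [tN]]]]]]]]].
  rewrite nE // kE // bE // addE // addE // mulE //.
  move=> [[[[[[[-> xn] ->] yk] ->] <-] <-] <-].
  by exists (Ordinal xn), (Ordinal yk).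
case=> v [c [-> -> ->]]; have lt := matrix_lt v c; have nk := nk_gt0.
have nN : n < N by rewrite size_encode /b4 /b3 /b2 /b1 /m; lia.
have kN : k < N by rewrite size_encode /b4 /b3 /b2 /b1 /m; lia.
have cN := color_lt_N c; have vN := ord_lt_N v.
exists n; split=> //; exists k; split=> //; exists base; split; first by lia.
exists (v * k); split; first by lia.
exists (v * k + c); split; first by lia.
rewrite nE // kE // bE; last by lia.
by rewrite !addE ?mulE ?ltn_ord //; lia.
Qed.

Lemma exists_edge s p x y : arith_ok w s ->
  (forall x, x < N -> s rN x x x <-> x = n) ->
  (forall x, x < N -> s rB1 x x x <-> x = b1) ->
  p < N -> x < N -> y < N ->
  (exists a, a < N /\ exists z, z < N /\ exists q, q < N /\
   exists t, t < N /\ ((((((s rN a a a /\ x < a) /\ y < a) /\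
     s rB1 z z z) /\ s rMul x a q) /\ s rAdd q y t) /\ s rAdd z t p)) <->
  (exists u v : 'I_n, [/\ x = u, y = v & p = b1 + (u * n + v)]).
Proof.
move=> [_ [_ [_ [addE mulE]]]] nE bE pN xN yN; split.
  case=> a [aN [z [zN [q [qN [t [tN]]]]]]].
  rewrite nE // bE // addE // addE // mulE //.
  move=> [[[[[[-> xn] yn] ->] <-] <-] <-].
  by exists (Ordinal xn), (Ordinal yn).
case=> u [v [-> -> E]]; move: pN; rewrite {}E => pN.
have nN : n < N by rewrite size_encode /b4 /b3 /b2 /b1 /m; lia.
have uN := ord_lt_N u; have vN := ord_lt_N v.
exists n; split=> //; exists b1; split; first by lia.
exists (u * n); split; first by lia.
exists (u * n + v); split; first by lia.
rewrite nE // bE; last by lia.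
by rewrite !addE ?mulE ?ltn_ord //; lia.
Qed.

Lemma decodeP s : arith_ok w s -> decoded (exec w (sets decode_defs) s).
Proof.
move=> ar0; set s' := exec w (sets decode_defs) s.
(* The decoding assigns none of the arithmetic relations. *)
have ar : arith_ok w s'.
  by move: ar0; rewrite /arith_ok /s' ![exec w (sets decode_defs) s _]exec_frame.
have [eqE [zeroE [sucE [addE mulE]]]] := ar.
have := exec_sets w s (isT : single_assignment decode_defs).
rewrite -/s' /= => -[nE [mE [kE [b1E [b2E [b3E [b4E [gE [nmE [lE [f0E [frE
  [spE [swE _]]]]]]]]]]]]]].
have NE := size_encode; have nk := nk_gt0.
have [[[h1 h2] h3] h4] := encode_head.
have [nN kN mN] : [/\ n < N, k < N & m < N].
  by rewrite NE /b4 /b3 /b2 /b1 /m; split; lia.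
have [b1N b2N b3N b4N] : [/\ b1 < N, b2 < N, b3 < N & b4 < N].
  by rewrite NE /b4 /b3 /b2 /b1 /m; split; lia.
have {}nE x : s' rN x x x <-> x = n.
  rewrite nE; split=> [[xf none]|->].
    case: (ltngtP x n) => // lt; first by rewrite h1 in xf.
    by case: none; exists n; rewrite h2.
  by rewrite h2; split=> // -[t [_ [tn]]]; rewrite h1.
have {}mE x : x < N -> s' rM x x x <-> x = m.
  move=> xN; rewrite mE; split=> [[xf [a [aN [[]]]]]|->].
    rewrite nE => -> nx none; case: (ltngtP x m) => // lt.
      by rewrite h3 in xf.
    case: none; exists m; rewrite h4; split=> //; split=> //; split=> //.
    by rewrite /m; lia.
  rewrite h4; split=> //; exists n; split=> //; split.
    by rewrite nE /m; split=> //; lia.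
  by case=> t [_ [[nt tm]]]; rewrite h3.
have {}kE x : x < N -> s' rK x x x <-> x = k.
  move=> xN; rewrite kE; split=> [[a [aN [b [bN [c [cN [[[]]]]]]]]]|->].
    by rewrite nE mE // sucE // addE // => -> -> ->; rewrite /m; lia.
  exists n; split=> //; exists n.+1; split; first by rewrite /m in mN; lia.
  exists m; split=> //; have n1 : n.+1 < N by rewrite /m in mN; lia.
  by rewrite nE mE // sucE // addE // /m; split=> //; lia.
have {}b1E x : x < N -> s' rB1 x x x <-> x = b1.
  move=> xN; rewrite b1E; split=> [[a [aN []]]|->].
    by rewrite mE // sucE // => ->.
  by exists m; rewrite mE // sucE.
have {}b2E x : x < N -> s' rB2 x x x <-> x = b2.
  move=> xN; rewrite b2E; split=> [[a [aN [q [qN [b [bN [[[]]]]]]]]]|->].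
    by rewrite nE b1E // mulE // addE // => -> <- -> <-.
  have lt : n * n < N by rewrite /b2 in b2N; lia.
  exists n; split=> //; exists (n * n); split=> //; exists b1; split=> //.
  by rewrite nE mulE // b1E // addE.
have {}b3E x : x < N -> s' rB3 x x x <-> x = b3.
  move=> xN; rewrite b3E.
  split=> [[a [aN [c [cN [q [qN [b [bN [[[[]]]]]]]]]]]]|->].
    by rewrite nE kE // b2E // mulE // addE // => -> -> <- -> <-.
  have lt : n * k < N by lia.
  exists n; split=> //; exists k; split=> //; exists (n * k); split=> //.
  by exists b2; split=> //; rewrite nE kE // mulE // b2E // addE.
have {}b4E x : x < N -> s' rB4 x x x <-> x = b4.
  move=> xN; rewrite b4E.
  split=> [[a [aN [c [cN [q [qN [b [bN [[[[]]]]]]]]]]]]|->].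
    by rewrite nE kE // b3E // mulE // addE // => -> -> <- -> <-.
  have lt : n * k < N by lia.
  exists n; split=> //; exists k; split=> //; exists (n * k); split=> //.
  by exists b3; split=> //; rewrite nE kE // mulE // b3E // addE.
have nE' x : x < N -> s' rN x x x <-> x = n by [].
have {}gE x y : x < N -> y < N -> s' rG x y y <->
    exists u v : 'I_n, [/\ x = u, y = v & graph I u v].
  move=> xN yN; rewrite gE; split=> [[p [pN [pw]]]|[u [v [xu yv uv]]]].
    move/(exists_edge ar nE' b1E pN xN yN) => [u [v [xu yv pE]]].
    by exists u, v; rewrite -encode_graph -pE.
  have pN : b1 + (u * n + v) < N.
    by rewrite NE /b4 /b3 /b2; have := ltn_ord u; have := ltn_ord v; nia.
  exists (b1 + (u * n + v)); split=> //; split; first by rewrite encode_graph.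
  by apply/(exists_edge ar nE' b1E pN xN yN); exists u, v.
have le2 : b2 + n * k <= N by rewrite NE /b4 /b3; lia.
have le3 : b3 + n * k <= N by rewrite NE /b4; lia.
have le4 : b4 + n * k <= N by rewrite NE; lia.
have {}nmE p x y : p < N -> x < N -> y < N -> s' rName p x y <->
    exists (v : 'I_n) (c : 'I_k), [/\ x = v, y = c & p = name v c].
  move=> pN xN yN; rewrite nmE.
  exact: (entryP ar nE' kE b2E le2 pN xN yN).
have {}lE x y : x < N -> y < N -> s' rL x y y <->
    exists (v : 'I_n) (c : 'I_k), [/\ x = v, y = c & c \in lists I v].
  move=> xN yN; rewrite lE; split=> [[p [pN [pw]]]|[v [c [xv yc cL]]]].
    move/(nmE _ _ _ pN xN yN) => [v [c [xv yc pE]]].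
    by exists v, c; rewrite -encode_lists -/(name v c) -pE.
  exists (name v c); split; first exact: name_lt_N.
  split; first by rewrite encode_lists.
  by apply/nmE => //; [exact: name_lt_N | exists v, c].
have {}f0E x y : x < N -> y < N -> s' rF0 x y y <->
    exists v : 'I_n, x = v /\ y = Defs.col0 I v.
  move=> xN yN; rewrite f0E; split=> [[p [pN [pw]]]|[v [xv yc]]].
    move/(entryP ar nE' kE b3E le3 pN xN yN) => [v [c [xv yc pE]]].
    by exists v; split=> //; move: pw; rewrite pE encode_col0 => /eqP->.
  have pN : b3 + (v * k + Defs.col0 I v) < N by have := matrix_lt v (Defs.col0 I v); lia.
  exists (b3 + (v * k + Defs.col0 I v)); split=> //.
  split; first by rewrite encode_col0 eqxx.
  by apply/(entryP ar nE' kE b3E le3 pN xN yN); exists v, (Defs.col0 I v).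
have {}frE x y : x < N -> y < N -> s' rFr x y y <->
    exists v : 'I_n, x = v /\ y = colr I v.
  move=> xN yN; rewrite frE; split=> [[p [pN [pw]]]|[v [xv yc]]].
    move/(entryP ar nE' kE b4E le4 pN xN yN) => [v [c [xv yc pE]]].
    by exists v; split=> //; move: pw; rewrite pE encode_colr => /eqP->.
  have pN : b4 + (v * k + colr I v) < N by have := matrix_lt v (colr I v); lia.
  exists (b4 + (v * k + colr I v)); split=> //.
  split; first by rewrite encode_colr eqxx.
  by apply/(entryP ar nE' kE b4E le4 pN xN yN); exists v, (colr I v).
have gO (u v : 'I_n) : s' rG u v v <-> graph I u v.
  split=> [/gE|uv]; last by apply/gE; rewrite ?ord_lt_N //; exists u, v.
  by case=> [||x [y [/val_inj-> /val_inj->]]]; rewrite ?ord_lt_N.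
have gI (u : 'I_n) y : y < N -> s' rG u y y -> exists2 v : 'I_n, y = v & graph I u v.
  move=> yN /gE; case=> [||x [v [/val_inj-> yv uv]]]; rewrite ?ord_lt_N //.
  by exists v.
have spO (v : 'I_n) : s' rSp v v v <-> v \in spine_of.
  rewrite spE inE; split=> [[a [aN [[_ _] nl]]]|nl].
    apply/negP => /existsP[y /and3P[vy /forallP uy oy]]; case: nl.
    exists y; split; first exact: ord_lt_N.
    split; first split; first exact/gO.
      case=> y' [y'N [/gI[//|z -> vz]]]; apply; apply/eqE; congr val.
      by apply/eqP; have /implyP := uy z; apply.
    case/orP: oy => [/existsP[z /andP[zv yz]]|lt]; last by right.
    left; exists z; split; first exact: ord_lt_N.
    split; last exact/gO.
    by move=> /eqE/val_inj E; rewrite E eqxx in zv.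
  exists n; split=> //; rewrite nE; split; first by split=> //; apply: ltn_ord.
  case=> y [yN [[/gI[//|x -> vx] none] oy]]; case/negP: nl; apply/existsP.
  exists x; rewrite vx /=; apply/andP; split.
    apply/forallP => z; apply/implyP => vz; apply: contraT => zx.
    case: none; exists z; split; first exact: ord_lt_N.
    split; first exact/gO.
    by move=> /eqE/val_inj E; rewrite E eqxx in zx.
  case: oy => [[z [zN [zv /gI[//|u zu xu]]]]|lt]; apply/orP; [left|by right].
  apply/existsP; exists u; rewrite xu andbT; apply/eqP => E; apply: zv.
  by apply/eqE; rewrite zu E.
have {}spE x : x < N -> s' rSp x x x <-> exists v : 'I_n, x = v /\ v \in spine_of.
  move=> xN; split=> [h|[v [-> vs]]]; last exact/spO.
  have xn : x < n.
    by have /spE[a [_ [[/nE-> lt] _]]] := h.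
  by exists (Ordinal xn); split=> //; apply/spO.
have lO (v : 'I_n) (c : 'I_k) : s' rL v c c <-> c \in lists I v.
  split=> [/lE|vc]; last by apply/lE; rewrite ?ord_lt_N ?color_lt_N //; exists v, c.
  by case=> [||x [y [/val_inj-> /val_inj->]]]; rewrite ?ord_lt_N ?color_lt_N.
have leafE (v l : 'I_n) (a b : 'I_k) :
    (exists c, c < N /\ ((s' rL l c c /\ ~ s' rEq c a a) /\ ~ s' rEq c b b)) <->
    [exists c, [&& c \in lists I l, c != a & c != b]].
  split=> [[c [cN [[/lE]]]]|/existsP[c /and3P[cl ca cb]]].
    case=> [||l' [c' [/val_inj-> -> cl]]]; rewrite ?ord_lt_N // !eqE => ca cb.
    apply/existsP; exists c'; rewrite cl /=.
    by apply/andP; split; apply/eqP => E; [apply: ca | apply: cb]; rewrite E.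
  exists c; split; first exact: color_lt_N.
  rewrite lO !eqE; split; first split=> //.
    by move=> /val_inj E; rewrite E eqxx in ca.
  by move=> /val_inj E; rewrite E eqxx in cb.
do 7!split=> //; move=> x y z xN yN zN; rewrite swE; split.
  case=> -[/(lE _ _ xN yN)[v [a [-> -> va]]] /(lE _ _ (ord_lt_N v) zN)].
  case=> v' [b [/val_inj<- -> vb]] nl.
  exists v, a, b; split=> //; rewrite /switch va vb /=; apply/forallP => l.
  apply/implyP => /andP[vl ll]; apply: contraT => no; case: nl.
  exists l; split; first exact: ord_lt_N.
  split; last by rewrite leafE //; exact/negP.
  by rewrite gO spO inE ll.
case=> v [a [b [-> -> -> /and3P[va vb /forallP h]]]].
split; first by split; apply/lO.
case=> l [lN [[/(gI _ _ lN)[u -> vu]]]].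
rewrite spO inE => /negP/negPn lu; apply; rewrite leafE //.
by have := h u; rewrite vu lu.
Qed.

End Decode.

(** * The algorithm *)

(* rTau holds the names of the classes of the target coloring; the relations
   from rNCol on are the values of rCol, rAdj, rTau and rProc after the next
   vertex, and rClass (p, z) says that the new class p restricts to z. *)
Notation rValid := 20 (only parsing).
Notation rRoot := 21 (only parsing).
Notation rAdj := 22 (only parsing).
Notation rTau := 23 (only parsing).
Notation rCol := 24 (only parsing).
Notation rPar := 25 (only parsing).
Notation rProc := 26 (only parsing).
Notation rCur := 27 (only parsing).
Notation rCand := 28 (only parsing).
Notation rNext := 29 (only parsing).
Notation rAvoid := 30 (only parsing).
Notation rReach := 31 (only parsing).
Notation rNCol := 32 (only parsing).
Notation rClass := 33 (only parsing).
Notation rNAdj := 34 (only parsing).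
Notation rNTau := 35 (only parsing).
Notation rNProc := 36 (only parsing).

Definition init_defs : seq (nat * fm) :=
  [:: def1 rValid (fun p => rZero.[p]);
      def1 rRoot (fun p => rZero.[p]);
      def2 rAdj (fun p q => rZero.[p] && rZero.[q]);
      def1 rTau (fun p => rZero.[p])]%fof.

(** A path is continued as long as possible. A new one is begun at a vertex with at most one
    unprocessed spine neighbor, that is, at an end of a remaining path. *)
Definition next_defs : seq (nat * fm) :=
  [:: def1 rCand (fun v => rSp.[v] && ~~ rProc.[v] &&
        ((EX u, rCur.[u] && rG.[u, v]) ||
         (~~ (EX u x, rCur.[u] && rG.[u, x] && (rSp.[x] && ~~ rProc.[x])) &&
          ~~ (EX x y, rG.[v, x] && (rSp.[x] && ~~ rProc.[x]) && rG.[v, y] &&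
                (rSp.[y] && ~~ rProc.[y]) && (x < y)))));
      def1 rNext (fun v => rCand.[v] && ~~ (EX x, (x < v) && rCand.[x]))]%fof.

Definition reach_defs : seq (nat * fm) :=
  [:: def2 rAvoid (fun p d => rValid.[p] && ~~ (EX u v,
        rCur.[u] && rNext.[v] && rG.[u, v] && rCol.[p, d]));
      def3 rReach (fun d p q => rEq.[p, q] && rAvoid.[p, d])]%fof.

Definition reach_step : prog :=
  sets [:: def3 rReach (fun d p q => rReach.[d, p, q] ||
    (EX r, rReach.[d, p, r] && (rAvoid.[q, d] && rAdj.[r, q])))]%fof.

(** [rNCol], [rClass] and [rNAdj] transcribe the hypotheses [C'E], [ClassE] and [A'E] of the
    abstract extension. *)
Definition class_defs : seq (nat * fm) :=
  [:: def2 rNCol (fun p d => EX v, rNext.[v] && rSw.[v, d, d] &&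
        ((rName.[p, v, d] && (EX r, rRoot.[r] && rAvoid.[r, d])) ||
         (rPar.[p, d] && rAvoid.[p, d])));
      def2 rClass (fun p z => EX d, rNCol.[p, d] && (rReach.[d, p, z] ||
        ((EX v, rNext.[v] && rName.[p, v, d]) &&
         (EX r, rRoot.[r] && rReach.[d, r, z]))));
      def2 rNAdj (fun p q => EX v d d' z, rNext.[v] && rNCol.[p, d] &&
        rNCol.[q, d'] && rSw.[v, d, d'] && rClass.[p, z] && rClass.[q, z]);
      def1 rNTau (fun p => EX v c z, rNext.[v] && rFr.[v, c] &&
        rNCol.[p, c] && rTau.[z] && rClass.[p, z]);
      def1 rNProc (fun x => rProc.[x] || rNext.[x])]%fof.

(** The contradictory formula empties [rPar], as the language has no constant for falsity. *)
Definition root_defs : seq (nat * fm) :=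
  [:: def1 rRoot (fun p => EX v c, rNext.[v] && rF0.[v, c] && rName.[p, v, c]);
      def1 rValid (fun p => rRoot.[p]);
      def2 rPar (fun p c => rRoot.[p] && ~~ rRoot.[p])]%fof.

(** Runs before [valid_step], so it records a parent color exactly for the names about to enter. The
    parent is the least adjacent name already present, which gives a breadth-first tree. *)
Definition par_step : prog :=
  sets [:: def2 rPar (fun p c => rPar.[p, c] || (~~ rValid.[p] &&
    (EX q, rValid.[q] && rNAdj.[q, p] && rNCol.[q, c] &&
       ~~ (EX q', (q' < q) && (rValid.[q'] && rNAdj.[q', p])))))]%fof.

Definition valid_step : prog :=
  sets [:: def1 rValid (fun p => rValid.[p] ||
    (EX q, rValid.[q] && rNAdj.[q, p]))]%fof.

(** At this point [rValid] is that of the new graph, so [rTau] keeps only names reached from the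
    root. *)
Definition copy_defs : seq (nat * fm) :=
  [:: def2 rCol (fun p c => rNCol.[p, c]);
      def2 rAdj (fun p q => rNAdj.[p, q]);
      def1 rTau (fun p => rValid.[p] && rNTau.[p]);
      def1 rProc (fun x => rNProc.[x]);
      def1 rCur (fun x => rNext.[x])]%fof.

Definition exists_next : fm := (EX v, rNext.[v])%fof 0.

Definition extend : prog :=
  Seq (sets reach_defs) (Seq (Rep reach_step) (Seq (sets class_defs)
    (Seq (sets root_defs) (Seq (Rep (Seq par_step valid_step))
      (sets copy_defs))))).

Definition body : prog := Seq (sets next_defs) (When exists_next extend).

Definition algorithm : prog :=
  Seq arithmetic (Seq (sets decode_defs) (Seq (sets init_defs) (Rep body))).

Definition accept : fm := (EX p, rTau.[p])%fof 0.

(** * The two fixed-point iterations: components and spanning tree *)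

Section Loops.
Variable w : seq bool.
Local Notation N := (size w).

Lemma reach_loopP (s : store) :
  (forall d p q, s rReach d p q <-> p = q /\ s rAvoid p d d) ->
  let s' := exec w (Rep reach_step) s in
  [/\ forall d p, s rAvoid p d d -> s' rReach d p p,
      forall d p q q', d < N -> p < N -> q < N -> q' < N -> s' rReach d p q ->
        s rAvoid q' d d -> s rAdj q q' q' -> s' rReach d p q' &
      forall d p (Q : nat -> Prop), (s rAvoid p d d -> Q p) ->
        (forall q q', q < N -> Q q -> s rAvoid q d d -> s rAvoid q' d d ->
           s rAdj q q' q' -> Q q') ->
        forall q, s' rReach d p q -> Q q].
Proof.
move=> init s'; pose st t := iter t (exec w reach_step) s.
have {s'}-> : s' = st N by [].
have fr t r : r != rReach -> st t r = s r.
  move=> ne; elim: t => //= t IH; rewrite -[RHS]IH.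
  by apply: (@exec_frame w r reach_step); rewrite /= orbF.
have stS t d p q : st t.+1 rReach d p q <-> st t rReach d p q \/
    exists r, [/\ r < N, st t rReach d p r & s rAvoid q d d /\ s rAdj r q q].
  rewrite [st t.+1]iterS -/(st t).
  apply: iff_trans (exec_setP _ _ _ _ _ _ _) _ => /=.
  rewrite (fr t rAvoid) // (fr t rAdj) //.
  by split=> [[|[r [? []]]]|[|[r []]]]; [left|right; exists r|left|right; exists r].
split.
- move=> d p ap; elim: (N) => [|t IH]; first exact/init.
  by apply/(stS t); left.
- move=> d p q q' dN pN qN q'N pq aq' qq'.
  apply: (@closed_iter w (fun t q => st t rReach d p q)
           (fun r q => s rAvoid q d d /\ s rAdj r q q)) pq _ => //.
- move=> d p Q base step.
  suff h t q : st t rReach d p q -> s rAvoid q d d /\ Q q by move=> q /h[].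
  elim: t q => [|t IH] q; first by move=> /init[<- ap]; split=> //; apply: base.
  case/(stS t)=> [/IH//|[r [rN /IH[ar Qr] [aq rq]]]].
  by split=> //; apply: step rq.
Qed.

Lemma tree_loopP (s : store) :
  (forall p, s rValid p p p <-> s rRoot p p p) ->
  (forall p c, ~ s rPar p c c) ->
  let s' := exec w (Rep (Seq par_step valid_step)) s in
  [/\ forall p, s rRoot p p p -> s' rValid p p p,
      forall p q, p < N -> q < N -> s' rValid p p p -> s rNAdj p q q ->
        s' rValid q q q,
      forall Q : nat -> Prop, (forall p, s rRoot p p p -> Q p) ->
        (forall p q, p < N -> s' rValid p p p -> Q p -> s rNAdj p q q -> Q q) ->
        forall p, s' rValid p p p -> Q p,
      forall (B : pred nat) z, z < N -> s' rValid z z z -> B z ->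
        (forall r, r < N -> s rRoot r r r -> ~~ B r) ->
        exists y q, [/\ y < N, q < N, s' rValid y y y /\ s' rValid q q q,
          B y /\ ~~ B q & s rNAdj q y y /\
            forall c, s rNCol q c c -> s' rPar y c c] &
      (forall p c c', p < N -> c < N -> c' < N -> s rNCol p c c ->
         s rNCol p c' c' -> c = c') ->
      forall p c c', c < N -> c' < N -> s' rPar p c c -> s' rPar p c' c' -> c = c'].
Proof.
move=> vr par0 s'; pose st t := iter t (exec w (Seq par_step valid_step)) s.
have {s'}-> : s' = st N by [].
have fr t r : r != rPar -> r != rValid -> st t r = s r.
  move=> ne ne'; elim: t => //= t IH; rewrite -[RHS]IH.
  by apply: (@exec_frame w r (Seq par_step valid_step)); rewrite /= !orbF negb_or ne.
have vS t p : st t.+1 rValid p p p <-> st t rValid p p p \/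
    exists q, [/\ q < N, st t rValid q q q & s rNAdj q p p].
  rewrite [st t.+1]iterS -/(st t).
  rewrite -[exec w (Seq _ _) _]/(exec w valid_step (exec w par_step (st t))).
  have fr' r : r != rPar -> exec w par_step (st t) r = st t r.
    by move=> ne; apply: exec_frame; rewrite /= orbF.
  set s1 := exec w par_step (st t) in fr' *.
  apply: iff_trans (exec_setP _ _ _ _ _ _ _) _ => /=.
  rewrite (fr' rValid) // (fr' rNAdj) // (fr t rNAdj) //.
  by split=> [[|[q [? []]]]|[|[q []]]]; [left|right; exists q|left|right; exists q].
have pS t p c : st t.+1 rPar p c c <-> st t rPar p c c \/
    (~ st t rValid p p p /\ exists q,
      [/\ q < N, st t rValid q q q, s rNAdj q p p, s rNCol q c c &
          ~ exists q', q' < N /\ q' < q /\ st t rValid q' q' q' /\ s rNAdj q' p p]).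
  rewrite [st t.+1]iterS -/(st t).
  rewrite -[exec w (Seq _ _) _]/(exec w valid_step (exec w par_step (st t))).
  rewrite (@exec_frame w rPar valid_step) //.
  apply: iff_trans (exec_setP _ _ _ _ _ _ _) _ => /=.
  rewrite (fr t rNAdj) // (fr t rNCol) //.
  split=> [[|[nv [q [? [[[]]]]]]]|[|[nv [q []]]]].
  - by left.
  - by right; split=> //; exists q.
  - by left.
  - by move=> qN vq qp qc no; right; split=> //; exists q.
have mono t t' p : t <= t' -> st t rValid p p p -> st t' rValid p p p.
  move=> le vp; rewrite -(subnK le); elim: (t' - t) => // j IH.
  by rewrite addSn; apply/vS; left.
split.
- by move=> p rp; apply: (@mono 0) => //; apply/vr.
- move=> p q pN qN vp pq.
  apply: (@closed_iter w (fun t q => st t rValid q q q) (fun r q => s rNAdj r q q))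
    vp pq => // t x xN; exact: vS.
- move=> Q base step.
  suff h t p : t <= N -> st t rValid p p p -> Q p by move=> p; apply: h.
  elim: t p => [|t IH] p tN; first by move/vr; apply: base.
  case/vS=> [|[q [qN vq qp]]]; first by apply: IH; apply: ltnW.
  apply: (step q) => //; first by apply: mono vq; apply: ltnW.
  by apply: IH => //; apply: ltnW.
- suff h t (B : pred nat) z : z < N -> st t rValid z z z -> B z ->
      (forall r, r < N -> s rRoot r r r -> ~~ B r) ->
      exists y q, [/\ y < N, q < N, st t rValid y y y /\ st t rValid q q q,
        B y /\ ~~ B q & s rNAdj q y y /\
          forall c, s rNCol q c c -> st t rPar y c c].
    by move=> B z; apply: h.
  elim: t B z => [|t IH] B z zN vz Bz nB.
    by have := nB z zN (proj1 (vr z) vz); rewrite Bz.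
  have lift x : x < N -> st t rValid x x x -> B x ->
      exists y q, [/\ y < N, q < N,
        st t.+1 rValid y y y /\ st t.+1 rValid q q q, B y /\ ~~ B q &
        s rNAdj q y y /\ forall c, s rNCol q c c -> st t.+1 rPar y c c].
    move=> xN vx Bx; have [y [q [yN qN [vy vq] By [qy par]]]] := IH B x xN vx Bx nB.
    exists y, q; split=> //; first by split; apply/vS; left.
    by split=> // c qc; apply/pS; left; apply: par.
  have [vz'|nvz] := boolP (st t rValid z z z); first exact: lift vz' Bz.
  case/vS: vz => [vz|]; first by rewrite vz in nvz.
  case=> q0 [q0N vq0 q0z].
  have ex : exists q, [&& q < N, st t rValid q q q & s rNAdj q z z].
    by exists q0; rewrite q0N vq0.
  (* The least neighbor already present is the one that [par_step] selected. If it lies in [B], it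
     takes the place of [z]. *)
  case: (ex_minnP ex) => q /and3P[qN vq qz] min.
  have [Bq|nBq] := boolP (B q); first exact: lift vq Bq.
  exists z, q; split=> //.
    by split; apply/vS; [right; exists q | left].
  split=> // c qc; apply/pS; right; split; first exact/negP.
  exists q; split=> // -[q' [q'N [lt [vq' q'z]]]].
  by have := min q'; rewrite q'N vq' q'z leqNgt lt => /(_ isT).
- move=> cf.
  (* The first clause, that only names which have entered have a recorded color, excludes a second
     record in a later round. *)
  suff h t : (forall p c, st t rPar p c c -> st t rValid p p p) /\
      forall p c c', c < N -> c' < N -> st t rPar p c c -> st t rPar p c' c' -> c = c'.
    by have [_] := h N.
  elim: t => [|t [IHv IHc]]; first by split=> [p c /par0|p c c' _ _ /par0].
  split=> [p c|p c c' cN c'N].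
    case/pS=> [/IHv vp|[_ [q [qN vq qp _ _]]]]; apply/vS; first by left.
    by right; exists q.
  case/pS=> [pc|[np [q [qN vq qp qc no]]]];
    case/pS=> [pc'|[np' [q' [q'N vq' q'p q'c' no']]]].
  + exact: (IHc p).
  + by case: np'; apply: IHv pc.
  + by case: np; apply: IHv pc'.
  + have E : q = q'.
      case: (ltngtP q q') => // lt.
        by case: no'; exists q.
      by case: no; exists q'.
    by apply: (cf q) => //; rewrite E.
Qed.

End Loops.

(** * Correctness of the algorithm *)

Section Main.
Variable I : instance.
Local Notation n := (nv I).
Local Notation k := (nc I).
Local Notation w := (encode I).
Local Notation N := (size (encode I)).
Local Notation G := (graph I).
Local Notation L := (lists I).
Local Notation f0 := (Defs.col0 I).
Local Notation fr := (colr I).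
Local Notation S := (spine_of I).
Hypotheses (n0 : 0 < n) (k0 : 0 < k).
Hypothesis degree2 : forall u x y z, x \in S -> y \in S -> z \in S ->
  G u x -> G u y -> G u z -> [|| x == y, x == z | y == z].
Hypothesis degenerate1 : forall U : {set 'I_n}, U != set0 -> exists2 v, v \in U &
  forall x y, x \in U -> y \in U -> G v x -> G v y -> x = y.

Definition R1 (s : store) r p : Prop := p < N /\ s r p p p.
Definition R2 (s : store) r p q : Prop := [/\ p < N, q < N & s r p q q].

Definition decoded_state (s : store) (P : {set 'I_n}) (cur : option 'I_n) : Prop :=
  [/\ decoded I s, forall v : 'I_n, s rProc v v v <-> v \in P &
      forall x, x < N -> s rCur x x x <-> exists2 u, cur = Some u & x = u :> nat].

Definition unprocessed (P : {set 'I_n}) : {set 'I_n} := S :\: P.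

(* The processed vertices form a prefix in an order along the paths of the
   spine: only the current vertex, and at most one edge at it, lead out of P. *)
Definition prefix_order (P : {set 'I_n}) (cur : option 'I_n) : Prop :=
  (forall x y, x \in P -> y \in unprocessed P -> G x y -> cur = Some x) /\
  (forall u x y, cur = Some u -> x \in unprocessed P -> y \in unprocessed P ->
     G u x -> G u y -> x = y).

(** The last clause, on the origin of the names, makes the names belonging to an unprocessed vertex
    fresh. *)
Definition state_graph (s : store) (P : {set 'I_n}) cur cls r : Prop :=
  [/\ class_graph G L f0 fr N P cur cls (R1 s rValid) (R2 s rAdj) (R2 s rCol) r
        (R1 s rTau) (R2 s rPar),
      forall x, x < N -> s rRoot x x x <-> x = r &
      forall p, R1 s rValid p ->
        p = 0 \/ exists2 v, v \in P & exists c : 'I_k, p = name I v c].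

Definition loop_inv (s : store) (P : {set 'I_n}) : Prop :=
  exists cur cls r, [/\ P \subset S, decoded_state s P cur, prefix_order P cur &
    state_graph s P cur cls r].

Lemma graphO s (u v : 'I_n) : decoded I s -> s rG u v v <-> G u v.
Proof.
case=> _ [_ [gE _]]; rewrite gE ?ord_lt_N //; split=> [[x [y]]|uv].
  by case=> /val_inj-> /val_inj->.
by exists u, v.
Qed.

Lemma spineO s (v : 'I_n) : decoded I s -> s rSp v v v <-> v \in S.
Proof.
case=> _ [_ [_ [_ [_ [_ [spE _]]]]]]; rewrite spE ?ord_lt_N //.
by split=> [[x [/val_inj->]]|vs] //; exists v.
Qed.

Lemma graphI s (u : 'I_n) y :
  decoded I s -> y < N -> s rG u y y -> exists2 v : 'I_n, y = v & G u v.
Proof.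
case=> _ [_ [gE _]] yN /gE; case=> [||x [v [/val_inj-> yv uv]]];
  by rewrite ?ord_lt_N //; exists v.
Qed.

Definition candidate P cur (v : 'I_n) : Prop :=
  v \in unprocessed P /\
  ((exists2 u, cur = Some u & G u v) \/
   ((forall u x, cur = Some u -> x \in unprocessed P -> ~ G u x) /\
    (forall x y, x \in unprocessed P -> y \in unprocessed P ->
       G v x -> G v y -> x = y))).

Lemma unprocessedO s P cur (v : 'I_n) : decoded_state s P cur ->
  (s rSp v v v /\ ~ s rProc v v v) <-> v \in unprocessed P.
Proof.
case=> ds pE _; rewrite spineO // pE in_setD andbC.
by split=> [[-> /negP->]|/andP[-> /negP]].
Qed.

Lemma cand_defP s P cur : decoded_state s P cur ->
  satisfies w s next_defs ->
  (forall v : 'I_n, s rCand v v v <-> candidate P cur v) /\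
  (forall x, x < N -> s rCand x x x -> x < n).
Proof.
move=> st; have [ds pE cE] := st; move=> /= [candE _].
have inS x : x < N -> s rSp x x x -> exists2 v : 'I_n, x = v & v \in S.
  by case: ds => _ [_ [_ [_ [_ [_ [spE _]]]]]] xN /(spE _ xN)[v []]; exists v.
split=> [v|x xN]; last first.
  by rewrite candE => -[[/(inS _ xN)[v -> _] _] _]; apply: ltn_ord.
rewrite candE (unprocessedO _ st); split=> -[uv h]; split=> //.
  case: h => [[x [xN [/(cE _ xN)[u cu ->] /(graphO _ _ ds) uv']]]|[no1 no2]].
    by left; exists u.
  right; split=> [u x cu ux gx|x y ux uy vx vy].
    apply: no1; exists u; split; first exact: ord_lt_N.
    exists x; split; first exact: ord_lt_N.
    split; last exact/(unprocessedO _ st).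
    by split; [apply/cE; [exact: ord_lt_N | exists u] | exact/graphO].
  apply: val_inj; case: (ltngtP x y) => // lt; case: no2.
    exists x; split; first exact: ord_lt_N.
    exists y; split; first exact: ord_lt_N.
    by rewrite !(graphO _ _ ds) !(unprocessedO _ st).
  exists y; split; first exact: ord_lt_N.
  exists x; split; first exact: ord_lt_N.
  by rewrite !(graphO _ _ ds) !(unprocessedO _ st).
case: h => [[u cu gu]|[no1 no2]].
  left; exists u; split; first exact: ord_lt_N.
  by split; [apply/cE; [exact: ord_lt_N | exists u] | exact/graphO].
right; split.
  case=> a [aN [x [xN [[/(cE _ aN)[u cu ->]]]]]].
  move/(graphI ds xN) => [y -> uy] /(unprocessedO _ st) uy'.
  exact: no1 cu uy' uy.
case=> x [xN [y [yN [[[[]]]]]]].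
move/(graphI ds xN) => [x' -> vx] /(unprocessedO _ st) ux.
move/(graphI ds yN) => [y' -> vy] /(unprocessedO _ st) uy.
by rewrite (no2 x' y') // ltnn.
Qed.

(** When the current path cannot be continued, [degenerate1] applied to the unprocessed spine
    supplies a vertex with at most one neighbor there. *)
Lemma next_defP s P cur : decoded_state s P cur ->
  satisfies w s next_defs ->
  (forall x, x < N -> s rNext x x x ->
     exists v : 'I_n, [/\ x = v, candidate P cur v &
       forall y, y < N -> s rNext y y y -> y = v]) /\
  (unprocessed P != set0 -> exists2 x, x < N & s rNext x x x).
Proof.
move=> st sat; have [candE lt] := cand_defP st sat.
move: sat => /= [_ [nextE _]].
have uniq x y : x < N -> y < N -> s rNext x x x -> s rNext y y y -> y = x.
  move=> xN yN /nextE[cx nx] /nextE[cy ny].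
  case: (ltngtP y x) => // l; first by case: nx; exists y.
  by case: ny; exists x.
split=> [x xN nx|ne].
  have /nextE[cx _] := nx; exists (Ordinal (lt x xN cx)); split=> //=.
    exact/candE.
  by move=> y yN; apply: uniq.
have [v cv] : exists v, candidate P cur v.
  have [v vU vmin] := degenerate1 ne.
  case Ec : cur => [u|]; last first.
    by exists v; split=> //; right; split=> // x y; apply: vmin.
  case: (pickP [pred x | (x \in unprocessed P) && G u x]) => [x /andP[ux gx]|no].
    by exists x; split=> //; left; exists u.
  exists v; split=> //; right; split; last by move=> x y; apply: vmin.
  move=> u' x [<-] xU ux; have := no x; by rewrite /= xU ux.
have ex : exists x, (x < N) && s rCand x x x.
  by exists v; rewrite ord_lt_N //; apply/candE.
case: (ex_minnP ex) => x /andP[xN cx] min; exists x => //.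
apply/nextE; split=> // -[y [yN [yx cy]]].
by have := min y; rewrite yN cy => /(_ isT); lia.
Qed.

(** If [v] continues a path, one of its at most two spine neighbors is the previous vertex, which
    leaves at most one unprocessed. If [v] begins a path, this holds by the choice of [v]. *)
Lemma prefix_order_next (P : {set 'I_n}) cur v : P \subset S -> prefix_order P cur ->
  (forall u, cur = Some u -> u \in P) -> candidate P cur v ->
  [/\ v \notin P, forall x, x \in P -> G x v -> cur = Some x,
      v |: P \subset S & prefix_order (v |: P) (Some v)].
Proof.
move=> PS [o1 o2] curP [vU cv].
have [vS vP] : v \in S /\ v \notin P by move: vU; rewrite in_setD => /andP[].
have sub x : x \in unprocessed (v |: P) -> x \in unprocessed P /\ x != v.
  by rewrite !in_setD in_setU1 negb_or => /andP[/andP[-> ->] ->].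
split=> //; first by move=> x xP; apply: o1.
  by rewrite subUset sub1set vS.
split=> [x y xP' /sub[yU yv] xy|u x y [<-] /sub[xU xv] /sub[yU yv] vx vy].
  (* A processed [x] other than [v] would be the old current vertex, whose only unprocessed
     neighbor, if any, is [v] and not [y]. *)
  case: (eqVneq x v) => [->//|xv]; exfalso.
  have xP : x \in P by move: xP'; rewrite !inE (negPf xv).
  have cx := o1 x y xP yU xy.
  case: cv => [[u]|[no _]]; last exact: no cx yU xy.
  rewrite cx => -[<-] xv'; move: yv.
  by rewrite (o2 x y v) ?eqxx.
case: cv => [[u' cu uv]|[_ uniq]]; last exact: uniq.
have xS : x \in S by move: xU; rewrite in_setD => /andP[].
have yS : y \in S by move: yU; rewrite in_setD => /andP[].
have vu : G v u' by rewrite adj_sym.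
have uP := curP u' cu.
have notP z : z \in unprocessed P -> u' != z.
  by move=> zU; apply: contraTneq zU => <-; rewrite in_setD uP.
have := degree2 (subsetP PS u' uP) xS yS vu vx vy.
by rewrite (negPf (notP x xU)) (negPf (notP y yU)) /= => /eqP.
Qed.

(** * One round of the main loop carries out the abstract extension *)

Section Extension.
Variables (s1 : store) (P : {set 'I_n}) (cur : option 'I_n)
  (cls : nat -> {ffun 'I_n -> 'I_k} -> Prop) (r : nat) (v : 'I_n).
Hypotheses (st1 : decoded_state s1 P cur) (sg1 : state_graph s1 P cur cls r).
Hypothesis nextE : forall x, x < N -> s1 rNext x x x <-> x = v.
Hypotheses (vP : v \notin P) (nbr_v : forall x, x \in P -> G x v -> cur = Some x).

Let s2 := exec w (sets reach_defs) s1.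
Let s3 := exec w (Rep reach_step) s2.
Let s4 := exec w (sets class_defs) s3.
Let s5 := exec w (sets root_defs) s4.
Let s6 := exec w (Rep (Seq par_step valid_step)) s5.
Let s7 := exec w (sets copy_defs) s6.

Lemma frame2 q : ~~ writes q (sets reach_defs) -> s2 q = s1 q.
Proof. exact: exec_frame. Qed.
Lemma frame3 q : ~~ writes q (Rep reach_step) -> s3 q = s2 q.
Proof. exact: exec_frame. Qed.
Lemma frame4 q : ~~ writes q (sets class_defs) -> s4 q = s3 q.
Proof. exact: exec_frame. Qed.
Lemma frame5 q : ~~ writes q (sets root_defs) -> s5 q = s4 q.
Proof. exact: exec_frame. Qed.
Lemma frame6 q : ~~ writes q (Rep (Seq par_step valid_step)) -> s6 q = s5 q.
Proof. exact: exec_frame. Qed.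
Lemma frame7 q : ~~ writes q (sets copy_defs) -> s7 q = s6 q.
Proof. exact: exec_frame. Qed.

Lemma sat2 : satisfies w s2 reach_defs.
Proof. exact: exec_sets. Qed.
Lemma sat4 : satisfies w s4 class_defs.
Proof. exact: exec_sets. Qed.
Lemma sat5 : satisfies w s5 root_defs.
Proof. exact: exec_sets. Qed.
Lemma sat7 : satisfies w s7 copy_defs.
Proof. exact: exec_sets. Qed.

Let CG := let: And3 h _ _ := sg1 in h.
Let rootE := let: And3 _ h _ := sg1 in h.
Let names := let: And3 _ _ h := sg1 in h.
Let V := R1 s1 rValid.
Let C := R2 s1 rCol.
Let avoid := avoids G cur V C v.

Lemma decoded1 : decoded I s1.
Proof. by case: st1. Qed.

Lemma root_lt : r < N.
Proof. by have [] := cg_root CG => -[]. Qed.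

Lemma avoidE p d : p < N -> d < N -> s2 rAvoid p d d <-> avoid p d.
Proof.
move=> pN dN; have [ds _ curE] := st1.
have [/= aE _] := sat2.
rewrite aE.
rewrite (frame2 (q := rValid)) // (frame2 (q := rCur)) // (frame2 (q := rNext)) //.
rewrite (frame2 (q := rG)) // (frame2 (q := rCol)) //.
split=> [[vp no]|[[_ vp] no]].
  split=> // u cu uv [_ _ cp]; apply: no; exists u; split; first exact: ord_lt_N.
  exists v; split; first exact: ord_lt_N.
  split=> //; split; last exact/graphO.
  by split; [apply/curE; [exact: ord_lt_N | exists u] | apply/nextE; rewrite ?ord_lt_N].
split=> // -[a [aN [b [bN [[[/(curE _ aN)[u cu ->] /(nextE bN)->]]]]]]].
by move/(graphO _ _ ds) => uv cp; apply: (no u cu uv); split.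
Qed.

Definition Reach d p q := [&& d < N, p < N, q < N & s3 rReach d p q].

Lemma dN d : d < k -> d < N.
Proof. by move=> dk; apply: (color_lt_N n0 k0 (Ordinal dk)). Qed.

Lemma reach_init d p q : s2 rReach d p q <-> p = q /\ s2 rAvoid p d d.
Proof.
have [_ [/= rE _]] := sat2.
rewrite rE (frame2 (q := rEq)) //.
by have [eqE _] := decoded1; rewrite eqE.
Qed.

Lemma Reach_refl d p : d < k -> avoid p d -> Reach d p p.
Proof.
move=> /dN dN av; have [h _ _] := reach_loopP w reach_init.
have pN : p < N by case: av => -[].
by rewrite /Reach dN pN /=; apply: h; apply/avoidE.
Qed.

Lemma Reach_step d p q q' : d < k -> Reach d p q -> avoid q' d ->
  R2 s1 rAdj q q' -> Reach d p q'.
Proof.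
move=> /dN dN /and4P[_ pN qN pq] av [_ q'N adj].
have [_ h _] := reach_loopP w reach_init.
rewrite /Reach dN pN q'N /=; apply: (h d p q q') => //; exact/avoidE.
Qed.

Lemma Reach_ind d p (Q : nat -> Prop) : d < k -> (avoid p d -> Q p) ->
  (forall q q', Q q -> avoid q d -> avoid q' d -> R2 s1 rAdj q q' -> Q q') ->
  forall q, Reach d p q -> Q q.
Proof.
move=> /dN dN base step q /and4P[_ pN qN pq].
have [_ _ h] := reach_loopP w reach_init.
move: qN; apply: (h d p (fun q => q < N -> Q q)) pq => [av _|x y xN Qx ax ay xy yN].
  by apply: base; apply/avoidE.
apply: (step x y (Qx xN)); try exact/avoidE.
by split=> //; rewrite -(frame2 (q := rAdj)).
Qed.

Let nm := name I v.

Lemma nm_bound d : d < k -> nm d < N.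
Proof. by move=> dk; apply: (name_lt_N n0 k0 v (Ordinal dk)). Qed.

Lemma nm_inj d d' : d < k -> d' < k -> nm d = nm d' -> d = d'.
Proof.
by move=> dk dk' E; have [_ []] := @name_inj I n0 k0 v v (Ordinal dk) (Ordinal dk') E.
Qed.

(** Old names are 0 or belong to processed vertices, and [v] is not one of these. *)
Lemma nm_fresh d : d < k -> ~ V (nm d).
Proof.
move=> dk /names[E|[v' v'P [c E]]]; first by have := name_gt0 I v d; rewrite -/nm E.
have [E' _] := @name_inj I n0 k0 v v' (Ordinal dk) c E.
by move: vP; rewrite E' v'P.
Qed.

Let C' := R2 s7 rCol.
Let Class := R2 s4 rClass.
Let A' := R2 s7 rAdj.
Let V' := R1 s7 rValid.
Let Tau' := R1 s7 rTau.
Let Par' := R2 s7 rPar.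

Lemma C'_ncol p d : C' p d <-> R2 s4 rNCol p d.
Proof.
have [/= cE _] := sat7.
rewrite /C' /R2; split=> -[pN dN'].
  by rewrite cE frame7 // frame6 // frame5.
by move=> h; split=> //; rewrite cE frame7 // frame6 // frame5.
Qed.

Lemma A'_nadj p q : A' p q <-> R2 s4 rNAdj p q.
Proof.
have [_ [/= cE _]] := sat7.
rewrite /A' /R2; split=> -[pN dN'].
  by rewrite cE frame7 // frame6 // frame5.
by move=> h; split=> //; rewrite cE frame7 // frame6 // frame5.
Qed.

Lemma nameE p x y : p < N -> x < N -> y < N -> s1 rName p x y <->
  exists (v : 'I_n) (c : 'I_k), [/\ x = v, y = c & p = name I v c].
Proof. by have [_ [_ [_ [h _]]]] := decoded1; apply: h. Qed.

Lemma switchO (a b : 'I_k) : s1 rSw v a b <-> switch G L v a b.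
Proof.
have [_ [_ [_ [_ [_ [_ [_ h]]]]]]] := decoded1.
rewrite h ?ord_lt_N ?color_lt_N //; split=> [[x [y [z]]]|sw]; last by exists v, a, b.
by case=> /val_inj-> /val_inj-> /val_inj->.
Qed.

Lemma C'E p d : C' p d <-> exists d' : 'I_k,
  [/\ d = d', switch G L v d' d' & (p = nm d /\ avoid r d) \/
      (R2 s1 rPar p d /\ avoid p d)].
Proof.
rewrite C'_ncol.
have [/= cE _] := sat4.
have f q : ~~ writes q (sets class_defs) -> ~~ writes q (Rep reach_step) ->
    s4 q = s2 q by move=> h1 h2; rewrite frame4 // frame3.
have f1 q : ~~ writes q (sets class_defs) -> ~~ writes q (Rep reach_step) ->
    ~~ writes q (sets reach_defs) -> s4 q = s1 q.
  by move=> h1 h2 h3; rewrite f // frame2.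
split=> [[pN dN'] |[d' [-> sw h]]].
  rewrite cE (f1 rNext) // (f1 rSw) // (f1 rName) // (f1 rRoot) // (f1 rPar) //.
  rewrite (f rAvoid) //.
  case=> x [xN [[/(nextE xN)-> sw] h]].
  have [d' dE sw'] : exists2 d' : 'I_k, d = d' & switch G L v d' d'.
    have [_ [_ [_ [_ [_ [_ [_ h']]]]]]] := decoded1.
    have [|||x' [a [b [/val_inj-> -> /val_inj->]]]] := proj1 (h' v d d _ _ _) sw;
      rewrite ?ord_lt_N //.
    by exists b.
  exists d'; split=> //.
  have vN := ord_lt_N n0 k0 v.
  case: h => [[/(nameE pN vN dN')[v' [c [/val_inj<- dc pE]]]]|[pd ap]].
    case=> y [yN [/(rootE yN)-> ay]]; left; split; first by rewrite dc.
    by apply/avoidE; rewrite ?root_lt.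
  by right; split=> //; apply/avoidE.
have dN' : d' < N by exact: color_lt_N.
have pN : p < N.
  by case: h => [[-> _]|[[]]] //; apply: nm_bound.
split=> //; rewrite cE (f1 rNext) // (f1 rSw) // (f1 rName) // (f1 rRoot) //.
rewrite (f1 rPar) // (f rAvoid) //.
exists v; split; first exact: ord_lt_N.
split; first by split; [apply/nextE; rewrite ?ord_lt_N | exact/switchO].
case: h => [[pE ar]|[[_ _ pd] ap]].
  left; split; first by apply/nameE; rewrite ?ord_lt_N //; exists v, d'.
  exists r; split; first exact: root_lt.
  by split; [apply/rootE | apply/avoidE]; rewrite ?root_lt.
by right; split=> //; apply/avoidE.
Qed.

Lemma ClassE p z : Class p z <-> exists d,
  C' p d /\ (Reach d p z \/ (p = nm d /\ Reach d r z)).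
Proof.
have [_ [/= cE _]] := sat4.
have f1 q : ~~ writes q (sets class_defs) -> ~~ writes q (Rep reach_step) ->
    ~~ writes q (sets reach_defs) -> s4 q = s1 q.
  by move=> h1 h2 h3; rewrite frame4 // frame3 // frame2.
split=> [[pN zN]|[d [pd h]]].
  rewrite cE (f1 rNext) // (f1 rName) // (f1 rRoot) // (frame4 (q := rReach)) //.
  case=> d [dN' [pd h]]; exists d; split; first by apply/C'_ncol.
  case: h => [h|[[x [xN [/(nextE xN)-> nmx]]] [y [yN [/(rootE yN)-> h]]]]].
    by left; rewrite /Reach dN' pN zN.
  right; split; last by rewrite /Reach dN' root_lt zN.
  by have [|||v' [c [/val_inj<- -> pE]]] := proj1 (nameE _ _ _) nmx;
    rewrite ?ord_lt_N.
have [pN dN' npd] := proj1 (C'_ncol p d) pd.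
have zN : z < N by case: h => [/and4P[]|[_ /and4P[]]].
split=> //; rewrite cE (f1 rNext) // (f1 rName) // (f1 rRoot) //.
rewrite (frame4 (q := rReach)) //; exists d; split=> //; split=> //.
case: h => [/and4P[]|[pE /and4P[_ _ _ h]]]; first by left.
right; split; last first.
  exists r; split; first exact: root_lt.
  by split=> //; apply/rootE; rewrite ?root_lt.
exists v; split; first exact: ord_lt_N.
split; first by apply/nextE; rewrite ?ord_lt_N.
have /C'E[d' [dE _ _]] := pd.
by apply/nameE; rewrite ?ord_lt_N //; exists v, d'; rewrite -dE.
Qed.

Lemma A'E p q : A' p q <-> exists d d' : 'I_k,
  [/\ C' p d, C' q d', switch G L v d d' & exists z, Class p z /\ Class q z].
Proof.
have [_ [_ [/= cE _]]] := sat4.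
have f1 x : ~~ writes x (sets class_defs) -> ~~ writes x (Rep reach_step) ->
    ~~ writes x (sets reach_defs) -> s4 x = s1 x.
  by move=> h1 h2 h3; rewrite frame4 // frame3 // frame2.
rewrite A'_nadj; split=> [[pN qN]|[d [d' [pd qd' sw [z [pz qz]]]]]].
  rewrite cE (f1 rNext) // (f1 rSw) //.
  case=> x [xN [d [dN' [d' [d'N [z [zN]]]]]]].
  move=> [[[[[/(nextE xN)-> pd] qd'] sw] pz] qz].
  have pd1 : C' p d by apply/C'_ncol.
  have qd1 : C' q d' by apply/C'_ncol.
  have /C'E[c [cE' _ _]] := pd1; have /C'E[c' [cE'' _ _]] := qd1.
  exists c, c'; rewrite -cE' -cE''; split=> //.
    by apply/switchO; rewrite -cE' -cE''.
  by exists z.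
have [pN _ pd1] := proj1 (C'_ncol _ _) pd; have [qN _ qd1] := proj1 (C'_ncol _ _) qd'.
split=> //; rewrite cE (f1 rNext) // (f1 rSw) //.
exists v; split; first exact: ord_lt_N.
exists d; split; first exact: color_lt_N.
exists d'; split; first exact: color_lt_N.
have [_ zN pz'] := pz; have [_ _ qz'] := qz.
exists z; split=> //; do 5?split=> //; last exact/switchO.
by apply/nextE; rewrite ?ord_lt_N.
Qed.

Lemma root5 p : p < N -> s5 rRoot p p p <-> p = nm (f0 v).
Proof.
move=> pN; have [/= rE _] := sat5.
rewrite rE.
have f1 x : ~~ writes x (sets root_defs) -> ~~ writes x (sets class_defs) ->
    ~~ writes x (Rep reach_step) -> ~~ writes x (sets reach_defs) -> s5 x = s1 x.
  by move=> h0 h1 h2 h3; rewrite frame5 // frame4 // frame3 // frame2.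
rewrite (f1 rNext) // (f1 rF0) // (f1 rName) //.
have [_ [_ [_ [_ [f0E _]]]]] := decoded1.
split=> [[x [xN [c [cN [[/(nextE xN)-> /f0E]]]]]]|->].
  case=> [||v' [/val_inj<- ->]]; rewrite ?ord_lt_N // => h.
  by have [|||v'' [c' [/val_inj<- /val_inj<-]]] := proj1 (nameE _ _ _) h;
    rewrite ?ord_lt_N ?color_lt_N.
exists v; split; first exact: ord_lt_N.
exists (f0 v); split; first exact: color_lt_N.
split; first split.
- by apply/nextE; rewrite ?ord_lt_N.
- by apply/f0E; rewrite ?ord_lt_N ?color_lt_N //; exists v.
- apply/nameE; rewrite ?ord_lt_N ?color_lt_N //; first exact: nm_bound.
  by exists v, (f0 v).
Qed.

Lemma tree5 : (forall p, s5 rValid p p p <-> s5 rRoot p p p) /\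
  (forall p c, ~ s5 rPar p c c).
Proof.
have [_ [/= vE [pE _]]] := sat5.
by split=> [p|p c]; rewrite ?vE // pE => -[].
Qed.

Let r' := nm (f0 v).

Lemma V'_root : V' r'.
Proof.
have [h1 h2] := tree5; have [h _ _ _ _] := tree_loopP w h1 h2.
have rN' : r' < N by exact: nm_bound.
by split=> //; rewrite frame7 //; apply: h; apply/root5.
Qed.

Lemma nadj5 : s5 rNAdj = s4 rNAdj.
Proof. exact: frame5. Qed.

Lemma V'_step p q : V' p -> q < N -> A' p q -> V' q.
Proof.
move=> [pN vp] qN /A'_nadj[_ _ pq]; split=> //; rewrite frame7 //.
have [h1 h2] := tree5; have [_ h _ _ _] := tree_loopP w h1 h2.
exact: (h p q).
Qed.

Lemma V'_ind (Q : nat -> Prop) : Q r' ->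
  (forall p q, V' p -> Q p -> q < N -> A' p q -> Q q) -> forall p, V' p -> Q p.
Proof.
move=> base step p [pN]; rewrite frame7 // => vp.
have [h1 h2] := tree5; have [_ _ h _ _] := tree_loopP w h1 h2.
move: pN; apply: (h (fun p => p < N -> Q p)) vp => [x xr xN|x y xN vx Qx xy yN].
  by have -> : x = r' by exact/root5.
apply: (step x y) => //; first exact: Qx.
by apply/A'_nadj; split=> //; rewrite -nadj5.
Qed.

Lemma Tau'E p : Tau' p <->
  [/\ V' p, C' p (fr v) & exists z, R1 s1 rTau z /\ Class p z].
Proof.
have [_ [_ [/= tE _]]] := sat7.
have [_ [_ [_ [/= ntE _]]]] := sat4.
have f1 x : ~~ writes x (sets class_defs) -> ~~ writes x (Rep reach_step) ->
    ~~ writes x (sets reach_defs) -> s4 x = s1 x.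
  by move=> h1 h2 h3; rewrite frame4 // frame3 // frame2.
have tauE x : s7 rNTau x x x <-> s4 rNTau x x x.
  by rewrite frame7 // frame6 // frame5.
have [_ [_ [_ [_ [_ [frE _]]]]]] := decoded1.
split=> [[pN]|[[pN vp] pd [z [[zN tz] [_ _ pz]]]]].
  rewrite tE tauE ntE (f1 rNext) // (f1 rFr) // (f1 rTau) //.
  case=> vp [x [xN [c [cN [z [zN [[[[/(nextE xN)-> /frE]]]]]]]]]].
  case=> [||v' [/val_inj<- ->]]; rewrite ?ord_lt_N // => pd tz pz.
  split=> //; first by apply/C'_ncol; split=> //; apply: color_lt_N.
  by exists z.
split=> //; rewrite tE tauE ntE (f1 rNext) // (f1 rFr) // (f1 rTau) //.
split=> //; exists v; split; first exact: ord_lt_N.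
exists (fr v); split; first exact: color_lt_N.
exists z; split=> //; do 4?split=> //.
- by apply/nextE; rewrite ?ord_lt_N.
- by apply/frE; rewrite ?ord_lt_N ?color_lt_N //; exists v.
- by have /C'_ncol[] := pd.
Qed.

Lemma tree' (B : pred nat) z : V' z -> B z -> ~~ B r' -> exists y q,
  [/\ V' y, V' q, B y, ~~ B q & A' q y /\ forall c, C' q c -> Par' y c].
Proof.
move=> [zN vz] Bz nB; have [h1 h2] := tree5.
have [_ _ _ h _] := tree_loopP w h1 h2; rewrite frame7 // in vz.
have [|y [q [yN qN [vy vq] [By nBq] [qy par]]]] := h B z zN vz Bz.
  by move=> x xN /root5->.
exists y, q; split=> //; try by split=> //; rewrite frame7.
split; first by apply/A'_nadj; split=> //; rewrite -nadj5.
move=> c /C'_ncol[_ cN qc]; split=> //; rewrite frame7 //.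
by apply: par; rewrite frame5.
Qed.

Lemma par' y c c' : V' y -> Par' y c -> Par' y c' -> c = c'.
Proof.
move=> _ [yN cN yc] [_ c'N yc']; rewrite frame7 // in yc yc'.
have [h1 h2] := tree5; have [_ _ _ _ h] := tree_loopP w h1 h2.
apply: (h _ y c c') => // p d d' pN dN' d'N pd pd'.
apply: (C'_fun CG nm_inj nm_fresh C'E (p := p)); exact/C'_ncol.
Qed.

Lemma exec_extend : exec w extend s1 = s7.
Proof. by rewrite /extend; do 5!rewrite exec_Seq. Qed.

Lemma extension_graph :
  exists cls', state_graph (exec w extend s1) (v |: P) (Some v) cls' r'.
Proof.
have vf0 : valid G L (v |: P) f0 by apply: list_coloring_valid; apply: col0P.
have vfr : valid G L (v |: P) fr by apply: list_coloring_valid; apply: colrP.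
have V'_bound p : V' p -> p < N by case.
rewrite exec_extend; eexists; split.
- exact: (class_graph_extend CG vP nbr_v vf0 vfr nm_bound nm_inj nm_fresh
    Reach_refl Reach_step Reach_ind C'E ClassE A'E V'_root V'_step V'_ind V'_bound
    Tau'E tree' par').
- by move=> x xN; rewrite frame7 // frame6 // root5.
(* A name reached by [A'] carries a color, so by [C'E] it is fresh and belongs to [v], or it is an
   old name. *)
- apply: V'_ind => [|p q _ _ qN /A'E[d [d' [_ /C'E[c [dE _ h]] _ _]]]].
    by right; exists v; [rewrite !inE eqxx | exists (f0 v)].
  case: h => [[-> _]|[_ [Vq _]]].
    by right; exists v; [rewrite !inE eqxx | exists d'].
  have [->|[x xP [e qE]]] := names Vq; first by left.
  by right; exists x; [rewrite !inE xP orbT | exists e].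
Qed.

Lemma extension_decoded : decoded_state (exec w extend s1) (v |: P) (Some v).
Proof.
rewrite exec_extend.
have f1 x : ~~ writes x extend -> s7 x = s1 x.
  by rewrite -exec_extend; apply: exec_frame.
have [ds pE _] := st1.
have [_ [_ [_ [/= prE [cuE _]]]]] := sat7.
have [_ [_ [_ [_ [/= npE _]]]]] := sat4.
split.
- by move: ds; rewrite /decoded !f1.
- move=> x; rewrite prE frame7 // frame6 // frame5 // npE frame4 // frame3 // frame2 //.
  rewrite frame4 // frame3 // frame2 // pE nextE ?ord_lt_N // !inE.
  by split=> [[->|/val_inj->]|/orP[/eqP->|->]]; rewrite ?eqxx ?orbT; auto.
- move=> x xN; rewrite cuE frame7 // frame6 // frame5 // frame4 // frame3 // frame2 //.
  by rewrite nextE //; split=> [->|[u [<-]]] //; exists v.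
Qed.

End Extension.

(** As long as the spine has unprocessed vertices a next one exists and the processed set grows;
    afterwards the [When] leaves the round idle. *)
Lemma body_inv s P : loop_inv s P -> exists P', loop_inv (exec w body s) P' /\
  (P = S /\ P' = P \/ #|P| < #|P'|).
Proof.
move=> [cur [cls [r [PS st po sg]]]]; pose s1 := exec w (sets next_defs) s.
have fr1 x : ~~ writes x (sets next_defs) -> s1 x = s x by apply: exec_frame.
have st1 : decoded_state s1 P cur.
  by move: st; rewrite /decoded_state /decoded !fr1.
have sg1 : state_graph s1 P cur cls r.
  by move: sg; rewrite /state_graph /R1 /R2 !fr1.
have sat := exec_sets w s (isT : single_assignment next_defs).
have [nextP nextE] := next_defP st1 sat.
have -> : exec w body s = if eval w s1 [::] exists_next then exec w extend s1 else s1.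
  by rewrite /body exec_Seq.
case: holdsP => [[x [xN nx]]|no].
  have [v [xE cv uniq]] := nextP x xN nx.
  have [CG _ _] := sg.
  have [vP nbr vPS po'] := prefix_order_next PS po (cg_cur CG) cv.
  have nE y : y < N -> s1 rNext y y y <-> y = v.
    by move=> yN; split=> [/(uniq y yN)|->]; [|rewrite -xE].
  have [cls' sg'] := extension_graph st1 sg1 nE vP nbr.
  have st' := extension_decoded st1 nE.
  exists (v |: P); split; last by right; rewrite cardsU1 vP.
  exists (Some v), cls'; eexists.
  by split; [exact: vPS|exact: st'|exact: po'|exact: sg'].
exists P; split.
  by exists cur, cls, r; split; [exact: PS|exact: st1|exact: po|exact: sg1].
left; split; last by [].
apply/eqP; rewrite eqEsubset PS /= -setD_eq0.
by apply: contraT => /nextE[x xN nx]; case: no; exists x.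
Qed.

(** Once the whole spine is processed, [cg_cover] and [cg_reach] show that some class contains the
    target if and only if the target is reachable on the spine; [connect_reconf_spine] puts the
    leaves back. *)
Lemma algorithmP : answer w algorithm accept = reconfigurable I.
Proof.
pose s0 := exec w (sets decode_defs) (exec w arithmetic (fun _ _ _ _ => false)).
pose s1 := exec w (sets init_defs) s0.
have d0 : decoded I s0 by apply: decodeP => //; apply: arithmeticP.
have fr1 x : ~~ writes x (sets init_defs) -> s1 x = s0 x by apply: exec_frame.
have zero x : ~~ writes x (sets decode_defs) -> ~~ writes x arithmetic ->
    ~~ writes x (sets init_defs) -> s1 x = fun _ _ _ => false.
  by move=> h1 h2 h3; rewrite fr1 // /s0 !exec_frame.
have d1 : decoded I s1 by move: d0; rewrite /decoded !fr1.
have [_ [zeroE _]] := d1.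
have := exec_sets w s0 (isT : single_assignment init_defs).
rewrite -/s1 /= => -[vE [rE [aE [tE _]]]].
have N0 : 0 < N by apply: (leq_ltn_trans _ (ord_lt_N n0 k0 (Ordinal n0))).
have inv1 : loop_inv s1 set0.
  exists None, (fun _ _ => True), 0; split.
  - exact: sub0set.
  - split=> //; first by move=> v; rewrite zero // inE.
    by move=> x xN; rewrite zero //; split=> // -[].
  - by split=> [x y|u x y //]; rewrite inE.
  - split.
    + apply: class_graph0 => //.
      * move=> p; rewrite /R1 vE; split=> [[pN /(zeroE _ pN)]|->] //.
        by split=> //; apply/zeroE.
      * by split=> //; rewrite aE; split; apply/zeroE.
      * move=> p; rewrite /R1 tE; split=> [[pN /(zeroE _ pN)]|->] //.
        by split=> //; apply/zeroE.
      * by move=> y c [_ _]; rewrite zero.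
    + by move=> x xN; rewrite rE; apply: zeroE.
    + by move=> p [pN]; rewrite vE => /(zeroE _ pN)->; left.
have main t : exists P, loop_inv (iter t (exec w body) s1) P /\ (P = S \/ t <= #|P|).
  elim: t => [|t [P [inv h]]]; first by exists set0; split=> //; right.
  have [P' [inv' h']] := body_inv inv; exists P'; split=> //.
  case: h' => [[PS ->]|lt]; first by left.
  case: h => [PS|le]; last by right; apply: leq_ltn_trans lt.
  have [cur [cls [r [P'S _ _ _]]]] := inv'.
  by have := subset_leq_card P'S; rewrite -PS leqNgt lt.
have [P [[cur [cls [r [PS st po [CG _ _]]]]] full]] := main N.
(* [N] rounds suffice because the spine has at most [n] vertices and [n <= N]. *)
have {full} PE : P = S.
  case: full => // NP; apply/eqP; rewrite eqEcard PS /=.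
  apply: leq_trans NP; apply: leq_trans (max_card _) _; rewrite card_ord.
  have lt : n.-1 < n by lia.
  by have := ord_lt_N n0 k0 (Ordinal lt); rewrite /=; lia.
rewrite /reconfigurable connect_reconf_spine ?col0P ?colrP // -/S -PE.
have -> : answer w algorithm accept = eval w (iter N (exec w body) s1) [::] accept.
  by rewrite /answer /algorithm; do 3!rewrite exec_Seq; rewrite exec_Rep.
apply/holdsP/idP => [[p [pN tp]]|c].
  have /(cg_target CG)[Vp pfr] : R1 (iter N (exec w body) s1) rTau p by [].
  exact: (cg_reach CG Vp pfr).
have [p Vp pfr] := cg_cover CG c.
have [pN tp] : R1 (iter N (exec w body) s1) rTau p by apply/(cg_target CG).
by exists p.
Qed.

End Main.

Theorem theorem3 :
  polytime_solvable encode
    (fun I : instance => has_pathwidth (graph I) 1%R)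
    reconfigurable.
Proof.
(* The highest tape is that of relation 36, with code 3 + 4 * 36 = 147; the value 200 leaves some
   room. *)
have [||||M [P h]] := @program_polytime 200 algorithm accept.
- by [].
- by vm_compute.
- by [].
- by [].
exists M, P => I [[s dec ws] wmin].
have size0 : 0 < size (encode I) by rewrite /encode size_cat addn_gt0 orbC.
(* The empty decomposition of the graph without vertices has width -1, so this graph does not have
   pathwidth one. *)
have n0 : 0 < nv I.
  rewrite lt0n; apply/eqP => nv0.
  have no (v : 'I_(nv I)) : False by case: v => m; rewrite nv0.
  have : path_decomposition (graph I) [::].
    by split=> [|u|]; [apply/setP => v; case: (no v) | case: (no u) | ].
  by move/wmin; rewrite /width big_nil.
(* A vertex exists and is colored, so there is a color. *)
have k0 : 0 < nc I by apply: leq_ltn_trans (ltn_ord (Defs.col0 I (Ordinal n0))).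
have width2 X : X \in s -> #|X| <= 2.
  move=> Xs; have max2 : \max_(X <- s) #|X| = 2 by move: ws; rewrite /width; lia.
  by rewrite -max2; apply: leq_bigmax_seq.
rewrite -(algorithmP n0 k0); first exact: h.
  exact: (spine_degree dec width2).
exact: (degenerate dec width2).
Qed.
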